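(* Let $\rho\in V_0$. (a) For every $h\in\mathcal P^W$ one has $D_h=\exp(\operatorname{ad}L)(h)$, where $h$ on the right is regarded as a multiplication operator and $(\operatorname{ad}L)(X)=LX-XL$. (b) The map $h\mapsto D_h$ from $\mathcal P^W$ to difference operators is an algebra homomorphism. In particular, the $D_h$ ($h\in\mathcal P^W$) commute pairwise. (c) If $\rho$ is dominant, then the action of the operators $D_h$, $h\in\mathcal P^W$, on $\mathcal P^W$ is simultaneously diagonalizable. More precisely, if $\lambda\in\Lambda_+$ then $D_h(p_\lambda)=h(\rho+\lambda)p_\lambda$ for all $h\in\mathcal P^W$.
   Context: Let $\Gamma$ be a lattice of finite rank, $\Sigma\subset\Gamma$ a $\mathbb Z$-basis, $W\subseteq\mathrm{Aut}(\Gamma)$ a finite group and $\ell\in\Gamma$. Put $V=\mathrm{Hom}(\Gamma,\mathbb C)$ with the induced $W$-action; elements of $\Gamma$ are regarded as linear functions on $V$. $\mathcal P=S^\bullet(\Gamma\otimes\mathbb C)$ is the algebra of polynomial functions on $V$, $\mathcal P^W$ its $W$-invariants. $\Gamma^\vee=\mathrm{Hom}(\Gamma,\mathbb Z)\subset V$, $\Sigma^\vee\subset\Gamma^\vee$ is the basis dual to $\Sigma$, and $\Lambda_+=\sum_{\eta\in\Sigma^\vee}\mathbb N\eta$ ($0\in\mathbb N$). Axioms (standing assumptions): (C1) $W$ is generated by reflections on $V$. [Thus there is a unique root system $\Delta\subset\Gamma$ with reflection group $W$ all of whose roots are primitive vectors of $\Gamma$; $\alpha^\vee\in\Gamma^\vee$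 denotes the coroot of $\alpha\in\Delta$. Put $\Delta^+=\{\alpha\in\Delta\mid\alpha(\eta)\ge0\ \forall\eta\in\Sigma^\vee\}$, $\Phi=W\Sigma$, $\Phi^+=\{\omega\in\Phi\mid\omega(\eta)\ge0\ \forall\eta\in\Sigma^\vee\}$, $\Sigma_1^\vee=\{\eta\in\Sigma^\vee\mid\ell(\eta)=1\}$.] (C2) $\Delta=\Delta^+\cup(-\Delta^+)$. (C3) $\Phi\subseteq\Phi^+\cup(-\Phi^+)$. (C4) $\ell\in\Gamma^W$. (C5) $\sum_{\omega\in\Phi^+}\omega-\sum_{\alpha\in\Delta^+}\alpha=\ell$. (C6) $\ell(\eta)>0$ for all $\eta\in\Sigma^\vee$. (C7) If $\eta\in\Sigma_1^\vee$ and $\omega\in\Delta\cup\Phi$ then $\omega(\eta)\in\{-1,0,1\}$. (C8) Any $W$-invariant linear function on $V$ is uniquely determined by its restriction to $\Sigma_1^\vee$. (C9) There is a regular dominant $\rho\in V_0$ such that for every $\lambda\in\Lambda_+$ there is a unique $p\in\mathcal P^W$ of degree $\ell(\lambda)$ with $p(\rho+\mu)=\delta_{\lambda\mu}$ for all $\mu\in\Lambda_+$ with $\ell(\mu)\le\ell(\lambda)$. Here $\pm W$ is the group generated by $W$ and $-1$, and $V_0=\{\rho\in V\mid \omega_1(\rho)=\omega_2(\rho)\text{ whenever }\omega_1,\omega_2\in\Sigma,\ \omega_1\in\pm W\omega_2\}$. An element $\rho$ is dominant if $\alpha(\rho)\notin\mathbb Z_{<0}$ for all $\alpha\in\Delta^+$,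 and regular if $\alpha(\rho)\ne0$ for all $\alpha\in\Delta^+$. For $\rho\in V_0$ and $\omega\in\Phi\cup(-\Phi)$ put $k_\omega=\omega_1(\rho)$ for any $\omega_1\in\pm W\omega\cap\Sigma$. Operators (for given $\rho\in V_0$): $\Lambda_1=W\Sigma_1^\vee$; $\Lambda$ is the monoid generated by $\Lambda_1$; for $\eta\in\Lambda_1$, $f_\eta(z)=\prod_{\omega\in\Phi:\,\omega(\eta)>0}(\omega(z)-k_\omega)\Big/\prod_{\alpha\in\Delta:\,\alpha(\eta)>0}\alpha(z)$; $(T_\tau f)(z)=f(z-\tau)$ for $\tau\in\Gamma^\vee$; $L=\sum_{\eta\in\Lambda_1}f_\eta(z)T_\eta$. A path from $\lambda$ to $\mu$ is a sequence $\tau_*=(\tau_0,\dots,\tau_d)$ with $\tau_0=\lambda$, $\tau_d=\mu$, $\tau_i-\tau_{i-1}\in\Lambda_1$ for all $i$. For $h\in\mathcal P^W$ and $\tau\in\Lambda$ with $d=\ell(\tau)$ put $$b_\tau^h(z)=\sum_{\tau_*}\Big[\sum_{i=0}^d\frac{(-1)^{d-i}}{i!(d-i)!}h(z-\tau_i)\Big]f_{\tau_1-\tau_0}(z-\tau_0)\cdots f_{\tau_d-\tau_{d-1}}(z-\tau_{d-1}),$$ the sum being over all paths from $0$ to $\tau$. One has $b_\tau^h=0$ for $\ell(\tau)>\deg h$, so $D_h=\sum_{\tau\in\Lambda}b_\tau^h(z)T_\tau$ is a finite sum; likewise $(\operatorname{ad}L)^d(h)=0$ for $d>\deg h$, so $\exp(\operatorname{ad}L)(h)=\sum_{d\ge0}\frac1{d!}(\operatorname{ad}L)^d(h)$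 is a finite sum. For $\rho\in V_0$ dominant, $p_\lambda$ ($\lambda\in\Lambda_+$) denotes the unique element of $\mathcal P^W$ with $\deg p_\lambda\le\ell(\lambda)$ and $p_\lambda(\rho+\mu)=\delta_{\lambda\mu}$ for all $\mu\in\Lambda_+$ with $\ell(\mu)\le\ell(\lambda)$; these polynomials form a basis of $\mathcal P^W$. *)

(* Defs.v *)
From HB Require Import structures.
From mathcomp Require Import all_boot all_order all_algebra.
From mathcomp Require Import finmap.
From mathcomp Require Import complex.
From mathcomp Require Import reals.
From mathcomp Require Import mpoly.

Set Implicit Arguments.
Unset Strict Implicit.
Unset Printing Implicit Defensive.

Import Order.TTheory GRing.Theory Num.Theory.
Local Open Scope ring_scope.
Local Open Scope complex_scope.

(* The lattice Gamma is Z^n, written as column vectors; its dual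
   Gamma^vee = Hom(Gamma, Z) and V = Hom(Gamma, C) are written as row vectors,
   the pairing being the matrix product. [Sigma] is the matrix whose columns
   are the chosen Z-basis of Gamma, and [W] is a set of automorphisms of Gamma,
   acting on Gamma by left multiplication. [Delta] is a datum rather than a
   definition: [is_root_system] below characterizes it uniquely. *)
Record datum (n : nat) := Datum {
  Sigma : 'M[int]_n;
  W : {fset 'M[int]_n};
  ell : 'cV[int]_n;
  Delta : {fset 'cV[int]_n}
}.

Definition pairing n (eta : 'rV[int]_n) (omega : 'cV[int]_n) : int :=
  (eta *m omega) 0 0.

Section Lattice.

Context {n : nat} (G : datum n).
Implicit Types (eta mu lambda tau : 'rV[int]_n) (omega alpha : 'cV[int]_n).
Implicit Types (w s : 'M[int]_n).

Definition is_finite_automorphism_group : Prop :=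
  [/\ {in W G, forall w, w \in unitmx},
      1%:M \in W G,
      {in W G &, forall w w', w *m w' \in W G} &
      {in W G, forall w, invmx w \in W G}].

Definition sigma (i : 'I_n) : 'cV[int]_n := col i (Sigma G).

Definition sigma_dual (i : 'I_n) : 'rV[int]_n := row i (invmx (Sigma G)).

Definition Lambda_plus lambda : Prop :=
  exists c : 'I_n -> nat, lambda = \sum_i sigma_dual i *+ c i.

Definition generated_by (X : 'M[int]_n -> Prop) : Prop :=
  forall w, w \in W G -> exists2 ss : seq 'M[int]_n,
    forall s, s \in ss -> s \in W G /\ X s & w = \big[mulmx/1%:M]_(s <- ss) s.

Definition reflection_along alpha s : Prop :=
  exists2 coroot : 'rV[int]_n,
    pairing coroot alpha = 2%:Z & s = 1%:M - alpha *m coroot.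

Definition primitive omega : Prop :=
  forall (m : int) (omega' : 'cV[int]_n), omega = m *: omega' -> m = 1 \/ m = -1.

Definition is_root_system : Prop :=
  [/\ {in Delta G, forall alpha, primitive alpha},
      {in Delta G, forall alpha, exists2 s, s \in W G &
         reflection_along alpha s /\
         {in Delta G, forall beta, s *m beta \in Delta G}} &
      generated_by
        (fun s => exists2 alpha, alpha \in Delta G & reflection_along alpha s)].

Definition nonneg omega : bool := [forall i, 0 <= pairing (sigma_dual i) omega].

Definition Delta_plus : {fset 'cV[int]_n} :=
  [fset alpha in Delta G | nonneg alpha]%fset.

Definition Phi : {fset 'cV[int]_n} :=
  [fset (w *m sigma i)%R | w in W G, i in 'I_n]%fset.

Definition Phi_plus : {fset 'cV[int]_n} :=
  [fset omega in Phi | nonneg omega]%fset.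

Definition Sigma1_dual : {fset 'rV[int]_n} :=
  [fset sigma_dual i | i in 'I_n & pairing (sigma_dual i) (ell G) == 1%:Z]%fset.

(* The action on Gamma^vee is the contragredient one: (w eta)(omega) =
   eta (w^-1 omega). *)
Definition act_dual w eta : 'rV[int]_n := eta *m invmx w.

Definition Lambda1 : {fset 'rV[int]_n} :=
  [fset act_dual w eta | w in W G, eta in Sigma1_dual]%fset.

(* The elements of the monoid Lambda that are sums of d elements of Lambda1.
   As ell is W-invariant and equal to 1 on Lambda1, these are exactly the
   elements tau of Lambda with ell(tau) = d. *)
Fixpoint Lambda_deg (d : nat) : {fset 'rV[int]_n} :=
  if d is d'.+1
  then [fset (tau + eta)%R | tau in Lambda_deg d', eta in Lambda1]%fset
  else [fset 0%R]%fset.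

(* All the sequences [:: tau_0; ...; tau_d] with tau_0 = tau and
   tau_i - tau_(i-1) \in Lambda1. *)
Fixpoint paths (d : nat) tau : seq (seq 'rV[int]_n) :=
  if d is d'.+1
  then [seq tau :: p | eta <- enum_fset Lambda1, p <- paths d' (tau + eta)]
  else [:: [:: tau]].

Definition axiom_C2 : Prop :=
  Delta G = (Delta_plus `|` [fset (- alpha)%R | alpha in Delta_plus])%fset.

Definition axiom_C3 : Prop :=
  (Phi `<=` Phi_plus `|` [fset (- omega)%R | omega in Phi_plus])%fset.

Definition axiom_C4 : Prop := {in W G, forall w, w *m ell G = ell G}.

Definition axiom_C5 : Prop :=
  \sum_(omega <- Phi_plus) omega - \sum_(alpha <- Delta_plus) alpha = ell G.

Definition axiom_C6 : Prop := forall i, 0 < pairing (sigma_dual i) (ell G).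

Definition axiom_C7 : Prop :=
  forall eta omega, eta \in Sigma1_dual -> omega \in (Delta G `|` Phi)%fset ->
    pairing eta omega \in [:: -1; 0; 1].

End Lattice.

Section Polynomials.

Context {R : realType} {n : nat} (G : datum n).
Local Notation C := R[i].
Local Notation V := 'rV[C]_n.
Local Notation P := {mpoly C[n]}.
Local Notation K := {fraction {mpoly C[n]}}.

Definition toV (eta : 'rV[int]_n) : V := map_mx intr eta.

(* The value of omega \in Gamma, viewed as a linear function on V. *)
Definition linval (omega : 'cV[int]_n) (v : V) : C :=
  (v *m map_mx intr omega) 0 0.

Definition act_V (w : 'M[int]_n) : 'M[C]_n := map_mx intr (invmx w).

Definition is_reflection (g : 'M[C]_n) : Prop :=
  g *m g = 1%:M /\ \rank (g - 1%:M) = 1%N.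

Definition axiom_C1 : Prop := generated_by G (fun s => is_reflection (act_V s)).

(* Linear functions on V are the elements of Gamma (x) C. *)
Definition axiom_C8 : Prop :=
  forall f g : 'cV[C]_n,
    {in W G, forall w, map_mx intr w *m f = f} ->
    {in W G, forall w, map_mx intr w *m g = g} ->
    {in Sigma1_dual G, forall eta, toV eta *m f = toV eta *m g} ->
    f = g.

(* The variable 'X_i is the i-th standard basis vector of Gamma. *)
Definition evalV (p : P) (v : V) : C := p.@[fun i => v 0 i].

Definition W_invariant (p : P) : Prop :=
  forall w (v : V), w \in W G -> evalV p (v *m act_V w) = evalV p v.

Definition in_orbit_pm (omega omega' : 'cV[int]_n) : bool :=
  has (fun w => (omega == w *m omega') || (omega == - (w *m omega')))
      (enum_fset (W G)).

Definition in_V0 (rho : V) : Prop :=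
  forall i j, in_orbit_pm (sigma G i) (sigma G j) ->
    linval (sigma G i) rho = linval (sigma G j) rho.

Definition dominant (rho : V) : Prop :=
  forall alpha, alpha \in Delta_plus G ->
    forall m : int, m < 0 -> linval alpha rho <> m%:~R.

Definition regular (rho : V) : Prop :=
  forall alpha, alpha \in Delta_plus G -> linval alpha rho <> 0.

(* p(rho + mu) = delta_(lambda, mu) for all mu \in Lambda_+ with
   ell(mu) <= ell(lambda). *)
Definition interpolates (rho : V) (lambda : 'rV[int]_n) (p : P) : Prop :=
  forall mu, Lambda_plus G mu -> pairing mu (ell G) <= pairing lambda (ell G) ->
    evalV p (rho + toV mu) = (lambda == mu)%:R.

(* Recall that [msize p] is 1 + deg p. *)
Definition axiom_C9 : Prop :=
  exists rho : V, [/\ in_V0 rho, regular rho, dominant rho &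
    forall lambda, Lambda_plus G lambda ->
      exists! p : P, [/\ W_invariant p,
        (msize p)%:Z = pairing lambda (ell G) + 1 & interpolates rho lambda p]].

Definition is_p (rho : V) (lambda : 'rV[int]_n) (p : P) : Prop :=
  [/\ W_invariant p, (msize p)%:Z <= pairing lambda (ell G) + 1 &
      interpolates rho lambda p].

(* The family (p lambda), lambda \in Lambda_+, is a basis of the space of
   W-invariant polynomials. *)
Definition invariant_basis (p : 'rV[int]_n -> P) : Prop :=
  [/\ forall lambda, Lambda_plus G lambda -> W_invariant (p lambda),
      forall (s : seq 'rV[int]_n) (c : 'rV[int]_n -> C), uniq s ->
        (forall lambda, lambda \in s -> Lambda_plus G lambda) ->
        \sum_(lambda <- s) c lambda *: p lambda = 0 ->
        forall lambda, lambda \in s -> c lambda = 0 &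
      forall q, W_invariant q ->
        exists (s : seq 'rV[int]_n) (c : 'rV[int]_n -> C),
          (forall lambda, lambda \in s -> Lambda_plus G lambda) /\
          q = \sum_(lambda <- s) c lambda *: p lambda].

(* Difference operators are functions K -> K on the field K of rational
   functions on V. *)

Definition to_frac (p : P) : K := @FracField.tofrac P p.

(* The polynomial p(z - tau). *)
Definition shift_poly (tau : 'rV[int]_n) (p : P) : P :=
  p \mPo [tuple 'X_i - ((tau 0 i)%:~R)%:MP | i < n].

(* The operator T_tau, i.e. the field automorphism extending [shift_poly]. *)
Definition Ttr (tau : 'rV[int]_n) (f : K) : K :=
  to_frac (shift_poly tau \n_(repr f)) / to_frac (shift_poly tau \d_(repr f)).

Definition linpoly (omega : 'cV[int]_n) : P :=
  \sum_i ((omega i 0)%:~R : C) *: 'X_i.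

Section Operators.

Variable rho : V.

Definition k_ (omega : 'cV[int]_n) : C :=
  if [pick i | in_orbit_pm (sigma G i) omega] is Some i
  then linval (sigma G i) rho else 0.

Definition f_ (eta : 'rV[int]_n) : K :=
  (\prod_(omega <- Phi G | 0 < pairing eta omega)
     to_frac (linpoly omega - (k_ omega)%:MP)) /
  (\prod_(alpha <- Delta G | 0 < pairing eta alpha) to_frac (linpoly alpha)).

Definition Lop (f : K) : K := \sum_(eta <- Lambda1 G) f_ eta * Ttr eta f.

(* [t`_i] is the i-th vertex tau_i of the path t, and f_eta(z - tau_i) is
   Ttr tau_i (f_ eta). *)
Definition b_ (h : P) (tau : 'rV[int]_n) : K :=
  let d := `|pairing tau (ell G)|%N in
  \sum_(t <- paths G d 0 | last 0 t == tau)
    (\sum_(i < d.+1) (-1) ^+ (d - i) / ((i`! * (d - i)`!)%N)%:R *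
        to_frac (shift_poly t`_i h)) *
    \prod_(i < d) Ttr t`_i (f_ (t`_i.+1 - t`_i)).

(* The sum over tau \in Lambda, restricted to ell(tau) <= deg h since the
   other terms vanish. *)
Definition Dop (h : P) (f : K) : K :=
  \sum_(d < msize h) \sum_(tau <- Lambda_deg G d) b_ h tau * Ttr tau f.

Definition ad_L (X : K -> K) (f : K) : K := Lop (X f) - X (Lop f).

(* The exponential series, restricted to the exponents d <= deg h since the
   other terms vanish. *)
Definition exp_ad_L (h : P) (f : K) : K :=
  \sum_(d < msize h) (d`!%:R)^-1 * iter d ad_L (fun g => to_frac h * g) f.

End Operators.

End Polynomials.

Arguments axiom_C1 R {n} G.
Arguments axiom_C8 R {n} G.
Arguments axiom_C9 R {n} G.

(* Main.v *)
(* For [rho] in [V_0] put [A = ell - ell(rho) - L], acting on the W-invariant polynomials.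
   [A] does not raise degrees, and its action on leading terms does not depend on [rho].
   If [rho] is dominant, [L] maps an invariant vanishing on one level of [rho + Lambda_+] to
   an invariant vanishing on the next level; where roots vanish at the point considered, this
   needs a deformation of [rho] inside [V_0]. At the point given by (C9) this forces [A] to
   act as [m] on leading terms of degree [m], hence it does so for all [rho], and interpolation
   becomes unisolvent at every dominant [rho]: an invariant of degree at most [m] vanishing at
   all [rho + mu] with [ell(mu) < m] is an eigenvector of [A] for [m].

   The identity [D_h = exp(ad L)(h)] is a formal expansion over paths. If [h p_lambda] is the
   sum of eigenvectors [q_j] of [A] for [ell(lambda) + j], then [(ad L)^d (h) / d!] maps
   [p_lambda] to the sum of the [(-1)^d binomial(j, d) q_j], so that [exp(ad L)(h)] maps it to
   [q_0 = h(rho + lambda) p_lambda]. The identities of (b) thus hold on invariant polynomials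
   when [rho] is dominant. Both sides being polynomial in [t] along [rho + t p], where [p] is the
   sum of [Sigma^vee], and [rho + t p] being dominant for large integers [t], they hold there
   for all [rho]; and a difference operator that kills the invariant polynomials is zero, as
   translations are independent on them. *)

Require Import Defs.
From HB Require Import structures.
From mathcomp Require Import all_boot all_order all_algebra.
From mathcomp Require Import finmap generic_quotient.
From mathcomp Require Import complex.
From mathcomp Require Import reals.
From mathcomp Require Import mpoly.
From mathcomp Require Import ring lra zify.
Import Order.TTheory GRing.Theory Num.Theory.
Local Open Scope ring_scope.
Local Open Scope complex_scope.
Set Implicit Arguments.
Unset Strict Implicit.
Unset Printing Implicit Defensive.

(** The obstacle is a point [rho + nu] at which roots vanish: the coefficients [f_eta] have poles
    there, so the vanishing of their numerators, which confines [L] to [rho + Lambda_+], gives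
    nothing term by term. Dominance forces these roots to vanish on [rho] and on [nu] separately.
    The sum over [Lambda_1] is therefore cut into orbits of the common stabilizer of [rho] and [nu],
    whose partial sums are already regular at the point. When [rho] moves along [p], at most one
    term of each orbit survives, because conjugate elements of [Lambda_+] coincide; an orbit sum is
    then a regular function times a single translate of the polynomial, and this factorization
    persists in the limit. That conjugate elements coincide is itself deduced from interpolation at
    a regular point, so the regular theory has to come before the singular one. Limits are algebraic
    throughout: polynomials are compared at the large integers of a line. *)

Lemma poly_eq0_infinite (F : idomainType) (x : nat -> F) (q : {poly F}) :
  injective x -> (forall k, q.[x k] = 0) -> q = 0.
Proof.
move=> injx q0; apply/eqP; apply: contraT => nzq.
have := max_poly_roots (rs := [seq x k | k <- iota 0 (size q)]) nzq.
rewrite map_inj_uniq // iota_uniq size_map size_iota ltnn => /(_ _ isT) -> //.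
by apply/allP => y /mapP [k _ ->]; apply/eqP.
Qed.

(** * Polynomials vanishing at natural points *)

Section Grid.

Variable F : numDomainType.

Lemma mwiden_eval n (p : {mpoly F[n]}) (v : 'I_n.+1 -> F) :
  (mwiden p).@[v] = p.@[fun i => v (widen_ord (leqnSn n) i)].
Proof.
elim/mpolyind: p => [|c m p _ _ IH]; first by rewrite mwiden0 !meval0.
rewrite mwidenD !mevalD IH mwidenZ !mevalZ mwidenX !mevalX; congr (c * _ + _).
rewrite big_ord_recr /= mnmwiden_ordmax expr0 mulr1.
by apply: eq_bigr => i _; rewrite mnmwiden_widen.
Qed.

Lemma mpoly_univariate n (p : {mpoly F[n.+1]}) :
  exists Q : {poly {mpoly F[n]}}, p = (map_poly (@mwiden n F) Q).['X_ord_max].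
Proof.
elim/mpolyind: p => [|c m p _ _ [Q ->]]; first by exists 0; rewrite rmorph0 horner0.
exists ((c *: 'X_[[multinom m (widen_ord (leqnSn n) i) | i < n]])%:P * 'X^(m ord_max) + Q).
rewrite rmorphD hornerD; congr (_ + _).
rewrite rmorphM /= map_polyC map_polyXn hornerM hornerC hornerXn /= mwidenZ mwidenX -scalerAl.
congr (_ *: _); rewrite mpolyXn -mpolyXD; congr 'X_[_].
apply/mnmP => i; rewrite mnmDE mulmnE mnm1E.
case: (unliftP ord_max i) => [j|] ->.
  rewrite (_ : lift _ _ = widen_ord (leqnSn n) j); last first.
    by apply/val_inj; rewrite /= /bump leqNgt ltn_ord.
  rewrite mnmwiden_widen mnmE -val_eqE /= gtn_eqF ?ltn_ord //.
  by rewrite mul0n addn0.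
by rewrite mnmwiden_ordmax eqxx mul1n.
Qed.

(** Natural points are the ones at hand: [rho + Lambda_+] is an affine image of this grid, so a
    polynomial vanishing on all of it is zero. *)
Lemma mpoly_grid_eq0 n (p : {mpoly F[n]}) :
  (forall v : 'I_n -> nat, p.@[fun i => (v i)%:R] = 0) -> p = 0.
Proof.
elim: n p => [|n IH] p p0.
  rewrite (nvar0_mpolyC p); have := p0 (fun=> 0%N).
  by rewrite {1}(nvar0_mpolyC p) mevalC => ->; rewrite mpolyC0.
have [Q defp] := mpoly_univariate p.
suff Q0 : Q = 0 by rewrite defp Q0 rmorph0 horner0.
apply/polyP => k; rewrite coef0; apply: IH => v.
set f := fun i : 'I_n => (v i)%:R : F.
suff : map_poly (meval f) Q = 0.
  by move/polyP/(_ k); rewrite coef_map coef0.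
apply: (@poly_eq0_infinite F (fun k => k%:R)).
  by move=> a b /eqP; rewrite eqr_nat => /eqP.
move=> x.
pose w (i : 'I_n.+1) := if unlift ord_max i is Some j then v j else x.
have := p0 w; rewrite defp -horner_map /= mevalXU {2}/w unlift_none -map_poly_comp.
move=> <-; congr (horner _ _); apply: eq_map_poly => q /=; rewrite mwiden_eval; apply: meval_eq => i; rewrite /f /w.
have -> : widen_ord (leqnSn n) i = lift ord_max i.
  by apply/val_inj; rewrite /= /bump leqNgt ltn_ord.
by rewrite liftK.
Qed.

Lemma mpoly_eval_eq0 n (p : {mpoly F[n]}) : (forall v, p.@[v] = 0) -> p = 0.
Proof. by move=> p0; apply: mpoly_grid_eq0. Qed.

Lemma mpoly_eval_inj n (p q : {mpoly F[n]}) : (forall v, p.@[v] = q.@[v]) -> p = q.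
Proof.
move=> pq; apply/eqP; rewrite -subr_eq0; apply/eqP/mpoly_eval_eq0 => v.
by rewrite mevalB pq subrr.
Qed.

End Grid.

(** * The root system and the bases of the lattice *)

Lemma perm_map_fset (T : choiceType) (A : {fset T}) (f : T -> T) :
  injective f -> {in A, forall x, f x \in A} -> perm_eq (map f A) A.
Proof.
move=> injf fA; have Uf : uniq (map f A) by rewrite map_inj_uniq.
apply: uniq_perm => //.
have sub : {subset map f A <= enum_fset A} by move=> y /mapP [x xA ->]; apply: fA.
by have [] := uniq_min_size Uf sub _; rewrite ?size_map.
Qed.

Lemma col_mulmx (R : pzSemiRingType) m n p (A : 'M[R]_(m, n)) (B : 'M[R]_(n, p)) j :
  col j (A *m B) = A *m col j B.
Proof. by rewrite !colE mulmxA. Qed.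

Lemma mulmx_sum_col (R : comPzRingType) m n (A : 'M[R]_(m, n)) (u : 'cV[R]_n) :
  A *m u = \sum_i u i 0 *: col i A.
Proof.
apply: trmx_inj; rewrite trmx_mul mulmx_sum_row raddf_sum /=.
by apply: eq_bigr => i _; rewrite linearZ /= tr_col mxE.
Qed.

Section Pairing.

Variable n : nat.
Implicit Types (eta mu lambda tau : 'rV[int]_n) (omega alpha : 'cV[int]_n) (w : 'M[int]_n).

Lemma pairingDl eta mu omega : pairing (eta + mu) omega = pairing eta omega + pairing mu omega.
Proof. by rewrite /pairing mulmxDl mxE. Qed.

Lemma pairingDr eta omega alpha : pairing eta (omega + alpha) = pairing eta omega + pairing eta alpha.
Proof. by rewrite /pairing mulmxDr mxE. Qed.

Lemma pairingNl eta omega : pairing (- eta) omega = - pairing eta omega.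
Proof. by rewrite /pairing mulNmx mxE. Qed.

Lemma pairingNr eta omega : pairing eta (- omega) = - pairing eta omega.
Proof. by rewrite /pairing mulmxN mxE. Qed.

Lemma pairingBl eta mu omega : pairing (eta - mu) omega = pairing eta omega - pairing mu omega.
Proof. by rewrite pairingDl pairingNl. Qed.

Lemma pairingZl a eta omega : pairing (a *: eta) omega = a * pairing eta omega.
Proof. by rewrite /pairing -scalemxAl mxE. Qed.

Lemma pairingZr a eta omega : pairing eta (a *: omega) = a * pairing eta omega.
Proof. by rewrite /pairing -scalemxAr mxE. Qed.

Lemma pairing0l omega : pairing 0 omega = 0.
Proof. by rewrite /pairing mul0mx mxE. Qed.

Lemma pairing0r eta : pairing eta 0 = 0.
Proof. by rewrite /pairing mulmx0 mxE. Qed.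

Lemma pairing_suml (I : Type) (r : seq I) (P : pred I) (F : I -> 'rV[int]_n) omega :
  pairing (\sum_(i <- r | P i) F i) omega = \sum_(i <- r | P i) pairing (F i) omega.
Proof. by rewrite /pairing mulmx_suml summxE. Qed.

Lemma pairing_sumr (I : Type) (r : seq I) (P : pred I) (F : I -> 'cV[int]_n) eta :
  pairing eta (\sum_(i <- r | P i) F i) = \sum_(i <- r | P i) pairing eta (F i).
Proof. by rewrite /pairing mulmx_sumr summxE. Qed.

End Pairing.

Lemma rank1_mulmx n (alpha : 'cV[int]_n) (c c' : 'rV[int]_n) :
  alpha *m c *m (alpha *m c') = pairing c alpha *: (alpha *m c').
Proof.
rewrite mulmxA -[alpha *m c *m alpha]mulmxA [c *m alpha]mx11_scalar.
by rewrite mul_mx_scalar -scalemxAl.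
Qed.

Record lattice_axioms n (G : datum n) : Prop := {
  ax_basis : Sigma G \in unitmx;
  ax_group : is_finite_automorphism_group G;
  ax_roots : is_root_system G;
  ax_C2 : axiom_C2 G;
  ax_C3 : axiom_C3 G;
  ax_C4 : axiom_C4 G;
  ax_C5 : axiom_C5 G;
  ax_C6 : axiom_C6 G;
  ax_C7 : axiom_C7 G }.

Section Datum.

Context {n : nat} (G : datum n) (ax : lattice_axioms G).
Implicit Types (eta mu nu lambda tau : 'rV[int]_n) (omega alpha beta : 'cV[int]_n).
Implicit Types (w s : 'M[int]_n).

Let basis := ax_basis ax.
Let Wgroup := ax_group ax.
Let roots := ax_roots ax.

Lemma W_unit w : w \in W G -> w \in unitmx. Proof. by case: Wgroup => H _ _ _; apply: H. Qed.
Lemma W1 : 1%:M \in W G. Proof. by case: Wgroup. Qed.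
Lemma WM w w' : w \in W G -> w' \in W G -> w *m w' \in W G.
Proof. by case: Wgroup => _ _ H _; apply: H. Qed.
Lemma WV w : w \in W G -> invmx w \in W G. Proof. by case: Wgroup => _ _ _; apply. Qed.

Lemma act_dual_pairing w eta omega :
  pairing (act_dual w eta) omega = pairing eta (invmx w *m omega).
Proof. by rewrite /pairing /act_dual mulmxA. Qed.

Lemma act_dualM_pairing w eta omega : w \in W G ->
  pairing (act_dual w eta) (w *m omega) = pairing eta omega.
Proof. by move=> /W_unit Uw; rewrite act_dual_pairing mulKmx. Qed.

Lemma act_dual1 eta : act_dual 1%:M eta = eta.
Proof. by rewrite /act_dual invmx1 mulmx1. Qed.

Lemma invmxM w w' : w \in unitmx -> w' \in unitmx ->
  invmx (w *m w') = invmx w' *m invmx w.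
Proof.
move=> Uw Uw'; have UM : w *m w' \in unitmx by rewrite unitmx_mul Uw.
apply: (can_inj (mulKmx UM)); rewrite mulmxV // mulmxA -[w *m w' *m _]mulmxA.
by rewrite mulmxV // mulmx1 mulmxV.
Qed.

Lemma act_dualM w w' eta : w \in W G -> w' \in W G ->
  act_dual (w *m w') eta = act_dual w (act_dual w' eta).
Proof. by move=> /W_unit Uw /W_unit Uw'; rewrite /act_dual invmxM // mulmxA. Qed.

Lemma act_dualK w : w \in W G -> cancel (act_dual w) (act_dual (invmx w)).
Proof. by move=> /W_unit Uw eta; rewrite /act_dual invmxK mulmxKV. Qed.

Lemma act_dual_inj w : w \in W G -> injective (act_dual w).
Proof. by move=> wW; apply: can_inj (act_dualK wW). Qed.

Lemma act_dualB w eta mu : act_dual w (eta - mu) = act_dual w eta - act_dual w mu.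
Proof. by rewrite /act_dual mulmxBl. Qed.

Lemma sigma_dualP i j : pairing (sigma_dual G i) (sigma G j) = (i == j)%:R.
Proof.
by rewrite /pairing /sigma_dual /sigma -col_mulmx -row_mul mulVmx // !mxE.
Qed.

Lemma sigma_decomp omega : omega = \sum_i pairing (sigma_dual G i) omega *: sigma G i.
Proof.
rewrite -[LHS](mulKVmx basis) [LHS]mulmx_sum_col; apply: eq_bigr => i _.
by rewrite /pairing /sigma_dual /sigma -row_mul [in RHS]mxE.
Qed.

Lemma sigma_dual_decomp eta : eta = \sum_i pairing eta (sigma G i) *: sigma_dual G i.
Proof.
rewrite -[LHS](mulmxK basis) [LHS]mulmx_sum_row; apply: eq_bigr => i _.
by rewrite /pairing /sigma_dual /sigma -col_mulmx [in RHS]mxE.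
Qed.

Lemma pairing_sigma eta omega :
  pairing eta omega = \sum_i pairing eta (sigma G i) * pairing (sigma_dual G i) omega.
Proof.
rewrite {1}(sigma_decomp omega) pairing_sumr; apply: eq_bigr => i _.
by rewrite pairingZr mulrC.
Qed.

Lemma Lambda_plusP lambda : Lambda_plus G lambda <-> forall i, 0 <= pairing lambda (sigma G i).
Proof.
split=> [[c ->] i|pos].
  rewrite pairing_suml; apply: sumr_ge0 => j _.
  by rewrite -scaler_nat pairingZl sigma_dualP mulr_ge0 // ler0n.
exists (fun i => `|pairing lambda (sigma G i)|%N).
rewrite {1}(sigma_dual_decomp lambda); apply: eq_bigr => i _.
by rewrite -scaler_nat natz gez0_abs.
Qed.

Lemma PhiP omega :
  reflect (exists2 w, w \in W G & exists i, omega = w *m sigma G i) (omega \in Phi G).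
Proof.
apply: (iffP (imfset2P _ _ _ _ _)) => /=.
  by move=> [w wW [i _ ->]]; exists w => //; exists i.
by move=> [w wW [i ->]]; exists w => //; exists i.
Qed.

Lemma sigma_Phi i : sigma G i \in Phi G.
Proof. by apply/PhiP; exists 1%:M; [exact: W1|exists i; rewrite mul1mx]. Qed.

Lemma Phi_stable w omega : w \in W G -> omega \in Phi G -> w *m omega \in Phi G.
Proof.
move=> wW /PhiP [w' w'W [i ->]]; apply/PhiP; exists (w *m w'); first exact: WM.
by exists i; rewrite mulmxA.
Qed.

Lemma mulmx_W_inj w : w \in W G -> injective (fun omega => w *m omega).
Proof. by move=> /W_unit Uw; apply: can_inj (mulKmx Uw). Qed.

Lemma perm_Phi w : w \in W G -> perm_eq [seq w *m omega | omega <- Phi G] (Phi G).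
Proof.
move=> wW; apply: (perm_map_fset (f := fun omega => w *m omega)); first exact: mulmx_W_inj.
by move=> omega; apply: Phi_stable.
Qed.

Lemma Sigma1_dualP eta : reflect
  (exists2 i, pairing (sigma_dual G i) (ell G) = 1 & eta = sigma_dual G i)
  (eta \in Sigma1_dual G).
Proof.
apply: (iffP (imfsetP _ _ _ _)) => /=.
  by move=> [i /= /eqP Hi ->]; exists i.
by move=> [i Hi ->]; exists i => //=; apply/eqP.
Qed.

Lemma Lambda1P eta : reflect
  (exists2 w, w \in W G & exists2 eta', eta' \in Sigma1_dual G & eta = act_dual w eta')
  (eta \in Lambda1 G).
Proof. exact: (iffP (imfset2P _ _ _ _ _)). Qed.

Lemma Sigma1_Lambda1 eta : eta \in Sigma1_dual G -> eta \in Lambda1 G.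
Proof.
move=> etaS; apply/Lambda1P; exists 1%:M; first exact: W1.
by exists eta => //; rewrite act_dual1.
Qed.

Lemma Lambda1_stable w eta : w \in W G -> eta \in Lambda1 G -> act_dual w eta \in Lambda1 G.
Proof.
move=> wW /Lambda1P [w' w'W [eta' eta'S ->]]; apply/Lambda1P.
by exists (w *m w'); [exact: WM|exists eta' => //; rewrite act_dualM].
Qed.

Lemma perm_Lambda1 w : w \in W G -> perm_eq [seq act_dual w eta | eta <- Lambda1 G] (Lambda1 G).
Proof.
move=> wW; apply: perm_map_fset; first exact: act_dual_inj.
by move=> eta; apply: Lambda1_stable.
Qed.

Lemma root_primitive alpha : alpha \in Delta G -> primitive alpha.
Proof. by case: roots => H _ _; apply: H. Qed.

Lemma root_neq0 alpha : alpha \in Delta G -> alpha != 0.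
Proof.
move=> aD; apply/eqP => a0; have := root_primitive aD.
by move=> /(_ 0 0); rewrite a0 scaler0 => /(_ erefl) [].
Qed.

(* Two reflections along the same root differ by a transvection, which has infinite order
   unless it is trivial. *)
Lemma reflection_unique alpha s s' : alpha \in Delta G ->
  s \in W G -> s' \in W G -> reflection_along alpha s -> reflection_along alpha s' -> s = s'.
Proof.
move=> aD sW s'W [c ca defs] [c' c'a defs'].
have ssE : s *m s' = 1%:M + alpha *m (c' - c).
  rewrite defs defs' mulmxBl mul1mx mulmxBr mulmx1 rank1_mulmx ca mulmxBr.
  by rewrite -natz scaler_nat mulr2n opprB -!addrA; congr (_ + _); rewrite addKr.
pose u k := 1%:M + alpha *m (k%:Z *: (c' - c)).
have d0 : pairing (c' - c) alpha = 0 by rewrite pairingBl ca c'a subrr.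
have uW k : u k \in W G.
  elim: k => [|k IH]; first by rewrite /u scale0r mulmx0 addr0 W1.
  have -> : u k.+1 = u k *m (s *m s'); last by rewrite !WM.
  rewrite ssE /u mulmxDl mul1mx mulmxDr mulmx1 rank1_mulmx pairingZl d0 mulr0 scale0r addr0.
  rewrite -addrA -mulmxDr; congr (_ + alpha *m _).
  by rewrite -{2}[c' - c]scale1r -scalerDl -intS addrC.
have ad0 : alpha *m (c' - c) = 0.
  apply/eqP; apply: contraT => nz.
  have inju : injective u.
    move=> k k' /addrI /eqP; rewrite -subr_eq0 -mulmxBr -scalerBl -scalemxAr.
    by rewrite scalemx_eq0 subr_eq0 eqz_nat (negPf nz) orbF => /eqP.
  have sub : {subset [seq u k | k <- iota 0 (size (W G)).+1] <= W G}.
    by move=> _ /mapP [k _ ->].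
  have := uniq_leq_size _ sub.
  by rewrite map_inj_uniq // iota_uniq size_map size_iota ltnn => /(_ isT).
have : s *m s' = 1%:M by rewrite ssE ad0 addr0.
have s2 : s *m s = 1%:M.
  rewrite defs mulmxBl mul1mx mulmxBr mulmx1 rank1_mulmx ca.
  by rewrite -natz scaler_nat mulr2n opprB addrK subrK.
by rewrite -s2 => /(can_inj (mulKmx (W_unit sW))) ->.
Qed.

Lemma root_reflection alpha : alpha \in Delta G ->
  exists s (c : 'rV[int]_n), [/\ s \in W G, pairing c alpha = 2 & s = 1%:M - alpha *m c].
Proof.
case: roots => _ H _ /H [s sW [[c ca defs] _]].
by exists s, c.
Qed.

Lemma reflection_omega alpha (c : 'rV[int]_n) omega :
  (1%:M - alpha *m c) *m omega = omega - pairing c omega *: alpha.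
Proof.
rewrite mulmxBl mul1mx -mulmxA [c *m omega]mx11_scalar -/(pairing c omega).
by rewrite mul_mx_scalar.
Qed.

Lemma invmx_reflection alpha (c : 'rV[int]_n) : pairing c alpha = 2 ->
  invmx (1%:M - alpha *m c) = 1%:M - alpha *m c.
Proof.
move=> ca; set s := 1%:M - _.
have ss : s *m s = 1%:M.
  rewrite /s mulmxBl mul1mx mulmxBr mulmx1 rank1_mulmx ca.
  by rewrite scaler_nat mulr2n opprB addrK subrK.
have [Us _] := mulmx1_unit ss.
by rewrite -[LHS]mulmx1 -ss mulKmx.
Qed.

Lemma act_reflection alpha (c : 'rV[int]_n) eta : pairing c alpha = 2 ->
  act_dual (1%:M - alpha *m c) eta = eta - pairing eta alpha *: c.
Proof.
move=> ca; rewrite /act_dual invmx_reflection // mulmxBr mulmx1 mulmxA.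
by rewrite [eta *m alpha]mx11_scalar -/(pairing eta alpha) mul_scalar_mx.
Qed.

(** [is_root_system] gives for each root some reflection in [W] that preserves [Delta], while the
    generators of [W] are arbitrary reflections along roots; uniqueness of the reflection identifies
    the two. *)
Lemma root_stable w alpha : w \in W G -> alpha \in Delta G -> w *m alpha \in Delta G.
Proof.
case: roots => _ Hs gen wW aD; have [ss Hss ->] := gen w wW.
elim: ss Hss => [|s ss IH] Hss; first by rewrite big_nil mul1mx.
rewrite big_cons -mulmxA.
have [sW [beta bD sb]] := Hss s (mem_head _ _).
have [s' s'W [s'b stab]] := Hs beta bD.
rewrite (reflection_unique bD sW s'W sb s'b); apply: stab; apply: IH => t tss.
by apply: Hss; rewrite inE tss orbT.
Qed.

Lemma perm_Delta w : w \in W G -> perm_eq [seq w *m omega | omega <- Delta G] (Delta G).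
Proof.
move=> wW; apply: (perm_map_fset (f := fun omega => w *m omega)); first exact: mulmx_W_inj.
by move=> omega; apply: root_stable.
Qed.

Lemma nonnegP omega : reflect (forall i, 0 <= pairing (sigma_dual G i) omega) (nonneg G omega).
Proof. exact: forallP. Qed.

Lemma Delta_plusP alpha : reflect (alpha \in Delta G /\ nonneg G alpha) (alpha \in Delta_plus G).
Proof. by rewrite /Delta_plus !inE /=; apply: andP. Qed.

Lemma Phi_plusP omega : reflect (omega \in Phi G /\ nonneg G omega) (omega \in Phi_plus G).
Proof. by rewrite /Phi_plus !inE /=; apply: andP. Qed.

Lemma root_sign alpha : alpha \in Delta G -> alpha \in Delta_plus G \/ - alpha \in Delta_plus G.
Proof.
rewrite {1}(ax_C2 ax) inE => /orP [|/imfsetP [beta /= bD ->]]; first by left.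
by rewrite opprK; right.
Qed.

Lemma root_opp alpha : alpha \in Delta G -> - alpha \in Delta G.
Proof.
move=> aD; have [s [c [sW ca defs]]] := root_reflection aD.
have := root_stable sW aD; rewrite defs reflection_omega ca.
by rewrite (_ : 2 = 1 + 1) // scalerDl scale1r opprD addrA subrr sub0r.
Qed.

Lemma Phi_sign omega : omega \in Phi G -> omega \in Phi_plus G \/ - omega \in Phi_plus G.
Proof.
move=> oP; have := fsubsetP (ax_C3 ax) _ oP.
rewrite inE => /orP [|/imfsetP [beta /= bD ->]]; first by left.
by rewrite opprK; right.
Qed.

Lemma Phi_neq0 omega : omega \in Phi G -> omega != 0.
Proof.
case/PhiP => w wW [i ->]; apply/eqP => /(congr1 (mulmx (invmx w))).
rewrite mulKmx ?W_unit // mulmx0 => si0.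
by have := sigma_dualP i i; rewrite si0 pairing0r eqxx.
Qed.

Lemma ell_act w eta : w \in W G -> pairing (act_dual w eta) (ell G) = pairing eta (ell G).
Proof. by move=> wW; rewrite act_dual_pairing (ax_C4 ax) ?WV. Qed.

Lemma ell_Lambda1 eta : eta \in Lambda1 G -> pairing eta (ell G) = 1.
Proof. by case/Lambda1P => w wW [eta' /Sigma1_dualP [i <- ->] ->]; apply: ell_act. Qed.

Lemma Lambda1_values eta omega : eta \in Lambda1 G ->
  omega \in Delta G \/ omega \in Phi G -> pairing eta omega \in [:: -1; 0; 1].
Proof.
case/Lambda1P => w wW [eta' eta'S ->] H.
rewrite act_dual_pairing; apply: (ax_C7 ax eta'S); rewrite inE; apply/orP.
by case: H => H; [left; apply: root_stable|right; apply: Phi_stable] => //; apply: WV.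
Qed.

Lemma Lambda1_gt0 eta omega : eta \in Lambda1 G ->
  omega \in Delta G \/ omega \in Phi G ->
  (0 < pairing eta omega) -> pairing eta omega = 1.
Proof. by move=> etaL /(Lambda1_values etaL); rewrite !inE => /or3P [] /eqP ->. Qed.

Lemma nonneg_Sigma1 eta omega : eta \in Sigma1_dual G -> nonneg G omega ->
  0 <= pairing eta omega.
Proof. by case/Sigma1_dualP => i _ -> /nonnegP. Qed.

(** This is (C5) evaluated at [eta]: by (C7) each sum over positive elements counts those of value
    1, and [ell(eta) = 1]. It gives [f_eta] degree 1, which compensates the degree lost by
    [1 - T_eta]. *)
Lemma count_positive_Sigma1 eta : eta \in Sigma1_dual G ->
  count (fun omega => 0 < pairing eta omega) (Phi G) =
  (count (fun alpha => 0 < pairing eta alpha) (Delta G)).+1.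
Proof.
move=> etaS; have etaL := Sigma1_Lambda1 etaS.
have H (A B : {fset 'cV[int]_n}) : (B = [fset omega in A | nonneg G omega])%fset ->
    (forall omega, omega \in A -> omega \in B \/ - omega \in B) ->
    (forall omega, omega \in A -> pairing eta omega \in [:: -1; 0; 1]) ->
    (count (fun omega => 0 < pairing eta omega) A)%:Z = \sum_(omega <- B) pairing eta omega.
  move=> defB sgn val.
  have -> : \sum_(omega <- B) pairing eta omega =
      \sum_(omega <- A | nonneg G omega) pairing eta omega.
    rewrite -[RHS]big_filter; apply: perm_big; apply: uniq_perm => //; first exact: filter_uniq.
    by move=> omega; rewrite mem_filter defB !inE andbC.
  rewrite -sum1_count -natz natr_sum big_mkcond [RHS]big_mkcond /=.
  apply: eq_big_seq => omega oA; have := val _ oA.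
  have := sgn _ oA; rewrite defB !inE /= => -[/andP [_ pos]|/andP [_ neg]].
    rewrite pos; have := nonneg_Sigma1 etaS pos.
    by move=> ge0 /or3P [] /eqP e; rewrite e // in ge0 *.
  have := nonneg_Sigma1 etaS neg; rewrite pairingNr => le0.
  rewrite ltNge -oppr_ge0 le0 /=; case: ifP => // pos _.
  by have := nonneg_Sigma1 etaS pos; lia.
have := congr1 (pairing eta) (ax_C5 ax).
rewrite ell_Lambda1 // pairingDr pairingNr !pairing_sumr.
rewrite -(H (Phi G) (Phi_plus G)) //; last first.
- by move=> omega oP; apply: Lambda1_values => //; right.
- exact: Phi_sign.
rewrite -(H (Delta G) (Delta_plus G)) //; last first.
- by move=> omega oP; apply: Lambda1_values => //; left.
- exact: root_sign.
by lia.
Qed.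

Lemma count_positive eta : eta \in Lambda1 G ->
  count (fun omega => 0 < pairing eta omega) (Phi G) =
  (count (fun alpha => 0 < pairing eta alpha) (Delta G)).+1.
Proof.
case/Lambda1P => w wW [eta' eta'S ->].
rewrite -(permP (perm_Phi wW)) -(permP (perm_Delta wW)) !count_map.
under eq_count => omega do rewrite /= act_dualM_pairing //.
under [in RHS]eq_count => omega do rewrite /= act_dualM_pairing //.
exact: count_positive_Sigma1.
Qed.

End Datum.

(** * Chambers and conjugacy inside [Lambda_+] *)

Lemma seq_argmax d (I : eqType) (T : orderType d) (f : I -> T) (x : I) (r : seq I) :
  x \in r -> exists2 y, y \in r & forall z, z \in r -> (f z <= f y)%O.
Proof.
elim: r x => // a [|b r] IH x xr.
  by exists a; rewrite ?mem_head // => z; rewrite inE => /eqP ->.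
have [y yr ymax] := IH b (mem_head _ _).
have [ay|ya] := leP (f a) (f y).
  by exists y => [|z]; rewrite inE ?yr ?orbT // => /orP [/eqP ->|/ymax].
exists a => [|z]; rewrite inE ?eqxx // => /orP [/eqP -> //|/ymax zy].
exact: le_trans zy (ltW ya).
Qed.

Section Chamber.

Context {n : nat} (G : datum n) (ax : lattice_axioms G).
Implicit Types (eta mu nu lambda tau : 'rV[int]_n) (omega alpha beta : 'cV[int]_n).
Implicit Types (w s : 'M[int]_n).

Lemma Lambda_plus0 : Lambda_plus G 0.
Proof. by apply/(Lambda_plusP ax) => i; rewrite pairing0l. Qed.

Lemma Lambda_plusD lambda mu : Lambda_plus G lambda -> Lambda_plus G mu -> Lambda_plus G (lambda + mu).
Proof.
move=> /(Lambda_plusP ax) H /(Lambda_plusP ax) H'; apply/(Lambda_plusP ax) => i.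
by rewrite pairingDl addr_ge0.
Qed.

Lemma Lambda_plus_ge0 lambda omega : Lambda_plus G lambda -> nonneg G omega ->
  0 <= pairing lambda omega.
Proof.
move=> /(Lambda_plusP ax) pos /nonnegP pos'; rewrite (pairing_sigma ax).
by apply: sumr_ge0 => i _; rewrite mulr_ge0.
Qed.

Lemma ell_nonneg : nonneg G (ell G).
Proof. by apply/nonnegP => i; apply/ltW/(ax_C6 ax). Qed.

Lemma Lambda_plus_ell0 lambda : Lambda_plus G lambda -> pairing lambda (ell G) <= 0 -> lambda = 0.
Proof.
move=> Lp; have /(Lambda_plusP ax) pos := Lp.
rewrite (pairing_sigma ax) => sum_le0.
rewrite (sigma_dual_decomp ax lambda) big1 // => i _.
have : \sum_i pairing lambda (sigma G i) * pairing (sigma_dual G i) (ell G) == 0.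
  rewrite eq_le sum_le0 sumr_ge0 // => j _; rewrite mulr_ge0 // ltW //.
  exact: (ax_C6 ax).
rewrite psumr_eq0; last by move=> j _; rewrite mulr_ge0 // ltW // (ax_C6 ax).
move=> /allP /(_ i (mem_index_enum _)) /=; rewrite mulf_eq0.
by rewrite orbC gt_eqF ?(ax_C6 ax i) //= => /eqP ->; rewrite scale0r.
Qed.

(** Its value is 1 on every element of [Sigma]. Hence it lies in [V_0], adding [t] times it to [rho]
    raises [k_omega] by [t] for every [omega] in [Phi], and it is strictly positive on positive
    roots. *)
Definition weyl_vector : 'rV[int]_n := \sum_i sigma_dual G i.
Local Notation p := weyl_vector.

Lemma weyl_vector_sigma i : pairing p (sigma G i) = 1.
Proof.
rewrite /p pairing_suml (bigD1 i) //= (sigma_dualP ax) eqxx big1 ?addr0 // => j ji.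
by rewrite (sigma_dualP ax) (negPf ji).
Qed.

Lemma Lambda_plus_weyl_vector : Lambda_plus G p.
Proof. by apply/(Lambda_plusP ax) => i; rewrite weyl_vector_sigma. Qed.

Lemma weyl_vector_gt0 omega : nonneg G omega -> omega != 0 -> 0 < pairing p omega.
Proof.
move=> pos nz; rewrite lt_neqAle Lambda_plus_ge0 ?andbT //; last exact: Lambda_plus_weyl_vector.
apply: contra nz; rewrite eq_sym (pairing_sigma ax).
move/nonnegP: pos => pos; rewrite psumr_eq0; last first.
  by move=> i _; rewrite weyl_vector_sigma mul1r.
move=> /allP H; rewrite (sigma_decomp ax omega) big1 // => i _.
by have := H i (mem_index_enum _); rewrite /= weyl_vector_sigma mul1r => /eqP ->; rewrite scale0r.
Qed.

Lemma weyl_vector_root alpha : alpha \in Delta_plus G -> 0 < pairing p alpha.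
Proof.
case/Delta_plusP => aD pos; apply: weyl_vector_gt0 => //.
exact: root_neq0 aD.
Qed.

Lemma weyl_vector_Phi omega : omega \in Phi_plus G -> 0 < pairing p omega.
Proof. by case/Phi_plusP => oP pos; apply: weyl_vector_gt0 => //; apply: Phi_neq0 oP. Qed.

(** Invariant because [Phi] is stable under [W], positive definite because [Phi] contains a
    basis. *)
Definition form eta mu : int := \sum_(omega <- Phi G) pairing eta omega * pairing mu omega.

Lemma form_act w eta mu : w \in W G -> form (act_dual w eta) (act_dual w mu) = form eta mu.
Proof.
move=> wW; rewrite /form -(perm_big _ (perm_Phi ax wW)) big_map.
by apply: eq_bigr => omega _; rewrite !(act_dualM_pairing ax).
Qed.

Lemma formBl eta eta' mu : form (eta - eta') mu = form eta mu - form eta' mu.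
Proof. by rewrite /form -sumrB; apply: eq_bigr => o _; rewrite pairingBl mulrBl. Qed.

Lemma formBr eta mu mu' : form eta (mu - mu') = form eta mu - form eta mu'.
Proof. by rewrite /form -sumrB; apply: eq_bigr => o _; rewrite pairingBl mulrBr. Qed.

Lemma formZl a eta mu : form (a *: eta) mu = a * form eta mu.
Proof. by rewrite /form mulr_sumr; apply: eq_bigr => o _; rewrite pairingZl mulrA. Qed.

Lemma formZr a eta mu : form eta (a *: mu) = a * form eta mu.
Proof. by rewrite /form mulr_sumr; apply: eq_bigr => o _; rewrite pairingZl mulrCA. Qed.

Lemma form_gt0 eta : eta != 0 -> 0 < form eta eta.
Proof.
move=> nz; rewrite lt_neqAle sumr_ge0 ?andbT; last by move=> o _; rewrite -expr2 sqr_ge0.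
apply: contra nz; rewrite eq_sym psumr_eq0; last by move=> o _; rewrite -expr2 sqr_ge0.
move=> /allP H; rewrite (sigma_dual_decomp ax eta) big1 // => i _.
have := H _ (sigma_Phi ax i); rewrite /= mulf_eq0 orbb => /eqP ->.
by rewrite scale0r.
Qed.

(** Invariance under the reflection, which negates [c], shows that up to a positive factor [alpha]
    is the form with its coroot. *)
Lemma form_coroot alpha (c : 'rV[int]_n) eta : 1%:M - alpha *m c \in W G ->
  pairing c alpha = 2 -> 2 * form c eta = pairing eta alpha * form c c.
Proof.
move=> sW ca; have := form_act c eta sW; rewrite !act_reflection // ca.
by rewrite formBl formZl formBr formZr; lia.
Qed.

(* [w'] maximizes [form (w' p) p] among the elements of [W] mapping [mu] to [w mu]. *)
Lemma chamber_reduction w mu : w \in W G -> Lambda_plus G mu -> Lambda_plus G (act_dual w mu) ->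
  exists w', [/\ w' \in W G, act_dual w' mu = act_dual w mu &
    {in Delta_plus G, forall alpha, w' *m alpha \in Delta_plus G}].
Proof.
move=> wW muL wmuL.
have [w' /=] := @seq_argmax _ _ _ (fun w' => form (act_dual w' p) p) w
  [seq w' <- W G | act_dual w' mu == act_dual w mu] ltac:(by rewrite mem_filter eqxx).
rewrite mem_filter => /andP [/eqP w'mu w'W] w'max.
exists w'; split=> // alpha aDp; have [aD apos] := Delta_plusP _ _ aDp.
have [//|neg] := root_sign ax (root_stable ax w'W aD).
have [_ negpos] := Delta_plusP _ _ neg.
(* If [w'] makes the positive root [alpha] negative, then [alpha(mu)] is both nonnegative and
   nonpositive. So the reflection fixes [mu], and [w' s] competes with [w']. *)
have amu0 : pairing mu alpha = 0.
  apply/eqP; rewrite eq_le Lambda_plus_ge0 // andbT.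
  have := Lambda_plus_ge0 wmuL negpos.
  by rewrite pairingNr -w'mu (act_dualM_pairing ax) // oppr_ge0.
have [s [c [sW ca defs]]] := root_reflection ax aD.
have sW' := sW; rewrite defs in sW'.
have w'sW : w' *m s \in W G by apply: WM.
have smu : act_dual (w' *m s) mu = act_dual w mu.
  by rewrite (act_dualM ax) // defs act_reflection // amu0 scale0r subr0.
have sp : act_dual (w' *m s) p = act_dual w' p - pairing p alpha *: act_dual w' c.
  by rewrite (act_dualM ax) // defs act_reflection // act_dualB /act_dual scalemxAl.
have := w'max (w' *m s); rewrite mem_filter w'sW smu eqxx sp => /(_ isT).
rewrite formBl formZl.
have p1 := weyl_vector_root aDp; have p2 := weyl_vector_root neg.
have c0 : 0 < form c c.
  by apply: form_gt0; apply/eqP => c0; move: ca; rewrite c0 pairing0l.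
have := form_coroot (act_dual (invmx w') p) sW' ca.
have pK := act_dualK ax (WV ax w'W) p; rewrite invmxK in pK.
rewrite act_dual_pairing invmxK -(form_act c _ w'W) pK.
rewrite pairingNr oppr_gt0 in p2 => fE.
(* By [form_coroot] this has the sign of [pairing p (w' *m alpha)], so [w' s] would exceed the
   maximum. *)
have f0 : form (act_dual w' c) p < 0.
  have : pairing p (w' *m alpha) * form c c < 0 by rewrite nmulr_rlt0.
  by rewrite -fE pmulr_rlt0.
have : pairing p alpha * form (act_dual w' c) p < 0 by rewrite pmulr_rlt0.
by move=> lt0; rewrite gerBl leNgt lt0.
Qed.

(** By (C5) and the invariance of [ell], [w] fixes the sum of [Phi_plus]. The sum of the values of
    [p] on [Phi_plus] is the sum of the positive parts of its values on [Phi], which [w] permutes.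
    The total over [w Phi_plus] is thus as large as possible, which forces each value of [p] there
    to be nonnegative. *)
Lemma Delta_chamber_Phi w : w \in W G ->
  {in Delta_plus G, forall alpha, w *m alpha \in Delta_plus G} ->
  {in Phi_plus G, forall omega, w *m omega \in Phi_plus G}.
Proof.
move=> wW wD.
have sumD : w *m (\sum_(alpha <- Delta_plus G) alpha) = \sum_(alpha <- Delta_plus G) alpha.
  rewrite mulmx_sumr -[RHS](perm_big _ (perm_map_fset (mulmx_W_inj ax wW) wD)).
  by rewrite big_map.
have sumP : \sum_(omega <- Phi_plus G) pairing p (w *m omega) =
    \sum_(omega <- Phi_plus G) pairing p omega.
  rewrite -!pairing_sumr -mulmx_sumr; congr (pairing _ _).
  have -> : \sum_(omega <- Phi_plus G) omega = ell G + \sum_(alpha <- Delta_plus G) alpha.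
    by rewrite -(ax_C5 ax) subrK.
  by rewrite mulmxDr sumD (ax_C4 ax).
have sum_plus (F : 'cV[int]_n -> int) : \sum_(omega <- Phi_plus G) F omega =
    \sum_(omega <- Phi G | nonneg G omega) F omega.
  rewrite -[RHS]big_filter; apply: perm_big; apply: uniq_perm => //; first exact: filter_uniq.
  by move=> omega; rewrite mem_filter /Phi_plus !inE andbC.
pose m (x : int) := Num.max 0 x.
have mP omega : omega \in Phi G -> m (pairing p omega) =
    if nonneg G omega then pairing p omega else 0.
  move=> oP; case: ifP => [pos|/negP npos].
    by rewrite /m max_r // ltW // weyl_vector_Phi //; apply/Phi_plusP.
  case: (Phi_sign ax oP) => [/Phi_plusP [//]|/weyl_vector_Phi].
  by rewrite pairingNr oppr_gt0 => /ltW le0; rewrite /m max_l.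
have sum_m : \sum_(omega <- Phi G) m (pairing p omega) = \sum_(omega <- Phi_plus G) pairing p omega.
  by rewrite sum_plus [RHS]big_mkcond; apply: eq_big_seq => omega /mP.
have sum_mw : \sum_(omega <- Phi G) m (pairing p (w *m omega)) =
    \sum_(omega <- Phi G) m (pairing p omega).
  by rewrite -[RHS](perm_big _ (perm_Phi ax wW)) big_map.
have le : \sum_(omega <- Phi_plus G) (m (pairing p (w *m omega)) - pairing p (w *m omega)) <= 0.
  rewrite sumrB sumP -sum_m -sum_mw sum_plus subr_le0 big_mkcond /=.
  by apply: ler_sum => omega _; case: ifP; rewrite // /m le_max lexx.
have ge omega : 0 <= m (pairing p (w *m omega)) - pairing p (w *m omega).
  by rewrite subr_ge0 /m le_max lexx orbT.
have : \sum_(omega <- Phi_plus G) (m (pairing p (w *m omega)) - pairing p (w *m omega)) == 0.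
  by rewrite eq_le le sumr_ge0.
rewrite psumr_eq0 // => /allP H omega oPp; have := H _ oPp; rewrite /= subr_eq0 => /eqP mE.
have [oP _] := Phi_plusP _ _ oPp.
case: (Phi_sign ax (Phi_stable ax wW oP)) => // /weyl_vector_Phi.
by rewrite pairingNr oppr_gt0 -mE /m gt_max ltxx.
Qed.

Lemma chamber_Lambda_plus w : w \in W G ->
  {in Delta_plus G, forall alpha, w *m alpha \in Delta_plus G} ->
  Lambda_plus G (act_dual w p - p) /\
  forall lambda, Lambda_plus G lambda -> Lambda_plus G (act_dual w lambda).
Proof.
move=> wW /(Delta_chamber_Phi wW) wP.
(* Were [w^-1 sigma_i] negative, its opposite would be sent by [w] to [- sigma_i], which is not
   positive. *)
have inv i : invmx w *m sigma G i \in Phi_plus G.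
  have oP : invmx w *m sigma G i \in Phi G by rewrite Phi_stable ?WV ?sigma_Phi.
  case: (Phi_sign ax oP) => // /wP; rewrite mulmxN mulKVmx ?(W_unit ax) //.
  case/Phi_plusP => _ /nonnegP /(_ i); rewrite pairingNr (sigma_dualP ax) eqxx.
  by [].
split=> [|lambda lL]; apply/(Lambda_plusP ax) => i.
  rewrite pairingBl act_dual_pairing weyl_vector_sigma.
  by have := weyl_vector_Phi (inv i); lia.
by rewrite act_dual_pairing Lambda_plus_ge0 //; case/Phi_plusP: (inv i).
Qed.

(** [w p - p] lies in [Lambda_+] and has level 0 because [ell] is invariant, so it is zero by
    (C6). *)
Lemma chamber_weyl_vector w : w \in W G ->
  {in Delta_plus G, forall alpha, w *m alpha \in Delta_plus G} -> act_dual w p = p.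
Proof.
move=> wW wD; have [H _] := chamber_Lambda_plus wW wD.
apply/eqP; rewrite -subr_eq0; apply/eqP; apply: Lambda_plus_ell0 => //.
by rewrite pairingBl (ell_act ax) // subrr.
Qed.

End Chamber.

(** * Polynomial functions and translations *)

Lemma congruence_mul (A : comPzRingType) (l a a' b b' r r' : A) :
  a - a' = l * r -> b - b' = l * r' -> a * b - a' * b' = l * (r * b + a' * r').
Proof. by move=> Ha Hb; rewrite mulrDr mulrA -Ha mulrCA -Hb; ring. Qed.

Section Evaluation.

Context {R : realType} {n : nat}.
Local Notation C := R[i].
Local Notation V := 'rV[C]_n.
Local Notation P := {mpoly C[n]}.
Implicit Types (p q : P) (u v x : V) (eta tau : 'rV[int]_n) (omega : 'cV[int]_n).

Lemma toVD eta tau : @toV R n (eta + tau) = toV eta + toV tau.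
Proof. exact: raddfD. Qed.

Lemma toVB eta tau : @toV R n (eta - tau) = toV eta - toV tau.
Proof. exact: raddfB. Qed.

Lemma toV0 : @toV R n 0 = 0.
Proof. exact: raddf0. Qed.

Lemma toV_act w eta : @toV R n (act_dual w eta) = toV eta *m act_V w.
Proof. by rewrite /toV /act_dual map_mxM. Qed.

Lemma linval_toV eta omega : linval omega (@toV R n eta) = (pairing eta omega)%:~R.
Proof. by rewrite /linval /toV -map_mxM mxE. Qed.

Lemma linvalD omega u v : linval omega (u + v) = linval omega u + linval omega v.
Proof. by rewrite /linval mulmxDl mxE. Qed.

Lemma linvalN omega v : linval omega (- v) = - linval omega v.
Proof. by rewrite /linval mulNmx mxE. Qed.

Lemma linvalB omega u v : linval omega (u - v) = linval omega u - linval omega v.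
Proof. by rewrite linvalD linvalN. Qed.

Lemma linvalZ omega (a : C) v : linval omega (a *: v) = a * linval omega v.
Proof. by rewrite /linval -scalemxAl mxE. Qed.

Lemma linvalNl omega v : linval (- omega) v = - linval omega v.
Proof. by rewrite /linval map_mxN mulmxN mxE. Qed.

Lemma linvalE omega v : linval omega v = \sum_i (omega i 0)%:~R * v 0 i.
Proof. by rewrite /linval mxE; apply: eq_bigr => i _; rewrite !mxE mulrC. Qed.

Lemma linval_act w omega v : linval omega (v *m act_V w) = linval (invmx w *m omega) v.
Proof. by rewrite /linval map_mxM mulmxA. Qed.

Lemma evalV_inj p q : (forall v, evalV p v = evalV q v) -> p = q.
Proof.
move=> pq; apply: mpoly_eval_inj => v; have := pq (\row_i v i).
rewrite /evalV (meval_eq (v2 := v)) => [->|i]; last by rewrite mxE.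
by apply: meval_eq => i; rewrite mxE.
Qed.

Lemma evalVD p q v : evalV (p + q) v = evalV p v + evalV q v.
Proof. exact: mevalD. Qed.

Lemma evalVN p v : evalV (- p) v = - evalV p v.
Proof. exact: mevalN. Qed.

Lemma evalVB p q v : evalV (p - q) v = evalV p v - evalV q v.
Proof. exact: mevalB. Qed.

Lemma evalVM p q v : evalV (p * q) v = evalV p v * evalV q v.
Proof. exact: mevalM. Qed.

Lemma evalVZ c p v : evalV (c *: p) v = c * evalV p v.
Proof. exact: mevalZ. Qed.

Lemma evalVC c v : evalV c%:MP v = c.
Proof. exact: mevalC. Qed.

Lemma evalV0 v : evalV 0 v = 0.
Proof. exact: meval0. Qed.

Lemma evalV1 v : evalV 1 v = 1.
Proof. exact: meval1. Qed.

Lemma evalV_sum (I : Type) (r : seq I) (Q : pred I) (F : I -> P) v :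
  evalV (\sum_(i <- r | Q i) F i) v = \sum_(i <- r | Q i) evalV (F i) v.
Proof. exact: raddf_sum. Qed.

Lemma evalV_prod (I : Type) (r : seq I) (Q : pred I) (F : I -> P) v :
  evalV (\prod_(i <- r | Q i) F i) v = \prod_(i <- r | Q i) evalV (F i) v.
Proof. exact: rmorph_prod. Qed.

Lemma evalV_linpoly omega v : evalV (linpoly omega) v = linval omega v.
Proof.
rewrite /linpoly evalV_sum linvalE; apply: eq_bigr => i _.
by rewrite evalVZ /evalV mevalXU.
Qed.

Definition affine_comp (M : 'M[C]_n) (b : V) p : P :=
  p \mPo [tuple \sum_j M j i *: 'X_j + (b 0 i)%:MP | i < n].

Lemma evalV_affine M b p v : evalV (affine_comp M b p) v = evalV p (v *m M + b).
Proof.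
rewrite /evalV /affine_comp comp_mpoly_meval; apply: meval_eq => i.
rewrite tnth_mktuple mevalD mevalC raddf_sum /= !mxE; congr (_ + _).
by apply: eq_bigr => j _; rewrite mevalZ mevalXU mulrC.
Qed.

Lemma evalV_shift tau p v : evalV (shift_poly tau p) v = evalV p (v - toV tau).
Proof.
rewrite /evalV /shift_poly comp_mpoly_meval; apply: meval_eq => i.
by rewrite tnth_mktuple mevalB mevalXU mevalC !mxE.
Qed.

Lemma evalV_line p x v : exists q : {poly C}, forall t, q.[t] = evalV p (x + t *: v).
Proof.
elim/mpolyind: p => [|c m p _ _ [q Hq]].
  by exists 0 => t; rewrite horner0 evalV0.
exists (c *: \prod_i ((x 0 i)%:P + v 0 i *: 'X) ^+ m i + q) => t.
rewrite hornerD hornerZ Hq evalVD evalVZ; congr (c * _ + _).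
rewrite horner_prod /evalV mevalX; apply: eq_bigr => i _.
by rewrite horner_exp hornerD hornerZ hornerX hornerC !mxE mulrC.
Qed.

(** This stands in for limits: equalities obtained at far integer points of a line, where a
    denominator can be cancelled, extend to [t = 0], where it may vanish. *)
Lemma evalV_line_eq p q x v k0 : (forall k : nat, (k0 <= k)%N ->
    evalV p (x + k%:R *: v) = evalV q (x + k%:R *: v)) ->
  forall t, evalV p (x + t *: v) = evalV q (x + t *: v).
Proof.
move=> pq t; have [h Hh] := evalV_line (p - q) x v.
suff h0 : h = 0 by apply/eqP; rewrite -subr_eq0 -evalVB -Hh h0 horner0.
apply: (@poly_eq0_infinite _ (fun k => (k0 + k)%:R)).
  by move=> a b /eqP; rewrite eqr_nat eqn_add2l => /eqP.
by move=> k; rewrite Hh evalVB pq ?subrr // leq_addr.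
Qed.

Lemma linpoly_neq0 omega : omega != 0 -> linpoly omega != 0 :> P.
Proof.
apply: contra => /eqP o0; apply/eqP/matrixP => i j; rewrite ord1 mxE.
have := evalV_linpoly omega (delta_mx 0 i); rewrite o0 evalV0 linvalE (bigD1 i) //=.
rewrite mxE !eqxx mulr1 big1 => [|k ki]; last by rewrite mxE (negPf ki) mulr0.
by rewrite addr0 => /esym/eqP; rewrite intr_eq0 => /eqP.
Qed.

Lemma linpolyN omega : linpoly (- omega) = - linpoly omega :> P.
Proof. by apply: evalV_inj => v; rewrite evalVN !evalV_linpoly linvalNl. Qed.

(** Project along [c] onto the hyperplane of [alpha]: any polynomial differs from its composite with
    the projection [pi] by a multiple of [linpoly alpha], and here the composite vanishes. *)
Lemma linpoly_dvdP alpha (c : V) p : linval alpha c != 0 ->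
  (forall v, linval alpha v = 0 -> evalV p v = 0) -> exists q, p = linpoly alpha * q.
Proof.
move=> ac0 p0; pose a := (linval alpha c)^-1.
pose pi : n.-tuple P := [tuple 'X_i - (a * c 0 i) *: linpoly alpha | i < n].
have [q Hq] : exists q, p - (p \mPo pi) = linpoly alpha * q.
  have HM q1 q2 : (exists q, q1 - (q1 \mPo pi) = linpoly alpha * q) ->
    (exists q, q2 - (q2 \mPo pi) = linpoly alpha * q) ->
    exists q, q1 * q2 - ((q1 * q2) \mPo pi) = linpoly alpha * q.
    move=> [r1 H1] [r2 H2]; exists (r1 * q2 + (q1 \mPo pi) * r2).
    rewrite (_ : (q1 * q2) \mPo pi = (q1 \mPo pi) * (q2 \mPo pi)); last exact: rmorphM.
    exact: congruence_mul.
  have H1 : exists q, 1 - (1 \mPo pi) = linpoly alpha * q.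
    by exists 0; rewrite comp_mpoly1 subrr mulr0.
  elim/mpolyind: {p0} p => [|k m p _ _ [q Hq]].
    by exists 0; rewrite comp_mpoly0 subrr mulr0.
  have [r Hr] : exists q, 'X_[m] - ('X_[m] \mPo pi) = linpoly alpha * q.
    rewrite mpolyXE_id; apply: (big_ind (fun q => exists r, q - (q \mPo pi) = linpoly alpha * r)).
    - exact: H1.
    - exact: HM.
    move=> i _; elim: (m i) => [|e IH]; first by rewrite expr0; exact: H1.
    rewrite exprS; apply: HM; last exact: IH.
    exists (a * c 0 i)%:MP.
    by rewrite comp_mpolyXU -tnth_nth tnth_mktuple opprB addrC subrK -mul_mpolyC mulrC.
  exists (k *: r + q); rewrite mulrDr -Hq -scalerAr -Hr comp_mpolyD comp_mpolyZ scalerBr.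
  by rewrite opprD addrACA.
exists q; rewrite -Hq (_ : p \mPo pi = 0) ?subr0 //; apply: evalV_inj => v.
have -> : evalV (p \mPo pi) v = evalV p (v - (a * linval alpha v) *: c).
  rewrite /evalV comp_mpoly_meval; apply: meval_eq => i.
  rewrite tnth_mktuple mevalB mevalXU mevalZ -/(evalV _ _) evalV_linpoly !mxE.
  by ring.
rewrite evalV0 p0 // linvalB linvalZ mulrAC mulVf // mul1r subrr //.
Qed.

(** The hyperplane of [alpha] is irreducible: on the line inside it joining [v0] to [v], the
    restrictions of [p] and [q] have product zero and that of [p] is nonzero. *)
Lemma linpoly_dvd_mul alpha (c : V) p q r : linval alpha c != 0 ->
  (exists2 v, linval alpha v = 0 & evalV p v != 0) -> p * q = linpoly alpha * r ->
  exists q', q = linpoly alpha * q'.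
Proof.
move=> ac0 [v0 av0 pv0] pq; apply: (linpoly_dvdP ac0) => v av.
have nz k : linval alpha (v0 + k *: (v - v0)) = 0.
  by rewrite linvalD linvalZ linvalB av av0 subrr mulr0 addr0.
have [f Hf] := evalV_line p v0 (v - v0).
have [g Hg] := evalV_line q v0 (v - v0).
have : f * g = 0.
  apply: (@poly_eq0_infinite _ (fun k => k%:R)).
    by move=> a b /eqP; rewrite eqr_nat => /eqP.
  move=> k; rewrite hornerM Hf Hg -evalVM pq evalVM evalV_linpoly nz mul0r //.
move/eqP; rewrite mulf_eq0 => /orP [/eqP f0|/eqP g0].
  by have := Hf 0; rewrite f0 horner0 scale0r addr0 => /esym/eqP; rewrite (negPf pv0).
by have := Hg 1; rewrite g0 horner0 scale1r addrC subrK => <-.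
Qed.

End Evaluation.

(** * Translations of rational functions *)

Lemma frac_numden (D : idomainType) (f : {fraction D}) :
  f = FracField.tofrac \n_(repr f) / FracField.tofrac \d_(repr f).
Proof.
have dnz : FracField.tofrac \d_(repr f) != 0 by rewrite tofrac_eq0 denom_ratioP.
apply: (mulIf dnz); rewrite divfK // -{1}[f]reprK.
unlock FracField.tofrac; rewrite -[LHS]FracField.pi_mul.
apply/eqmodP; rewrite /= FracField.equivfE /FracField.mulf.
by rewrite !numden_Ratio ?mulf_neq0 ?oner_eq0 ?denom_ratioP // !mulr1 mulrC.
Qed.

Lemma frac_eqP (D : idomainType) (p q a b : D) : q != 0 -> b != 0 ->
  FracField.tofrac p / FracField.tofrac q = FracField.tofrac a / FracField.tofrac b <->
  p * b = a * q.
Proof.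
move=> nzq nzb.
have nzq' : FracField.tofrac q != 0 by rewrite tofrac_eq0.
have nzb' : FracField.tofrac b != 0 by rewrite tofrac_eq0.
split=> [/eqP|e].
  by rewrite eqr_div // -!tofracM tofrac_eq => /eqP.
by apply/eqP; rewrite eqr_div // -!tofracM tofrac_eq e.
Qed.

Section Translation.

Context {R : realType} {n : nat}.
Local Notation C := R[i].
Local Notation P := {mpoly C[n]}.
Local Notation K := {fraction {mpoly C[n]}}.
Implicit Types (p q : P) (f g : K) (eta tau : 'rV[int]_n).

HB.instance Definition _ :=
  GRing.isZmodMorphism.Build P K (@to_frac R n) (@tofrac_is_zmod_morphism P).
HB.instance Definition _ :=
  GRing.isMonoidMorphism.Build P K (@to_frac R n) (@tofrac_is_monoid_morphism P).

Lemma to_frac_eq0 p : (to_frac p == 0) = (p == 0).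
Proof. exact: tofrac_eq0. Qed.

Lemma to_frac_inj : injective (@to_frac R n).
Proof. by move=> p q /eqP; rewrite tofrac_eq => /eqP. Qed.

Lemma fracP f : exists p q, q != 0 /\ f = to_frac p / to_frac q.
Proof. by exists \n_(repr f), \d_(repr f); split; [exact: denom_ratioP|exact: frac_numden]. Qed.

Lemma shift_is_zmod_morphism tau : zmod_morphism (@shift_poly R n tau).
Proof. by move=> p q; rewrite /shift_poly rmorphB. Qed.

Lemma shift_is_monoid_morphism tau : monoid_morphism (@shift_poly R n tau).
Proof. by split=> [|p q]; rewrite /shift_poly ?rmorph1 ?rmorphM. Qed.

HB.instance Definition _ tau :=
  GRing.isZmodMorphism.Build P P (shift_poly tau) (shift_is_zmod_morphism tau).
HB.instance Definition _ tau :=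
  GRing.isMonoidMorphism.Build P P (shift_poly tau) (shift_is_monoid_morphism tau).

Lemma shift_polyC tau c : shift_poly tau c%:MP = c%:MP :> P.
Proof. exact: comp_mpolyC. Qed.

Lemma shift_polyD eta tau p : shift_poly eta (shift_poly tau p) = shift_poly (eta + tau) p.
Proof.
apply: evalV_inj => v.
rewrite [LHS]evalV_shift.
rewrite [LHS]evalV_shift.
rewrite [RHS]evalV_shift.
rewrite toVD.
rewrite opprD.
rewrite addrA.
reflexivity.
Qed.

Lemma shift_poly0 p : shift_poly 0 p = p.
Proof. by apply: evalV_inj => v; rewrite !evalV_shift toV0 subr0. Qed.

Lemma shift_poly_eq0 tau p : (shift_poly tau p == 0) = (p == 0).
Proof.
apply/eqP/eqP => [H|->]; last by rewrite rmorph0.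
by rewrite -(shift_poly0 p) -(addNr tau) -shift_polyD H rmorph0.
Qed.

Opaque shift_poly evalV to_frac linpoly.

(** [Ttr] is defined on a chosen representative; the cross-multiplied equality of two
    representatives is preserved by the shift, so any fraction may be used. *)
Lemma Ttr_frac tau p q : q != 0 ->
  Ttr tau (to_frac p / to_frac q) = to_frac (shift_poly tau p) / to_frac (shift_poly tau q).
Proof.
move=> nzq; rewrite /Ttr; set f := to_frac p / to_frac q.
set a := \n_(repr f); set b := \d_(repr f).
have nzb : b != 0 by exact: denom_ratioP.
have nzsq : shift_poly tau q != 0 by rewrite shift_poly_eq0.
have nzsb : shift_poly tau b != 0 by rewrite shift_poly_eq0.
apply/(frac_eqP _ _ nzsb nzsq).
have /frac_eqP := esym (frac_numden f); move=> /(_ nzb nzq) e.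
rewrite -[LHS](rmorphM (shift_poly tau)) -[RHS](rmorphM (shift_poly tau)).
by rewrite -/a -/b in e *; rewrite e.
Qed.

Opaque Ttr.

Lemma Ttr_poly tau p : Ttr tau (to_frac p) = to_frac (shift_poly tau p).
Proof.
have := Ttr_frac tau p (oner_neq0 P).
by rewrite !rmorph1 !divr1.
Qed.

Lemma Ttr_is_zmod_morphism tau : zmod_morphism (@Ttr R n tau).
Proof.
move=> f g; have [p [q [nzq ->]]] := fracP f; have [p' [q' [nzq' ->]]] := fracP g.
rewrite -mulNr addf_div ?to_frac_eq0 // -rmorphN -!rmorphM -rmorphD !Ttr_frac ?mulf_neq0 //.
rewrite -mulNr addf_div ?to_frac_eq0 ?shift_poly_eq0 //.
by rewrite !(rmorphD, rmorphM, rmorphN).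
Qed.

Lemma Ttr_is_monoid_morphism tau : monoid_morphism (@Ttr R n tau).
Proof.
split=> [|f g].
  by have := Ttr_poly tau 1; rewrite !rmorph1.
have [p [q [nzq ->]]] := fracP f; have [p' [q' [nzq' ->]]] := fracP g.
by rewrite mulf_div -!rmorphM !Ttr_frac ?mulf_neq0 // !rmorphM /= mulf_div.
Qed.

HB.instance Definition _ tau :=
  GRing.isZmodMorphism.Build K K (@Ttr R n tau) (Ttr_is_zmod_morphism tau).
HB.instance Definition _ tau :=
  GRing.isMonoidMorphism.Build K K (@Ttr R n tau) (Ttr_is_monoid_morphism tau).

Lemma TtrD eta tau f : Ttr eta (Ttr tau f) = Ttr (eta + tau) f.
Proof.
have [p [q [nzq ->]]] := fracP f.
have nzsq : shift_poly tau q != 0 by rewrite shift_poly_eq0.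
have e1 := Ttr_frac tau p nzq.
have e2 := Ttr_frac eta (shift_poly tau p) nzsq.
have e3 := Ttr_frac (eta + tau) p nzq.
apply: (etrans (congr1 (Ttr eta) e1)).
apply: (etrans e2); apply: (etrans _ (esym e3)).
exact: (congr2 (fun a b => to_frac a / to_frac b) (shift_polyD _ _ _) (shift_polyD _ _ _)).
Qed.

Lemma Ttr0 f : Ttr 0 f = f.
Proof.
have [p [q [nzq ->]]] := fracP f; apply: (etrans (Ttr_frac 0 p nzq)).
exact: (congr2 (fun a b => to_frac a / to_frac b) (shift_poly0 _) (shift_poly0 _)).
Qed.

Lemma Ttr_const tau c : Ttr tau (to_frac c%:MP) = to_frac c%:MP :> K.
Proof. by rewrite Ttr_poly shift_polyC. Qed.

End Translation.

Opaque shift_poly evalV to_frac linpoly Ttr.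

(** * The operator [L] on invariant polynomials *)

Lemma prod_factor (A : comPzRingType) (T : eqType) (r : seq T) (Q : pred T) (F : T -> A) a :
  a \in r -> Q a -> exists q, \prod_(x <- r | Q x) F x = F a * q.
Proof. by move=> ar Qa; rewrite (big_rem a) //= Qa; eexists. Qed.

Lemma mul_opp_sqr (A : comPzRingType) (a b c : A) : b * (a * (a * c)) = a * - a * b * - c.
Proof. by ring. Qed.

(** * Divisibility of Weyl sums by the roots *)

Section WeylSums.

Context {R : realType} {n : nat} (G : datum n) (ax : lattice_axioms G).
Local Notation C := R[i].
Local Notation V := 'rV[C]_n.
Local Notation P := {mpoly C[n]}.
Local Notation lin := (@linpoly R n).
Implicit Types (p q : P) (u v x : V) (eta tau : 'rV[int]_n) (omega alpha beta : 'cV[int]_n).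
Implicit Types (w s : 'M[int]_n).

(** Roots of both signs occur, which makes this common denominator invariant rather than
    antiinvariant; the price is that each hyperplane has to be divided out twice. *)
Definition root_poly : P := \prod_(alpha <- Delta G) lin alpha.

Definition denom eta : P := \prod_(alpha <- Delta G | 0 < pairing eta alpha) lin alpha.

Definition cofactor_den eta : P :=
  \prod_(alpha <- Delta G | ~~ (0 < pairing eta alpha)) lin alpha.

Lemma root_polyE eta : root_poly = denom eta * cofactor_den eta.
Proof. exact: bigID. Qed.

Lemma prod_roots_neq0 (Q : pred 'cV[int]_n) : \prod_(alpha <- Delta G | Q alpha) lin alpha != 0.
Proof.
rewrite prodf_seq_neq0; apply/allP => alpha aD; apply/implyP => _.
exact: linpoly_neq0 (root_neq0 ax aD).
Qed.

Lemma root_poly_neq0 : root_poly != 0.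
Proof. exact: prod_roots_neq0 xpredT. Qed.

Lemma denom_neq0 eta : denom eta != 0.
Proof. exact: prod_roots_neq0. Qed.

Lemma reindex_W (A : {fset 'cV[int]_n}) (Q : pred 'cV[int]_n) (F : 'cV[int]_n -> C) w :
  perm_eq [seq w *m omega | omega <- A] A ->
  \prod_(omega <- A | Q omega) F omega = \prod_(omega <- A | Q (w *m omega)) F (w *m omega).
Proof. by move=> pA; rewrite -(perm_big _ pA) big_map. Qed.

Lemma cofactor_den_act w eta v : w \in W G ->
  evalV (cofactor_den (act_dual w eta)) (v *m act_V w) = evalV (cofactor_den eta) v.
Proof.
move=> wW; rewrite !evalV_prod (reindex_W _ _ (perm_Delta ax wW)).
apply: eq_big => alpha; first by rewrite (act_dualM_pairing ax).
by move=> _; rewrite !evalV_linpoly linval_act mulKmx ?(W_unit ax).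
Qed.

Lemma root_poly_act w v : w \in W G -> evalV root_poly (v *m act_V w) = evalV root_poly v.
Proof.
move=> wW; rewrite !evalV_prod (reindex_W _ _ (perm_Delta ax wW)).
by apply: eq_bigr => alpha _; rewrite !evalV_linpoly linval_act mulKmx ?(W_unit ax).
Qed.

Lemma act_V_reflection alpha (c : 'rV[int]_n) v : pairing c alpha = 2 ->
  v *m act_V (1%:M - alpha *m c) = v - linval alpha v *: toV c.
Proof.
move=> ca; rewrite /act_V invmx_reflection // map_mxB map_mxM map_mx1.
rewrite mulmxBr mulmx1 mulmxA [v *m _]mx11_scalar mul_scalar_mx.
by [].
Qed.

(** The vectors [2 e_i - beta(e_i) c] are killed by [beta]. If [beta'] kills them all, then
    [2 beta' = m beta] with [m > 0]. For even [m], primitivity of [beta'] forces [beta' = beta]; for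
    [m = 2 k + 1], the root [beta = 2 (beta' - k beta)] is not primitive. *)
Lemma roots_independent beta beta' :
  beta \in Delta_plus G -> beta' \in Delta_plus G -> beta != beta' ->
  exists2 v, linval beta v = 0 & linval beta' v != 0 :> C.
Proof.
move=> bp bp' neq; have [bD _] := Delta_plusP _ _ bp; have [bD' _] := Delta_plusP _ _ bp'.
have [s [c [sW cb _]]] := root_reflection ax bD.
pose m := pairing c beta'.
have [/forallP e|] := boolP [forall i, 2 * beta' i 0 == beta i 0 * m].
  exfalso; have e2 : 2 *: beta' = m *: beta.
    by apply/matrixP => i j; rewrite ord1 !mxE [RHS]mulrC; apply/eqP.
  have pos := weyl_vector_root ax bp; have pos' := weyl_vector_root ax bp'.
  have ee := congr1 (pairing (weyl_vector G)) e2; rewrite !pairingZr in ee.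
  have m0 : 0 < m by rewrite -(pmulr_lgt0 _ pos) -ee pmulr_rgt0.
  have [k mk] : exists k : int, m = 2 * k \/ m = 2 * k + 1.
    exists (m %/ 2)%Z; have := divz_eq m 2; have := modz_ge0 m (isT : 2 != 0 :> int).
    by have := ltz_pmod m (isT : 0 < 2 :> int); lia.
  case: mk => mk.
    have bk : beta' = k *: beta.
      apply/matrixP => i j; have /matrixP /(_ i j) := e2; rewrite !mxE mk.
      by move=> h; apply: (@mulfI _ (2 : int)); rewrite // mulrA.
    have [k1|k1] := root_primitive ax bD' bk.
      by move: neq; rewrite bk k1 scale1r eqxx.
    by move: m0; rewrite mk k1.
  have bk : beta = 2 *: (beta' - k *: beta).
    apply/matrixP => i j; have /matrixP /(_ i j) := e2; rewrite !mxE mk.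
    by move=> h; rewrite mulrBr h; ring.
  by have [] := root_primitive ax bD bk.
rewrite negb_forall => /existsP [i neqi].
exists (2 *: toV (delta_mx 0 i) - (beta i 0)%:~R *: toV c).
  rewrite linvalB !linvalZ !linval_toV cb /pairing -rowE !mxE mulrC subrr //.
rewrite linvalB !linvalZ !linval_toV -/m /pairing -rowE !mxE.
apply: contra neqi; rewrite subr_eq0 -intrM (_ : 2 = 2%:~R) // -intrM eqr_int.
by [].
Qed.

Section Divisibility.

Variables (r : seq 'rV[int]_n) (S : pred 'cV[int]_n) (u : 'rV[int]_n -> P).

Hypothesis S_sym : {in Delta G, forall alpha, S (- alpha) = S alpha}.
Hypothesis r_stable : forall s beta, s \in W G -> beta \in Delta G -> S beta ->
  reflection_along beta s -> perm_eq [seq act_dual s eta | eta <- r] r.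
Hypothesis u_equiv : forall s beta, s \in W G -> beta \in Delta G -> S beta ->
  reflection_along beta s -> forall eta v,
  evalV (u (act_dual s eta)) (v *m act_V s) = evalV (u eta) v.

Let N := \sum_(eta <- r) cofactor_den eta * u eta.

(** At least one of [beta] and [- beta] is not positive on [eta] and so remains in the cofactor. *)
Lemma cofactor_den_dvd beta eta : beta \in Delta G ->
  exists q, cofactor_den eta = lin beta * q.
Proof.
move=> bD; have [pos|npos] := boolP (0 < pairing eta beta); last exact: (prod_factor lin bD npos).
have [q Hq] : exists q, cofactor_den eta = lin (- beta) * q.
  have npos : ~~ (0 < pairing eta (- beta)) by rewrite pairingNr oppr_gt0 -leNgt ltW.
  exact: (prod_factor lin (root_opp ax bD) npos).
by exists (- q); rewrite Hq linpolyN mulNr mulrN.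
Qed.

(* One root factor comes from the summands, the second one from the antisymmetry of the
   quotient under the reflection along [beta]. *)
Lemma weyl_sum_dvd_sqr beta : beta \in Delta_plus G -> S beta ->
  exists q, N = lin beta * lin (- beta) * q.
Proof.
move=> bp Sb; have [bD _] := Delta_plusP _ _ bp.
have [s [c [sW cb defs]]] := root_reflection ax bD.
have sb : reflection_along beta s by exists c.
have [N1 defN] : exists q, N = lin beta * q.
  rewrite /N; elim: (r) => [|eta r' [q Hq]]; first by exists 0; rewrite big_nil mulr0.
  have [q' Hq'] := cofactor_den_dvd eta bD.
  by exists (q' * u eta + q); rewrite big_cons Hq Hq' mulrDr mulrA.
have invN v : evalV N (v *m act_V s) = evalV N v.
  rewrite /N !evalV_sum -(perm_big _ (r_stable sW bD Sb sb)) big_map.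
  by apply: eq_bigr => eta _; rewrite !evalVM cofactor_den_act // (u_equiv sW bD Sb sb).
have c2 : linval beta (toV c) = 2 :> C by rewrite linval_toV cb.
have cnz : linval beta (toV c) != 0 :> C by rewrite c2 pnatr_eq0.
have [q defN1] : exists q, N1 = lin beta * q.
  apply: (linpoly_dvdP cnz) => v bv.
  (* For [v] on the hyperplane the reflection exchanges [v + t c] and [v - t c]. As [N] is invariant
     and [lin beta] changes sign, [N1] is odd along this line, hence zero at [v]; the values
     [t = k + 1] are used because [lin beta] cannot be cancelled at [t = 0]. *)
  have [f Hf] := evalV_line N1 v (toV c).
  have [g Hg] := evalV_line N1 v (- toV c).
  have fg : f + g = 0.
    apply: (@poly_eq0_infinite _ (fun k => k.+1%:R)).
      by move=> a b /eqP; rewrite eqr_nat => /eqP [].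
    move=> k; rewrite hornerD Hf Hg.
    have := invN (v + k.+1%:R *: toV c).
    rewrite defs act_V_reflection // linvalD linvalZ bv add0r c2 defN !evalVM !evalV_linpoly.
    have -> : v + k.+1%:R *: toV c - (k.+1%:R * 2) *: toV c = v + k.+1%:R *: - toV c.
      by rewrite scalerN -addrA -scalerBl; congr (_ + _); rewrite -scaleNr; congr (_ *: _); ring.
    rewrite !linvalD !linvalZ linvalN bv c2 !add0r mulrN mulNr => /eqP.
    rewrite eq_sym -addr_eq0 -mulrDr mulf_eq0 mulf_eq0 !pnatr_eq0 /= => /eqP //.
  have /eqP : f.[0] + g.[0] = 0 by rewrite -hornerD fg horner0.
  by rewrite Hf Hg !scale0r !addr0 -mulr2n mulrn_eq0 /= => /eqP.
by exists (- q); rewrite defN defN1 linpolyN [lin beta * - _]mulrN mulrNN mulrA.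
Qed.

Lemma linpoly_dvd_prod beta (t : seq 'cV[int]_n) q q' :
  beta \in Delta_plus G -> {subset t <= Delta_plus G} -> beta \notin t ->
  (\prod_(alpha <- t) (lin alpha * lin (- alpha))) * q = lin beta * q' ->
  exists q'', q = lin beta * q''.
Proof.
move=> bp; have [bD _] := Delta_plusP _ _ bp.
have [s [c [sW cb defs]]] := root_reflection ax bD.
have cnz : linval beta (toV c) != 0 :> C by rewrite linval_toV cb pnatr_eq0.
elim: t q' => [|alpha t IH] q' tp; first by rewrite big_nil mul1r => _ ->; exists q'.
rewrite inE negb_or => /andP [neq bt]; rewrite big_cons.
have [v bv av] := roots_independent bp (tp _ (mem_head _ _)) neq.
rewrite -!mulrA => /(linpoly_dvd_mul cnz) [|q1].
  by exists v; rewrite // evalV_linpoly.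
move=> /(linpoly_dvd_mul cnz) [|q2].
  by exists v; rewrite // evalV_linpoly linvalNl oppr_eq0.
by apply: IH => // a ta; apply: tp; rewrite inE ta orbT.
Qed.

Lemma prod_roots_sym : \prod_(alpha <- Delta G | S alpha) lin alpha =
  \prod_(alpha <- [seq alpha <- Delta_plus G | S alpha]) (lin alpha * lin (- alpha)).
Proof.
have pD : perm_eq (Delta G) (enum_fset (Delta_plus G) ++ [seq - alpha | alpha <- Delta_plus G]).
  apply: uniq_perm => // [|alpha].
    rewrite cat_uniq fset_uniq map_inj_uniq ?fset_uniq ?andbT //=; last exact: oppr_inj.
    apply/hasPn => _ /mapP [alpha ap ->]; apply/negP => /= /(weyl_vector_root ax).
    by rewrite pairingNr oppr_gt0 ltNge ltW // (weyl_vector_root ax).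
  rewrite mem_cat; apply/idP/orP => [aD|[/Delta_plusP [] //|/mapP [b /Delta_plusP [bD _] ->]]].
    case: (root_sign ax aD) => ap; [by left|right].
    by apply/mapP; exists (- alpha); rewrite ?opprK.
  exact: (root_opp ax).
rewrite (perm_big _ pD) big_cat big_map /= big_filter big_split /=; congr (_ * _).
rewrite big_seq_cond [RHS]big_seq_cond; apply: eq_bigl => alpha /=.
by case: (boolP (alpha \in _)) => //= /Delta_plusP [aD _]; rewrite S_sym.
Qed.

(** Distinct positive roots are coprime, so the double factors multiply up. The generality in [S]
    and [r] covers both the whole sum, with all roots, and the orbit sums at a singular point, with
    the roots vanishing there. *)
Lemma weyl_sum_dvd : exists q, N = (\prod_(alpha <- Delta G | S alpha) lin alpha) * q.
Proof.
rewrite prod_roots_sym; move: (filter_uniq S (fset_uniq (Delta_plus G))).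
set t := [seq alpha <- _ | _].
have : {subset t <= Delta_plus G} by move=> a; rewrite mem_filter => /andP [].
have : all S t by rewrite /t filter_all.
elim: t => [|beta t IH]; first by move=> _ _ _; exists N; rewrite big_nil mul1r.
move=> /= /andP [Sb St] tp /andP [bt Ut].
have tp' : {subset t <= Delta_plus G} by move=> a ta; apply: tp; rewrite inE ta orbT.
have bp := tp _ (mem_head _ _).
have [q Hq] := IH St tp' Ut.
have [q' Hq'] := weyl_sum_dvd_sqr bp Sb.
have [bD _] := Delta_plusP _ _ bp.
have nzb : lin beta != 0 by rewrite linpoly_neq0 // (root_neq0 ax bD).
have [q1 Hq1] : exists q1, q = lin beta * q1.
  by apply: (linpoly_dvd_prod bp tp' bt (q' := lin (- beta) * q')); rewrite -Hq Hq' mulrA.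
have [q2 Hq2] : exists q2, q1 = lin beta * q2.
  apply: (linpoly_dvd_prod bp tp' bt (q' := - q')).
  apply: (mulfI nzb); rewrite mulrCA -Hq1 -Hq Hq' linpolyN.
  by rewrite mulrN mulNr !mulrA mulrN.
exists (- q2); rewrite big_cons Hq Hq1 Hq2 linpolyN.
exact: mul_opp_sqr.
Qed.

End Divisibility.

End WeylSums.

(** * Degree estimates *)

Lemma affine_mulB (A : comPzRingType) (l a b x y : A) :
  (l - a) * x - (l - b) * y = (l - a) * (x - y) + (b - a) * y.
Proof. by ring. Qed.

Section Degrees.

Context {R : realType} {n : nat}.
Local Notation C := R[i].
Local Notation P := {mpoly C[n]}.
Local Notation lin := (@linpoly R n).
Implicit Types (p q f g : P) (eta tau : 'rV[int]_n) (omega : 'cV[int]_n).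

Lemma msizeM_bound p q a b : (msize p <= a -> msize q <= b -> msize (p * q) <= (a + b).-1)%N.
Proof.
move=> pa qb; have [->|nzp] := eqVneq p 0; first by rewrite mul0r msize0.
have [->|nzq] := eqVneq q 0; first by rewrite mulr0 msize0.
by rewrite msizeM // -!subn1 leq_sub2r // leq_add.
Qed.

Lemma msizeD_bound p q a : (msize p <= a -> msize q <= a -> msize (p + q) <= a)%N.
Proof. by move=> pa qa; apply: leq_trans (msizeD_le p q) _; rewrite geq_max pa. Qed.

Lemma msizeB_bound p q a : (msize p <= a -> msize q <= a -> msize (p - q) <= a)%N.
Proof. by move=> pa qa; apply: msizeD_bound; rewrite ?msizeN. Qed.

Lemma msize_sum_bound (T : eqType) (r : seq T) (Q : pred T) (F : T -> P) a :
  (forall x, x \in r -> Q x -> msize (F x) <= a)%N ->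
  (msize (\sum_(x <- r | Q x) F x) <= a)%N.
Proof.
move=> H; rewrite big_seq_cond; elim/big_rec: _ => [|x q /andP [xr Qx] IH].
  by rewrite msize0.
by apply: msizeD_bound => //; apply: H.
Qed.

Lemma msizeC_le (c : C) : (msize (c%:MP : P) <= 1)%N.
Proof. by rewrite msizeC; case: (_ != _). Qed.

Lemma msize_linpoly_le omega : (msize (lin omega) <= 2)%N.
Proof.
Transparent linpoly.
rewrite /linpoly; apply: msize_sum_bound => i _ _.
by apply: leq_trans (msizeZ_le _ _) _; rewrite msizeX mdeg1.
Qed.
Opaque linpoly.

Lemma msize_linpoly omega : omega != 0 -> msize (lin omega) = 2.
Proof.
move=> nz; apply/eqP; rewrite eqn_leq msize_linpoly_le /= ltnNge.
apply/negP => /msize1_polyC e.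
have := evalV_linpoly omega (0 : 'rV[C]_n); rewrite e evalVC /linval mul0mx mxE => c0.
by have := linpoly_neq0 (R := R) nz; rewrite e c0 mpolyC0 eqxx.
Qed.

Lemma msize_prod_linpoly (r : seq 'cV[int]_n) (Q : pred 'cV[int]_n) :
  {in r, forall omega, omega != 0} ->
  msize (\prod_(omega <- r | Q omega) lin omega) = (count Q r).+1.
Proof.
elim: r => [|omega r IH] nz; first by rewrite big_nil msize1.
have nz' : {in r, forall omega, omega != 0} by move=> o or; apply: nz; rewrite inE or orbT.
rewrite big_cons /=; case: ifP => _; last by rewrite IH.
have nz1 := linpoly_neq0 (R := R) (nz _ (mem_head _ _)).
have nz2 : \prod_(omega <- r | Q omega) lin omega != 0.
  rewrite prodf_seq_neq0; apply/allP => o or; apply/implyP => _.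
  by apply: linpoly_neq0; apply: nz'.
by rewrite (msizeM nz1 nz2) IH // msize_linpoly // nz // mem_head.
Qed.

Lemma msize_affine_factor omega (c : C) : (msize (lin omega - c%:MP) <= 2)%N.
Proof. by apply: msizeB_bound; rewrite ?msize_linpoly_le // (leq_trans (msizeC_le c)). Qed.

Lemma msize_prod_affine (r : seq 'cV[int]_n) (Q : pred 'cV[int]_n) (a : 'cV[int]_n -> C) :
  (msize (\prod_(omega <- r | Q omega) (lin omega - (a omega)%:MP)) <= (count Q r).+1)%N.
Proof.
elim: r => [|omega r IH]; first by rewrite big_nil msize1.
rewrite big_cons /=; case: ifP => _ //.
exact: msizeM_bound (msize_affine_factor _ _) IH.
Qed.

Lemma msize_prod_affineB (r : seq 'cV[int]_n) (Q : pred 'cV[int]_n) (a b : 'cV[int]_n -> C) :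
  (msize (\prod_(omega <- r | Q omega) (lin omega - (a omega)%:MP) -
          \prod_(omega <- r | Q omega) (lin omega - (b omega)%:MP)) <= count Q r)%N.
Proof.
elim: r => [|omega r IH]; first by rewrite !big_nil subrr msize0.
rewrite !big_cons /=; case: ifP => _ //.
set X := (X in _ * X - _) in IH *; set Y := (X in _ - _ * X) in IH *.
have -> : (lin omega - (a omega)%:MP) * X - (lin omega - (b omega)%:MP) * Y =
    (lin omega - (a omega)%:MP) * (X - Y) + (b omega - a omega)%:MP * Y.
  by rewrite mpolyCB; apply: affine_mulB.
apply: msizeD_bound; first exact: msizeM_bound (msize_affine_factor _ _) IH.
exact: msizeM_bound (msizeC_le _) (msize_prod_affine r Q b).
Qed.

(** Translations fix leading terms. The property [Q d], degree at most [d] with a difference of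
    degree below [d], is multiplicative by a twisted Leibniz rule, so only the variables need a
    check. *)
Lemma msize_shiftB tau f : (msize (f - shift_poly tau f) <= (msize f).-1)%N.
Proof.
pose Q d p := (msize p <= d.+1)%N /\ (msize (p - shift_poly tau p) <= d)%N.
have Q1 : Q 0%N 1 by split; rewrite ?msize1 // rmorph1 subrr msize0.
have QM d1 d2 p1 p2 : Q d1 p1 -> Q d2 p2 -> Q (d1 + d2)%N (p1 * p2).
  move=> [a1 b1] [a2 b2]; split.
    by apply: leq_trans (msizeM_bound a1 a2) _; rewrite addSn addnS.
  have -> : p1 * p2 - shift_poly tau (p1 * p2) =
      (p1 - shift_poly tau p1) * p2 + shift_poly tau p1 * (p2 - shift_poly tau p2).
    by rewrite rmorphM mulrBl mulrBr addrA subrK.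
  have s1 : (msize (shift_poly tau p1) <= d1.+1)%N.
    have -> : shift_poly tau p1 = p1 - (p1 - shift_poly tau p1) by rewrite subKr.
    by apply: msizeB_bound; rewrite // ltnW.
  apply: msizeD_bound.
    by apply: leq_trans (msizeM_bound b1 a2) _; rewrite addnS.
  by apply: leq_trans (msizeM_bound s1 b2) _.
have QX m : Q (mdeg m) 'X_[m].
  rewrite mpolyXE_id mdegE; elim/big_rec2: _ => // i p d _ IH; apply: (QM) => //.
  elim: (m i) => [|e IHe]; first by rewrite expr0.
  rewrite exprS -add1n; apply: (QM) => //; split; first by rewrite msizeX mdeg1.
  suff -> : 'X_i - shift_poly tau 'X_i = (((tau 0 i)%:~R : C)%:MP : P) by apply: msizeC_le.
  apply: evalV_inj => v; rewrite evalVB evalV_shift evalVC.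
  Transparent evalV.
  by rewrite /evalV !mevalXU !mxE opprB addrC subrK.
  Opaque evalV.
have -> : f - shift_poly tau f =
    \sum_(m <- msupp f) (f@_m *: 'X_[m] - shift_poly tau (f@_m *: 'X_[m])).
  by rewrite sumrB -raddf_sum -mpolyE.
apply: msize_sum_bound => m mf _.
have [_] := QX m; move=> le.
have -> : f@_m *: 'X_[m] - shift_poly tau (f@_m *: 'X_[m]) =
    f@_m *: ('X_[m] - shift_poly tau 'X_[m]).
  by rewrite -mul_mpolyC rmorphM /= shift_polyC -mulrBr mul_mpolyC.
apply: leq_trans (msizeZ_le _ _) (leq_trans le _).
by have := msize_mdeg_lt mf; case: (msize f).
Qed.

Lemma msize_shift tau f : (msize (shift_poly tau f) <= msize f)%N.
Proof.
have -> : shift_poly tau f = f - (f - shift_poly tau f) by rewrite subKr.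
by apply: msizeB_bound; rewrite // (leq_trans (msize_shiftB tau f)) // leq_pred.
Qed.

End Degrees.

(** * Integrality of [L], its effect on degrees, and its vanishing coefficients *)

Lemma mul_div_cancel (F : fieldType) (c d u : F) : d != 0 -> d * c * (u / d) = c * u.
Proof. by move=> nz; field. Qed.

Lemma weyl_sum_arith1 (a b c k : nat) :
  (0 < a -> 0 < b -> c < b + k -> (a + c).-1 <= ((b + a).-1 + k).-1)%N.
Proof. by lia. Qed.

Lemma weyl_sum_arith2 (a b k : nat) :
  (0 < a -> 0 < b -> (b + a).-1 <= (b + k).-1 -> a <= k)%N.
Proof. by lia. Qed.

Lemma mulr_diff_expand (A : comPzRingType) (d a b a' b' f : A) :
  d * ((a * f - b) - (a' * f - b')) = ((d * a) * f - d * b) - ((d * a') * f - d * b').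
Proof. by ring. Qed.

Lemma diff_product_expand (A : comPzRingType) (c u u' f s : A) :
  ((c * (u * 1)) * f - c * (u * s)) - ((c * (u' * 1)) * f - c * (u' * s)) =
  c * ((u - u') * (f - s)).
Proof. by ring. Qed.

Section Operators.

Context {R : realType} {n : nat} (G : datum n) (ax : lattice_axioms G).
Local Notation C := R[i].
Local Notation V := 'rV[C]_n.
Local Notation P := {mpoly C[n]}.
Local Notation K := {fraction {mpoly C[n]}}.
Local Notation lin := (@linpoly R n).
Local Notation pvec := (weyl_vector G).
Local Notation den := (@denom R n G).
Implicit Types (p q f g : P) (u v x rho : V) (eta mu nu lambda tau : 'rV[int]_n).
Implicit Types (omega alpha beta : 'cV[int]_n) (w s : 'M[int]_n).

Lemma in_orbit_pm_act omega omega' w : w \in W G ->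
  in_orbit_pm G omega (w *m omega') = in_orbit_pm G omega omega'.
Proof.
have sub w' o : w' \in W G -> in_orbit_pm G omega (w' *m o) -> in_orbit_pm G omega o.
  move=> w'W /hasP [w1 w1W H]; apply/hasP; exists (w1 *m w'); first exact: (WM ax).
  by rewrite -mulmxA.
move=> wW; apply/idP/idP; first exact: sub.
move=> H; apply: (sub (invmx w)); first exact: (WV ax).
by rewrite mulKmx ?(W_unit ax).
Qed.

Lemma k_act rho omega w : w \in W G -> k_ G rho (w *m omega) = k_ G rho omega.
Proof. by move=> wW; rewrite /k_; under eq_pick do rewrite in_orbit_pm_act //. Qed.

Lemma k_sigma rho i : in_V0 G rho -> k_ G rho (sigma G i) = linval (sigma G i) rho.
Proof.
move=> V0; rewrite /k_; case: pickP => [j ji|/(_ i)]; first exact: V0.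
move/hasPn => /(_ _ (W1 ax)); rewrite mul1mx eqxx //.
Qed.

Lemma V0_line rho (t : C) : in_V0 G rho -> in_V0 G (rho + t *: toV pvec).
Proof.
move=> V0 i j ij; rewrite !linvalD !linvalZ !linval_toV !weyl_vector_sigma //.
by rewrite (V0 _ _ ij).
Qed.

Lemma V0_weyl_vector : @in_V0 R n G (toV pvec).
Proof. by move=> i j _; rewrite !linval_toV !weyl_vector_sigma. Qed.

Lemma k_line rho (t : C) omega : in_V0 G rho -> omega \in Phi G ->
  k_ G (rho + t *: toV pvec) omega = k_ G rho omega + t.
Proof.
move=> V0 /(PhiP) [w wW [i ->]]; rewrite !k_act // !k_sigma //; last exact: V0_line.
by rewrite linvalD linvalZ linval_toV weyl_vector_sigma // mulr1.
Qed.

Definition numer rho eta : P :=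
  \prod_(omega <- Phi G | 0 < pairing eta omega) (lin omega - (k_ G rho omega)%:MP).

Lemma f_E rho eta : f_ G rho eta = to_frac (numer rho eta) / to_frac (den eta).
Proof. by rewrite /f_ /numer /denom !rmorph_prod. Qed.

Lemma numer_act rho w eta v : w \in W G ->
  evalV (numer rho (act_dual w eta)) (v *m act_V w) = evalV (numer rho eta) v.
Proof.
move=> wW; rewrite !evalV_prod (reindex_W _ _ (perm_Phi ax wW)).
apply: eq_big => omega; first by rewrite (act_dualM_pairing ax).
by move=> _; rewrite !evalVB !evalVC !evalV_linpoly linval_act mulKmx ?(W_unit ax) // k_act.
Qed.

Lemma shift_act f w eta v : W_invariant G f -> w \in W G ->
  evalV (shift_poly (act_dual w eta) f) (v *m act_V w) = evalV (shift_poly eta f) v.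
Proof. by move=> inv wW; rewrite [LHS]evalV_shift [RHS]evalV_shift toV_act -mulmxBl inv. Qed.

Local Notation cof := (@cofactor_den R n G).
Local Notation DD := (@root_poly R n G).

Definition weyl_sum (u : 'rV[int]_n -> P) : P := \sum_(eta <- Lambda1 G) cof eta * u eta.

Lemma weyl_sum_frac (u : 'rV[int]_n -> P) :
  to_frac DD * \sum_(eta <- Lambda1 G) to_frac (u eta) / to_frac (den eta) =
  to_frac (weyl_sum u).
Proof.
rewrite mulr_sumr rmorph_sum; apply: eq_bigr => eta _.
have nz : to_frac (den eta) != 0 by rewrite to_frac_eq0 (denom_neq0 ax).
by rewrite (root_polyE G eta) !rmorphM; apply: mul_div_cancel.
Qed.

Lemma Lop_polyP rho f g :
  Lop G rho (to_frac f) = to_frac g <->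
  DD * g = weyl_sum (fun eta => numer rho eta * shift_poly eta f).
Proof.
have e : to_frac DD * Lop G rho (to_frac f) =
    to_frac (weyl_sum (fun eta => numer rho eta * shift_poly eta f)).
  rewrite -weyl_sum_frac; congr (_ * _); apply: eq_bigr => eta _.
  by rewrite f_E Ttr_poly rmorphM mulrAC.
have nz : to_frac DD != 0 by rewrite to_frac_eq0 (root_poly_neq0 ax).
split=> [Lfg|Dg].
  by apply: to_frac_inj; rewrite -e Lfg rmorphM.
by apply: (mulfI nz); rewrite e -Dg rmorphM.
Qed.

Lemma root_poly_cancel_act p w v : w \in W G ->
  (forall v, evalV (DD * p) (v *m act_V w) = evalV (DD * p) v) ->
  evalV p (v *m act_V w) = evalV p v.
Proof.
move=> wW inv; rewrite -[v *m act_V w]addr0 -evalV_affine; congr evalV.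
apply: (mulfI (root_poly_neq0 (R := R) ax)); apply: evalV_inj => {}v.
rewrite -inv !evalVM (root_poly_act ax) //; congr (_ * _).
by rewrite evalV_affine addr0.
Qed.

Lemma weyl_sum_invariant (u : 'rV[int]_n -> P) :
  (forall w eta v, w \in W G -> evalV (u (act_dual w eta)) (v *m act_V w) = evalV (u eta) v) ->
  exists2 g, W_invariant G g & DD * g = weyl_sum u.
Proof.
move=> uinv.
have inv w v : w \in W G -> evalV (weyl_sum u) (v *m act_V w) = evalV (weyl_sum u) v.
  move=> wW; rewrite /weyl_sum !evalV_sum -(perm_big _ (perm_Lambda1 ax wW)) big_map.
  by apply: eq_bigr => eta _; rewrite !evalVM (cofactor_den_act ax) // uinv.
have [|||g Hg] := @weyl_sum_dvd R n G ax (Lambda1 G) xpredT u.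
- by [].
- by move=> s beta sW _ _ _; apply: (perm_Lambda1 ax).
- by move=> s beta sW _ _ _ eta v; apply: uinv.
exists g => [w v wW|]; last by rewrite /root_poly -Hg.
apply: root_poly_cancel_act => // {}v.
by rewrite /root_poly -Hg; apply: inv.
Qed.

Lemma numer_shift_act rho f w eta v : W_invariant G f -> w \in W G ->
  evalV (numer rho (act_dual w eta) * shift_poly (act_dual w eta) f) (v *m act_V w) =
  evalV (numer rho eta * shift_poly eta f) v.
Proof.
move=> inv wW; rewrite [LHS]evalVM [RHS]evalVM.
by congr (_ * _); [apply: numer_act | apply: shift_act].
Qed.

(** The poles of the coefficients cancel in the sum over [Lambda_1]: after clearing denominators it
    is a Weyl sum, divisible by [root_poly]. *)
Lemma Lop_poly rho f : W_invariant G f ->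
  exists2 g, W_invariant G g & Lop G rho (to_frac f) = to_frac g.
Proof.
move=> inv; have [|g ginv Hg] := @weyl_sum_invariant (fun eta => numer rho eta * shift_poly eta f).
  by move=> w eta v; apply: numer_shift_act.
by exists g => //; apply/Lop_polyP.
Qed.

Lemma weyl_sum_msize (u : 'rV[int]_n -> P) g k :
  (forall eta, eta \in Lambda1 G -> msize (u eta) < msize (den eta) + k)%N ->
  DD * g = weyl_sum u -> (msize g <= k)%N.
Proof.
move=> small Hg; have [->|nzg] := eqVneq g 0; first by rewrite msize0.
have nzD := root_poly_neq0 (R := R) ax.
have posD : (0 < msize DD)%N by rewrite lt0n msize_poly_eq0.
have : (msize (DD * g) <= (msize DD + k).-1)%N.
  rewrite Hg; apply: msize_sum_bound => eta etaL _.
  have nzd := denom_neq0 (R := R) ax eta.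
  have nzc : cof eta != 0 by exact: prod_roots_neq0.
  have [->|nzu] := eqVneq (u eta) 0; first by rewrite mulr0 msize0.
  have := small eta etaL; rewrite msizeM // (root_polyE G eta) msizeM //.
  have : (0 < msize (den eta))%N by rewrite lt0n msize_poly_eq0.
  have : (0 < msize (cof eta))%N by rewrite lt0n msize_poly_eq0.
  exact: weyl_sum_arith1.
have : (0 < msize g)%N by rewrite lt0n msize_poly_eq0.
by rewrite msizeM // => g0; apply: weyl_sum_arith2.
Qed.

Lemma denom_roots : {in Delta G, forall omega, omega != 0}.
Proof. by move=> alpha; apply: root_neq0. Qed.

Lemma msize_denom eta : msize (den eta) =
  (count (fun alpha => 0 < pairing eta alpha) (Delta G)).+1.
Proof. by rewrite /denom msize_prod_linpoly //; apply: denom_roots. Qed.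

Lemma msize_numer rho eta : eta \in Lambda1 G ->
  (msize (numer rho eta) <= (msize (den eta)).+1)%N.
Proof.
move=> etaL; rewrite msize_denom -(count_positive ax etaL).
exact: msize_prod_affine.
Qed.

Lemma msize_numerB rho rho' eta : eta \in Lambda1 G ->
  (msize (numer rho eta - numer rho' eta) <= msize (den eta))%N.
Proof.
move=> etaL; rewrite msize_denom -(count_positive ax etaL).
exact: msize_prod_affineB.
Qed.

Lemma msize_denom_gt0 eta : (0 < msize (den eta))%N.
Proof. by rewrite msize_denom. Qed.

Lemma Lop_msize rho f g : Lop G rho (to_frac f) = to_frac g -> (msize g <= (msize f).+1)%N.
Proof.
move/Lop_polyP; apply: weyl_sum_msize => eta etaL.
have := msizeM_bound (msize_numer rho etaL) (msize_shift eta f).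
by have := msize_denom_gt0 eta; lia.
Qed.

(* [g1 * f - g] is the image of [f] under [\sum_eta f_eta (1 - T_eta)]. *)
Lemma Lop_diff_msize rho f g g1 :
  Lop G rho (to_frac f) = to_frac g -> Lop G rho (to_frac 1) = to_frac g1 ->
  (msize (g1 * f - g) <= msize f)%N.
Proof.
move=> /Lop_polyP Hg /Lop_polyP Hg1.
apply: (@weyl_sum_msize (fun eta => numer rho eta * (f - shift_poly eta f))) => [eta etaL|].
  have := msizeM_bound (msize_numer rho etaL) (msize_shiftB eta f).
  have [->|nzf] := eqVneq f 0; first by rewrite rmorph0 subrr mulr0 msize0; have := msize_denom_gt0 eta; lia.
  have : (0 < msize f)%N by rewrite lt0n msize_poly_eq0.
  by have := msize_denom_gt0 eta; lia.
rewrite mulrBr mulrA Hg1 Hg /weyl_sum mulr_suml -sumrB; apply: eq_bigr => eta _.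
by rewrite rmorph1 mulr1 -mulrA -mulrBr -mulrBr.
Qed.

(** Changing [rho] alters the numerators only below their top degree, and [1 - T_eta] loses a
    further degree; this is why the action on leading terms does not depend on [rho]. *)
Lemma Lop_diff_indep rho rho' f g g1 g' g1' :
  Lop G rho (to_frac f) = to_frac g -> Lop G rho (to_frac 1) = to_frac g1 ->
  Lop G rho' (to_frac f) = to_frac g' -> Lop G rho' (to_frac 1) = to_frac g1' ->
  (msize ((g1 * f - g) - (g1' * f - g')) <= (msize f).-1)%N.
Proof.
move=> /Lop_polyP Hg /Lop_polyP Hg1 /Lop_polyP Hg' /Lop_polyP Hg1'.
apply: (@weyl_sum_msize (fun eta => (numer rho eta - numer rho' eta) * (f - shift_poly eta f)))
  => [eta etaL|].
  have := msizeM_bound (msize_numerB rho rho' etaL) (msize_shiftB eta f).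
  by have := msize_denom_gt0 eta; lia.
rewrite mulr_diff_expand Hg1 Hg Hg1' Hg' /weyl_sum [X in X - _ - _]mulr_suml.
rewrite [X in _ - (X - _)]mulr_suml -!sumrB; apply: eq_bigr => eta _.
by rewrite rmorph1; apply: diff_product_expand.
Qed.

Lemma Lop1_indep rho rho' g g' :
  Lop G rho (to_frac 1) = to_frac g -> Lop G rho' (to_frac 1) = to_frac g' ->
  (msize (g - g') <= 1)%N.
Proof.
move=> /Lop_polyP Hg /Lop_polyP Hg'.
apply: (@weyl_sum_msize (fun eta => numer rho eta - numer rho' eta)) => [eta etaL|].
  by have := msize_numerB rho rho' etaL; rewrite addn1 ltnS.
rewrite mulrBr Hg Hg' /weyl_sum -sumrB; apply: eq_bigr => eta _.
by rewrite rmorph1 !mulr1 mulrBr.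
Qed.

Lemma Lop_eval rho f g v : Lop G rho (to_frac f) = to_frac g ->
  evalV DD v * evalV g v = \sum_(eta <- Lambda1 G)
    evalV (cof eta) v * (evalV (numer rho eta) v * evalV f (v - toV eta)).
Proof.
move=> /Lop_polyP /(congr1 (fun p => evalV p v)); rewrite evalVM => ->.
rewrite /weyl_sum evalV_sum; apply: eq_bigr => eta _.
by rewrite [LHS]evalVM [X in _ * X]evalVM evalV_shift.
Qed.

(** As [sigma_i(eta)] is at most 1, leaving [Lambda_+] requires [sigma_i(nu) = 0] and
    [sigma_i(eta) = 1] for some [i]; then the factor of the numerator belonging to [sigma_i]
    vanishes at [rho + nu]. *)
Lemma numer_eq0 rho eta nu : in_V0 G rho -> eta \in Lambda1 G -> Lambda_plus G nu ->
  ~ Lambda_plus G (nu - eta) -> evalV (numer rho eta) (rho + toV nu) = 0.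
Proof.
move=> V0 etaL /(Lambda_plusP ax) nuL nL.
have [/forallP H|] := boolP [forall i, 0 <= pairing (nu - eta) (sigma G i)].
  by case: nL; apply/(Lambda_plusP ax).
rewrite negb_forall => /existsP H; case: H => i; rewrite pairingBl subr_ge0 -ltNge => lt.
have nu0 := nuL i; have eta0 := le_lt_trans nu0 lt.
have eta1 : pairing eta (sigma G i) = 1.
  by apply: (Lambda1_gt0 ax etaL) => //; right; apply: (sigma_Phi ax).
have nuz : pairing nu (sigma G i) = 0 by move: lt nu0; rewrite eta1; lia.
rewrite /numer evalV_prod (big_rem (sigma G i)) ?(sigma_Phi ax) //= eta0.
by rewrite evalVB evalVC evalV_linpoly linvalD linval_toV nuz addr0 k_sigma // subrr mul0r.
Qed.

End Operators.

(** * Vanishing and interpolation on [rho + Lambda_+] *)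

Section Vanishing.

Context {R : realType} {n : nat} (G : datum n) (ax : lattice_axioms G).
Local Notation C := R[i].
Local Notation V := 'rV[C]_n.
Local Notation P := {mpoly C[n]}.
Local Notation lin := (@linpoly R n).
Local Notation pvec := (weyl_vector G).
Local Notation den := (@denom R n G).
Local Notation cof := (@cofactor_den R n G).
Local Notation DD := (@root_poly R n G).
Implicit Types (p q f g : P) (u v x rho : V) (eta mu nu lambda tau : 'rV[int]_n).
Implicit Types (omega alpha beta : 'cV[int]_n) (w s : 'M[int]_n).

Lemma Lambda_plus_dec nu : decidable (Lambda_plus G nu).
Proof.
apply: (@decP _ [forall i, 0 <= pairing nu (sigma G i)]).
apply: (iffP forallP); first by move=> H; apply/(Lambda_plusP ax).
by move/(Lambda_plusP ax).
Qed.

(** The interpolation theory uses dominance only through this property. It is immediate at regular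
    dominant points, which is enough to start from (C9), and its proof at singular points relies on
    that regular theory. *)
Definition propagates_vanishing rho := forall f g nu,
  W_invariant G f -> Lop G rho (to_frac f) = to_frac g -> Lambda_plus G nu ->
  (forall mu, Lambda_plus G mu -> pairing mu (ell G) = pairing nu (ell G) - 1 ->
     evalV f (rho + toV mu) = 0) ->
  evalV g (rho + toV nu) = 0.

(** At [rho + nu] the summands with [nu - eta] outside [Lambda_+] have zero numerator, and the
    others involve values of [f] one level lower. *)
Lemma propagates_vanishing_regular rho : in_V0 G rho ->
  (forall nu, Lambda_plus G nu -> evalV DD (rho + toV nu) != 0) ->
  propagates_vanishing rho.
Proof.
move=> V0 nz f g nu finv Lfg nuL fmu.
apply: (mulfI (nz nu nuL)); rewrite (Lop_eval ax _ Lfg) mulr0 big_seq big1 // => eta etaL.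
have [dL|ndL] := Lambda_plus_dec (nu - eta); last first.
  by rewrite (numer_eq0 ax) // mul0r mulr0.
rewrite -addrA -toVB fmu ?mulr0 //.
by rewrite pairingBl (ell_Lambda1 ax etaL).
Qed.

(** For a positive root [beta], a zero would mean [beta(rho) = - beta(nu)], an integer that is at
    most 0: dominance excludes negative values and regularity excludes 0. *)
Lemma regular_dominant_root rho nu alpha : regular G rho -> dominant G rho ->
  Lambda_plus G nu -> alpha \in Delta G -> linval alpha (rho + toV nu) != 0.
Proof.
move=> reg dom nuL aD.
have H beta : beta \in Delta_plus G -> linval beta (rho + toV nu) != 0.
  move=> bp; rewrite linvalD linval_toV addr_eq0 -rmorphN; apply/eqP => e.
  have [_ bpos] := Delta_plusP _ _ bp.
  have ge0 := Lambda_plus_ge0 ax nuL bpos.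
  have [z0|nz] := eqVneq (pairing nu beta) 0.
    by apply: (reg beta bp); rewrite e z0 oppr0.
  by apply: (dom beta bp (- pairing nu beta)); rewrite // oppr_lt0 lt_neqAle eq_sym nz.
case: (root_sign ax aD) => [/H //|/H].
by rewrite linvalNl oppr_eq0.
Qed.

Lemma regular_dominant_root_poly rho nu : regular G rho -> dominant G rho ->
  Lambda_plus G nu -> evalV DD (rho + toV nu) != 0.
Proof.
move=> reg dom nuL; rewrite evalV_prod prodf_seq_neq0; apply/allP => alpha aD; apply/implyP => _.
by rewrite evalV_linpoly regular_dominant_root.
Qed.

Lemma propagates_vanishing_regular_dominant rho : in_V0 G rho ->
  regular G rho -> dominant G rho -> propagates_vanishing rho.
Proof.
move=> V0 reg dom; apply: propagates_vanishing_regular => // nu.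
exact: regular_dominant_root_poly.
Qed.

Lemma weyl_vector_regular k : regular G (k.+1%:R *: toV pvec : V).
Proof.
move=> alpha ap; rewrite linvalZ linval_toV; apply/eqP.
by rewrite mulf_neq0 // ?pnatr_eq0 // intr_eq0 gt_eqF // (weyl_vector_root ax).
Qed.

Lemma weyl_vector_dominant k : dominant G (k.+1%:R *: toV pvec : V).
Proof.
move=> alpha ap m m0; rewrite linvalZ linval_toV => /eqP.
rewrite (_ : k.+1%:R = (k.+1%:Z)%:~R) // -rmorphM eqr_int => /eqP e.
by move: m0; rewrite -e ltNge mulr_ge0 // ltW // (weyl_vector_root ax).
Qed.

Lemma V0_weyl_vectorZ (t : C) : in_V0 G (t *: toV pvec).
Proof.
by move=> i j ij; rewrite !linvalZ (V0_weyl_vector ax ij).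
Qed.

Lemma msize2_affine g : (msize g <= 2)%N ->
  exists (a : 'cV[C]_n) c, forall v, evalV g v = (v *m a) 0 0 + c.
Proof.
move=> le2; pose Q (g : P) := exists (a : 'cV[C]_n) c, forall v, evalV g v = (v *m a) 0 0 + c.
have Q0 c : Q c%:MP.
  by exists 0, c => v; rewrite evalVC mulmx0 mxE add0r.
have QD g1 g2 : Q g1 -> Q g2 -> Q (g1 + g2).
  move=> [a1 [c1 H1]] [a2 [c2 H2]]; exists (a1 + a2), (c1 + c2) => v.
  by rewrite evalVD H1 H2 mulmxDr [X in _ = X + _]mxE addrACA.
have QZ c g1 : Q g1 -> Q (c *: g1).
  move=> [a1 [c1 H1]]; exists (c *: a1), (c * c1) => v.
  by rewrite evalVZ H1 mulrDr -scalemxAr [X in _ = X + _]mxE.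
have QX i : Q 'X_i.
  exists (delta_mx i 0), 0 => v; rewrite -colE mxE addr0.
  Transparent evalV.
  by rewrite /evalV mevalXU.
  Opaque evalV.
rewrite -/(Q g) (mpolyE g) big_seq; elim/big_ind: _ => //.
  by rewrite -mpolyC0.
move=> m mg; apply: (QZ); have := leq_trans (msize_mdeg_lt mg) le2.
rewrite ltnS leq_eqVlt ltnS leqn0 => /orP [/mdeg1P [i /eqP ->]|]; first exact: QX.
by rewrite mdeg_eq0 => /eqP ->; rewrite mpolyX0 -mpolyC1.
Qed.

Lemma Lambda_plus_level_lt0 nu : Lambda_plus G nu -> pairing nu (ell G) = -1 -> False.
Proof.
move=> nuL e; have := Lambda_plus_ge0 ax nuL (ell_nonneg ax).
by rewrite e.
Qed.

Lemma W_invariant1 : W_invariant G (1 : P).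
Proof. by move=> w v _; rewrite !evalV1. Qed.

(** No node has level -1, so the constant 1 vanishes vacuously on that level. *)
Lemma Lop1_at_rho rho g : propagates_vanishing rho -> Lop G rho (to_frac 1) = to_frac g ->
  evalV g rho = 0.
Proof.
move=> prop Lg; have := prop 1 g 0 W_invariant1 Lg (Lambda_plus0 ax).
rewrite toV0 addr0; apply => mu muL; rewrite pairing0l sub0r => e.
by case: (Lambda_plus_level_lt0 muL e).
Qed.

Lemma k_zero omega : omega \in Phi G -> k_ G (0 : V) omega = 0.
Proof.
case/PhiP => w wW [i ->]; rewrite (k_act ax) // (k_sigma ax).
  by rewrite /linval mul0mx mxE.
by move=> a b _; rewrite /linval !mul0mx !mxE.
Qed.

(** Only the translation by [eta] itself survives: for another [eta'], the difference [eta - eta']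
    would be a nonzero element of [Lambda_+] of level 0. *)
Lemma Lop1_Sigma1 k g eta : eta \in Sigma1_dual G ->
  let x := k.+1%:R *: toV pvec + toV eta in
  Lop G (k.+1%:R *: toV pvec) (to_frac 1) = to_frac g ->
  evalV (den eta) x * evalV g x = evalV (numer G (k.+1%:R *: toV pvec) eta) x.
Proof.
move=> etaS x Lg; have etaL := Sigma1_Lambda1 ax etaS.
have V0 := V0_weyl_vectorZ k.+1%:R.
have etaLp : Lambda_plus G eta.
  case/Sigma1_dualP: etaS => i _ ->; apply/(Lambda_plusP ax) => j.
  by rewrite (sigma_dualP ax); case: (_ == _).
have nz : evalV DD x != 0.
  apply: regular_dominant_root_poly => //; first exact: weyl_vector_regular.
  exact: weyl_vector_dominant.
have nzc : evalV (cof eta) x != 0.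
  by apply: contra nz => /eqP c0; rewrite (root_polyE G eta) evalVM c0 mulr0.
apply: (mulfI nzc); rewrite mulrA [_ * evalV (den eta) x]mulrC -evalVM -root_polyE.
rewrite (Lop_eval ax _ Lg) (big_rem eta) //= evalV1 mulr1 big_seq big1 ?addr0 // => eta' eta'L.
have [eta'L1 neq] : eta' \in Lambda1 G /\ eta' != eta.
  by move: eta'L; rewrite (mem_rem_uniq eta (fset_uniq _)) => /andP [].
rewrite (numer_eq0 ax) ?mul0r ?mulr0 // => dL.
move: neq; rewrite eq_sym -subr_eq0 => /eqP; apply; apply: (Lambda_plus_ell0 ax) => //.
by rewrite pairingBl (ell_Lambda1 ax etaL) (ell_Lambda1 ax eta'L1) subrr.
Qed.

Hypothesis C8 : axiom_C8 R G.

(** Here [k_omega = t] and [omega(eta) = 1]. The constant term 1 of each factor is what normalizes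
    the slope of [L(1)]. *)
Lemma numer_weyl_vector (t : C) eta : eta \in Lambda1 G ->
  evalV (numer G (t *: toV pvec) eta) (t *: toV pvec + toV eta) =
  (\prod_(omega <- Phi G | 0 < pairing eta omega)
     (1 + ((pairing pvec omega)%:~R - 1) *: 'X)).[t].
Proof.
move=> etaL; rewrite evalV_prod horner_prod big_seq_cond [RHS]big_seq_cond.
apply: eq_bigr => omega /andP [oP pos].
have V00 : in_V0 G (0 : V) by move=> a b _; rewrite /linval !mul0mx !mxE.
rewrite evalVB evalVC evalV_linpoly linvalD linvalZ !linval_toV.
have := k_line ax t V00 oP; rewrite !add0r k_zero // add0r => ->.
rewrite (Lambda1_gt0 ax etaL (or_intror oP) pos).
by rewrite hornerD hornerZ hornerX hornerC mulr1z; move: (_%:~R) => c; ring.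
Qed.

Lemma den_weyl_vector (t : C) eta : eta \in Lambda1 G ->
  evalV (den eta) (t *: toV pvec + toV eta) =
  (\prod_(alpha <- Delta G | 0 < pairing eta alpha)
     (1 + (pairing pvec alpha)%:~R *: 'X)).[t].
Proof.
move=> etaL; rewrite evalV_prod horner_prod big_seq_cond [RHS]big_seq_cond.
apply: eq_bigr => alpha /andP [aD pos].
rewrite evalV_linpoly linvalD linvalZ !linval_toV.
rewrite (Lambda1_gt0 ax etaL (or_introl aD) pos).
by rewrite hornerD hornerZ hornerX hornerC addrC [_ * t]mulrC.
Qed.

(* The linear part does not depend on [rho]; for [rho] a positive multiple of [pvec] only one
   summand survives at [rho + eta], and letting the multiple tend to [0] gives [ell(eta)]. *)
Lemma Lop1_affine rho : exists c,
  Lop G rho (to_frac 1) = to_frac (lin (ell G) + c%:MP).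
Proof.
have ex1 rho' : exists2 g, W_invariant G g & Lop G rho' (to_frac 1) = to_frac g.
  exact: (Lop_poly ax rho' W_invariant1).
have [g0 g0inv Lg0] := ex1 0.
have size_g0 : (msize g0 <= 2)%N by have := Lop_msize ax Lg0; rewrite msize1.
have [a [c Hg0]] := msize2_affine size_g0.
have shift_g0 rho' g : Lop G rho' (to_frac 1) = to_frac g ->
    exists c', forall v, evalV g v = (v *m a) 0 0 + c'.
  move=> Lg; have /msize1_polyC e := Lop1_indep ax Lg Lg0.
  exists (c + (g - g0)@_0%MM) => v.
  by rewrite addrA -Hg0 -[g](subrK g0) evalVD {1}e evalVC addrC subrK.
have a_inv w : w \in W G -> map_mx intr w *m a = a.
  move=> wW; have wiW := WV ax wW.
  apply/matrixP => i j; rewrite ord1.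
  have := g0inv (invmx w) (delta_mx 0 i) wiW; rewrite !Hg0 => /addIr.
  by rewrite /act_V invmxK -mulmxA -!rowE !mxE.
have m1 eta : eta \in Sigma1_dual G -> (toV eta *m a) 0 0 = 1.
  move=> etaS; have etaL := Sigma1_Lambda1 ax etaS.
  set m := (_ *m _) 0 0.
  pose q1 := \prod_(omega <- Phi G | 0 < pairing eta omega)
     (1 + ((pairing pvec omega)%:~R - 1) *: 'X) : {poly C}.
  pose q2 := \prod_(alpha <- Delta G | 0 < pairing eta alpha)
     (1 + (pairing pvec alpha)%:~R *: 'X) : {poly C}.
  (* Both products equal 1 at 0, so the identity gives [m = 1]. *)
  suff e : m *: q2 - q1 = 0.
    have := congr1 (fun q : {poly C} => q.[0]) e.
    rewrite hornerD hornerN hornerZ horner0 !horner_prod.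
    rewrite !big1 => [|alpha _|omega _]; last 2 first.
    - by rewrite hornerD hornerZ hornerX hornerC mulr0 addr0.
    - by rewrite hornerD hornerZ hornerX hornerC mulr0 addr0.
    by rewrite mulr1 => /eqP; rewrite subr_eq0 => /eqP.
  apply: (@poly_eq0_infinite _ (fun k => k.+1%:R)).
    by move=> k k' /eqP; rewrite eqr_nat => /eqP [].
  move=> k; rewrite hornerD hornerN hornerZ -den_weyl_vector // -numer_weyl_vector //.
  have [g ginv Lg] := ex1 (k.+1%:R *: toV pvec).
  rewrite -(Lop1_Sigma1 etaS Lg).
  have prop : propagates_vanishing (k.+1%:R *: toV pvec : V).
    apply: propagates_vanishing_regular_dominant; first exact: V0_weyl_vectorZ.
      exact: weyl_vector_regular.
    exact: weyl_vector_dominant.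
  have [c' Hg] := shift_g0 _ _ Lg.
  have := Lop1_at_rho prop Lg; rewrite !Hg.
  rewrite mulmxDl; set A1 := _ *m a; set A2 := _ *m a.
  rewrite (_ : (A1 + A2) 0 0 = A1 0 0 + A2 0 0) => [e0|]; last by rewrite mxE.
  by rewrite addrAC e0 add0r mulrC subrr.
(* Both are invariant and take the value 1 on [Sigma_1^vee], so (C8) identifies them. *)
have aE : a = map_mx intr (ell G).
  apply: C8 => // [w wW|eta etaS].
    by rewrite -map_mxM (ax_C4 ax).
  apply/matrixP => i j; rewrite !ord1 m1 // -/(linval _ _) linval_toV.
  by rewrite (ell_Lambda1 ax (Sigma1_Lambda1 ax etaS)).
have [g _ Lg] := ex1 rho; have [c' Hg] := shift_g0 _ _ Lg.
exists c'; rewrite Lg; congr to_frac; apply: evalV_inj => v.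
by rewrite Hg aE evalVD evalVC evalV_linpoly.
Qed.

Definition level_poly rho : P := lin (ell G) - (linval (ell G) rho)%:MP.

Lemma Lop1_level rho : propagates_vanishing rho ->
  Lop G rho (to_frac 1) = to_frac (level_poly rho).
Proof.
move=> prop; have [c Lc] := Lop1_affine rho; rewrite Lc /level_poly; congr (to_frac (_ + _)).
have := Lop1_at_rho prop Lc; rewrite evalVD evalVC evalV_linpoly => /eqP.
by rewrite addrC addr_eq0 => /eqP ->; rewrite mpolyCN.
Qed.

Lemma evalV_level_poly rho nu :
  evalV (level_poly rho) (rho + toV nu) = (pairing nu (ell G))%:~R.
Proof. by rewrite evalVB evalVC evalV_linpoly linvalD linval_toV addrAC subrr add0r. Qed.

End Vanishing.

(** * Unisolvent interpolation and leading terms *)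

Lemma mulrB_subB (A : comPzRingType) (l f f' h h' : A) :
  (l * f - h) - (l * f' - h') = l * (f - f') - (h - h').
Proof. by ring. Qed.

Lemma Posz_eqS (a m : nat) : a%:Z = m%:Z + 1 <-> a = m.+1.
Proof. by split; lia. Qed.

Lemma subBB (A : comPzRingType) (a b c d : A) : a - c - (b - d) = (a - b) - (c - d).
Proof. by ring. Qed.

Lemma add_sub_double (A : comPzRingType) (a p : A) : a + a = p + a - (p - a).
Proof. by ring. Qed.

Section Interpolation.

Context {R : realType} {n : nat} (G : datum n) (ax : lattice_axioms G).
Hypothesis C8 : axiom_C8 R G.
Local Notation C := R[i].
Local Notation V := 'rV[C]_n.
Local Notation P := {mpoly C[n]}.
Local Notation K := {fraction {mpoly C[n]}}.
Local Notation lin := (@linpoly R n).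
Local Notation level := (fun nu => pairing nu (ell G)).
Implicit Types (p q f g h : P) (u v x rho : V) (eta mu nu lambda tau : 'rV[int]_n).
Implicit Types (omega alpha beta : 'cV[int]_n) (w s : 'M[int]_n).

Lemma W_invariantD f g : W_invariant G f -> W_invariant G g -> W_invariant G (f + g).
Proof. by move=> Hf Hg w v wW; rewrite !evalVD Hf ?Hg. Qed.

Lemma W_invariantB f g : W_invariant G f -> W_invariant G g -> W_invariant G (f - g).
Proof. by move=> Hf Hg w v wW; rewrite !evalVB Hf ?Hg. Qed.

Lemma W_invariantZ (c : C) f : W_invariant G f -> W_invariant G (c *: f).
Proof. by move=> Hf w v wW; rewrite !evalVZ Hf. Qed.

Lemma W_invariantM f g : W_invariant G f -> W_invariant G g -> W_invariant G (f * g).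
Proof. by move=> Hf Hg w v wW; rewrite !evalVM Hf ?Hg. Qed.

Lemma W_invariant0 : W_invariant G (0 : P).
Proof. by move=> w v _; rewrite !evalV0. Qed.

Lemma W_invariant_sum (I : Type) (r : seq I) (Q : pred I) (F : I -> P) :
  (forall i, Q i -> W_invariant G (F i)) -> W_invariant G (\sum_(i <- r | Q i) F i).
Proof.
move=> HF; elim/big_ind: _ => //; [exact: W_invariant0|exact: W_invariantD].
Qed.

Lemma level_poly_invariant rho : W_invariant G (level_poly G rho).
Proof.
move=> w v wW; rewrite !evalVB !evalVC !evalV_linpoly linval_act.
by rewrite (ax_C4 ax) // (WV ax).
Qed.

Lemma LopD rho (f g : K) : Lop G rho (f + g) = Lop G rho f + Lop G rho g.
Proof. by rewrite /Lop -big_split; apply: eq_bigr => eta _; rewrite rmorphD mulrDr. Qed.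

Lemma LopN rho (f : K) : Lop G rho (- f) = - Lop G rho f.
Proof. by rewrite /Lop -sumrN; apply: eq_bigr => eta _; rewrite rmorphN mulrN. Qed.

Lemma LopC rho c (f : K) : Lop G rho (to_frac c%:MP * f) = to_frac c%:MP * Lop G rho f.
Proof.
rewrite /Lop mulr_sumr; apply: eq_bigr => eta _.
by rewrite rmorphM /= Ttr_const mulrCA.
Qed.

(* [h] is the image of [f] under [ell - ell(rho) - L]. *)
Definition euler_image rho f h := Lop G rho (to_frac f) = to_frac (level_poly G rho * f - h).

Lemma euler_imageB rho f h f' h' : euler_image rho f h -> euler_image rho f' h' ->
  euler_image rho (f - f') (h - h').
Proof.
move=> H H'; rewrite /euler_image rmorphB /= LopD LopN H H' -rmorphB; congr to_frac.
exact: mulrB_subB.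
Qed.

Lemma euler_image_ex rho f : propagates_vanishing G rho -> W_invariant G f ->
  exists h, [/\ W_invariant G h, euler_image rho f h & (msize h <= msize f)%N].
Proof.
move=> prop finv; have [g ginv Lg] := Lop_poly ax rho finv.
exists (level_poly G rho * f - g); split.
- by apply: W_invariantB => //; apply: W_invariantM => //; apply: level_poly_invariant.
- by rewrite /euler_image subKr.
exact: Lop_diff_msize Lg (Lop1_level ax C8 prop).
Qed.

Lemma euler_image_indep rho rho' f h h' :
  propagates_vanishing G rho -> propagates_vanishing G rho' ->
  euler_image rho f h -> euler_image rho' f h' -> (msize (h - h') <= (msize f).-1)%N.
Proof.
move=> prop prop' H H'.
have := Lop_diff_indep ax H (Lop1_level ax C8 prop) H' (Lop1_level ax C8 prop').
by rewrite !subKr.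
Qed.

Lemma euler_image_eval rho f h nu : propagates_vanishing G rho -> W_invariant G f ->
  euler_image rho f h -> Lambda_plus G nu ->
  (forall mu, Lambda_plus G mu -> level mu = level nu - 1 -> evalV f (rho + toV mu) = 0) ->
  evalV h (rho + toV nu) = (level nu)%:~R * evalV f (rho + toV nu).
Proof.
move=> prop finv H nuL /(prop _ _ _ finv H nuL) /eqP.
by rewrite evalVB evalVM evalV_level_poly subr_eq0 => /eqP.
Qed.

Definition vanishes_below rho (m : nat) f :=
  forall mu, Lambda_plus G mu -> level mu < m%:Z -> evalV f (rho + toV mu) = 0.

(** [msize f <= m] means degree below [m], matched with the nodes of level below [m]. *)
Definition unisolvent_uniq rho := forall m f,
  W_invariant G f -> (msize f <= m)%N -> vanishes_below rho m f -> f = 0.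

Definition unisolvent_ex rho := forall m (v : 'rV[int]_n -> C), exists f,
  [/\ W_invariant G f, (msize f <= m)%N &
      forall mu, Lambda_plus G mu -> level mu < m%:Z -> evalV f (rho + toV mu) = v mu].

Lemma evalV_Lambda_plus_eq0 rho f :
  (forall nu, Lambda_plus G nu -> evalV f (rho + toV nu) = 0) -> f = 0.
Proof.
move=> f0; pose M : 'M[C]_n := map_mx intr (invmx (Sigma G)).
have aff0 : affine_comp M rho f = 0.
  apply: mpoly_grid_eq0 => v.
  pose nu : 'rV[int]_n := (\row_i (v i)%:Z) *m invmx (Sigma G).
  have nuL : Lambda_plus G nu.
    apply/(Lambda_plusP ax) => i; rewrite /pairing /sigma -col_mulmx mulmxKV ?(ax_basis ax) //.
    by rewrite !mxE.
  have := f0 nu nuL; rewrite addrC /toV map_mxM -evalV_affine => <-.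
  Transparent evalV.
  by apply: meval_eq => i; rewrite !mxE.
  Opaque evalV.
apply: evalV_inj => u; rewrite evalV0.
have := evalV_affine M rho f ((u - rho) *m map_mx intr (Sigma G)).
rewrite aff0 evalV0 -mulmxA -map_mxM mulmxV ?(ax_basis ax) // map_mx1 mulmx1 subrK.
by [].
Qed.

(* If [ell - ell(rho) - L] acts on the leading terms of degree [m] as [m], then [f] is an
   eigenvector, so its zeros propagate to the levels above [m]. *)
Lemma unisolvent_uniq_of_euler rho : propagates_vanishing G rho ->
  (forall m f h, W_invariant G f -> euler_image rho f h -> (msize f <= m.+1)%N ->
     (msize (h - m%:R *: f) <= m)%N) ->
  unisolvent_uniq rho.
Proof.
move=> prop gr; elim=> [|m IH] f finv fm fvan.
  by apply/eqP; rewrite -msize_poly_eq0 -leqn0.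
have [h [hinv Hh _]] := euler_image_ex prop finv.
(* The difference has degree below [m] and vanishes on the levels below [m], so the induction
   hypothesis kills it. *)
have hE : h = m%:R *: f.
  apply/eqP; rewrite -subr_eq0; apply/eqP; apply: IH.
  - by apply: W_invariantB => //; apply: W_invariantZ.
  - exact: gr.
  move=> nu nuL num.
  have num1 : level nu < m.+1%:Z by lia.
  rewrite evalVB evalVZ (euler_image_eval prop finv Hh nuL) ?fvan ?mulr0 ?subrr //.
  by move=> mu muL e; apply: fvan => //; lia.
apply: (@evalV_Lambda_plus_eq0 rho) => nu nuL.
have [k Hk] : exists k : nat, level nu = k%:Z.
  exists `|level nu|%N; rewrite gez0_abs //.
  exact: (Lambda_plus_ge0 ax nuL (ell_nonneg ax)).
elim: k nu nuL Hk => [|k IHk] nu nuL Hk; first by apply: fvan; rewrite // Hk.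
have [lt|ge] := ltnP k.+1 m.+1; first by apply: fvan; rewrite // Hk.
have e : evalV h (rho + toV nu) = (level nu)%:~R * evalV f (rho + toV nu).
  apply: euler_image_eval => // mu muL e; apply: IHk => //.
  by rewrite e Hk; lia.
(* At level [k + 1 > m] the value of [h] is both [k + 1] times and [m] times that of [f]. *)
move: e; rewrite hE evalVZ Hk => /eqP; rewrite -subr_eq0 -mulrBl mulf_eq0 => /orP [|/eqP //].
rewrite -pmulrn subr_eq0 eqr_nat => /eqP mk; move: ge.
by rewrite mk ltnn.
Qed.

(** Coefficients below [m] suffice: [ell] is at least 1 on [Sigma^vee], so no coefficient of a node
    exceeds its level. *)
Definition level_seq (m : nat) : seq 'rV[int]_n :=
  undup [seq nu <- [seq \sum_i sigma_dual G i *+ (c i : nat) | c : {ffun 'I_n -> 'I_m}] |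
    level nu < m%:Z].

Lemma mem_level_seq m nu : reflect (Lambda_plus G nu /\ level nu < m%:Z) (nu \in level_seq m).
Proof.
rewrite /level_seq mem_undup mem_filter; apply: (iffP andP) => [[lt /mapP [c _ e]]|].
  by split=> //; exists (fun i => nat_of_ord (c i)).
move=> [nuL lt]; split=> //; have /(Lambda_plusP ax) pos := nuL.
have cm i : (`|pairing nu (sigma G i)| < m)%N.
  suff : pairing nu (sigma G i) <= level nu by have := pos i; lia.
  rewrite (pairing_sigma ax nu (ell G)) (bigD1 i) //=.
  have : 0 <= \sum_(j | j != i) pairing nu (sigma G j) * pairing (sigma_dual G j) (ell G).
    by apply: sumr_ge0 => j _; rewrite mulr_ge0 // ltW // (ax_C6 ax).
  have := ax_C6 ax i; have := pos i.
  set a := pairing _ _; set b := pairing _ _; set s := \sum_(_ | _) _ => a0 b0 s0.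
  by rewrite -[leLHS]addr0 lerD // ler_peMr.
apply/mapP; exists [ffun i => Ordinal (cm i)]; first by rewrite mem_enum.
rewrite {1}(sigma_dual_decomp ax nu); apply: eq_bigr => i _.
by rewrite ffunE /= -scaler_nat natz gez0_abs.
Qed.

(** A dimension count without dimensions: the Lagrange basis at [rho0] has one element per node, and
    uniqueness at [rho] makes the square matrix of its values at the nodes of [rho] invertible. *)
Lemma unisolvent_ex_transfer rho0 rho :
  unisolvent_ex rho0 -> unisolvent_uniq rho -> unisolvent_ex rho.
Proof.
move=> ex0 uni m v; pose S := level_seq m; pose N := size S.
have SP (i : 'I_N) : Lambda_plus G S`_i /\ level S`_i < m%:Z.
  by apply/mem_level_seq; apply: mem_nth.
have /fin_all_exists [e He] : forall i : 'I_N, exists f : P,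
    [/\ W_invariant G f, (msize f <= m)%N &
    forall j : 'I_N, evalV f (rho0 + toV S`_j) = (i == j)%:R].
  move=> i; have [f [finv fm fv]] := ex0 m (fun mu => (S`_i == mu)%:R).
  exists f; split=> // j; have [jL jm] := SP j.
  by rewrite fv // nth_uniq ?undup_uniq.
pose comb (x : 'rV[C]_N) : P := \sum_i x 0 i *: e i.
have comb_inv (x : 'rV[C]_N) : W_invariant G (comb x).
  by apply: W_invariant_sum => i _; apply: W_invariantZ; have [] := He i.
have comb_size (x : 'rV[C]_N) : (msize (comb x) <= m)%N.
  apply: msize_sum_bound => i _ _; apply: leq_trans (msizeZ_le _ _) _.
  by have [] := He i.
pose M : 'M[C]_N := \matrix_(i, j) evalV (e i) (rho + toV S`_j).
have combE (x : 'rV[C]_N) (j : 'I_N) : evalV (comb x) (rho + toV S`_j) = (x *m M) 0 j.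
  by rewrite evalV_sum mxE; apply: eq_bigr => i _; rewrite evalVZ mxE.
have Mu : M \in unitmx.
  rewrite -row_free_unit; apply: inj_row_free => x xM0.
  have c0 : comb x = 0.
    apply: (uni m) => // mu muL mum.
    have muS : mu \in S by apply/mem_level_seq.
    have ltN : (index mu S < N)%N by rewrite index_mem.
    by have := combE x (Ordinal ltN); rewrite xM0 mxE /= nth_index.
  apply/rowP => j; rewrite mxE.
  have : evalV (comb x) (rho0 + toV S`_j) = x 0 j.
    rewrite evalV_sum (bigD1 j) //= big1 => [|i ij].
      by rewrite evalVZ; have [_ _ ->] := He j; rewrite eqxx mulr1 addr0.
    by rewrite evalVZ; have [_ _ ->] := He i; rewrite (negPf ij) mulr0.
  by rewrite c0 evalV0 => <-.
exists (comb ((\row_j v S`_j) *m invmx M)); split=> // mu muL mum.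
have muS : mu \in S by apply/mem_level_seq.
have ltN : (index mu S < N)%N by rewrite index_mem.
have := combE ((\row_j v S`_j) *m invmx M) (Ordinal ltN).
by rewrite mulmxKV // mxE /= nth_index.
Qed.

(** Let [g] interpolate [f] below level [m]. Then [f - g] vanishes there, so its image takes the
    values of [m (f - g)] at all nodes up to level [m] and equals it; what remains, [k - m g], has
    degree below [m]. *)
Lemma unisolvent_euler rho : propagates_vanishing G rho ->
  unisolvent_uniq rho -> unisolvent_ex rho -> forall m f h,
  W_invariant G f -> euler_image rho f h -> (msize f <= m.+1)%N ->
  (msize (h - m%:R *: f) <= m)%N.
Proof.
move=> prop uni ex m f h finv Hf fm.
have [g [ginv gm gf]] := ex m (fun mu => evalV f (rho + toV mu)).
have [k [kinv Hg km]] := euler_image_ex prop ginv.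
have e0 : (h - k) - m%:R *: (f - g) = 0.
  have fginv := W_invariantB finv ginv.
  have Hfg := euler_imageB Hf Hg.
  have fg0 : vanishes_below rho m (f - g).
    by move=> mu muL mum; rewrite evalVB gf // subrr.
  have fgm : (msize (f - g) <= m.+1)%N by apply: msizeB_bound; rewrite // ltnW // ltnS.
  have [h' [h'inv Hfg' h'm]] := euler_image_ex prop fginv.
  have hE : h - k = h'.
    have := Hfg; rewrite /euler_image Hfg' => /to_frac_inj /addrI /oppr_inj ->.
    by [].
  apply: (uni m.+1); first by apply: W_invariantB; [rewrite hE|apply: W_invariantZ].
    rewrite hE; apply: msizeB_bound; first exact: leq_trans h'm fgm.
    exact: leq_trans (msizeZ_le _ _) fgm.
  move=> nu nuL num; rewrite evalVB evalVZ (euler_image_eval prop fginv Hfg nuL); last first.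
    by move=> mu muL e; apply: fg0 => //; lia.
  have [lt|ge] := ltP (level nu) m%:Z; first by rewrite fg0 // !mulr0 subrr.
  have -> : level nu = m%:Z by apply/eqP; rewrite eq_le ge andbT; lia.
  by rewrite -pmulrn subrr.
have -> : h - m%:R *: f = k - m%:R *: g.
  by apply/eqP; rewrite -subr_eq0 -e0 scalerBr; apply/eqP; apply: subBB.
apply: msizeB_bound; first exact: leq_trans km gm.
exact: leq_trans (msizeZ_le _ _) gm.
Qed.

Lemma unisolvent_transfer rho0 rho :
  propagates_vanishing G rho0 -> propagates_vanishing G rho ->
  unisolvent_uniq rho0 -> unisolvent_ex rho0 -> unisolvent_uniq rho /\ unisolvent_ex rho.
Proof.
move=> prop0 prop uni0 ex0.
have uni : unisolvent_uniq rho.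
  apply: unisolvent_uniq_of_euler => // m f h finv Hf fm.
  have [h0 [h0inv Hf0 h0m]] := euler_image_ex prop0 finv.
  have le0 := unisolvent_euler prop0 uni0 ex0 finv Hf0 fm.
  rewrite -[h](subrK h0) -addrA; apply: msizeD_bound => //.
  by apply: leq_trans (euler_image_indep prop prop0 Hf Hf0) _; case: (msize f) fm.
split=> //; exact: unisolvent_ex_transfer ex0 uni.
Qed.

Hypothesis C9 : axiom_C9 R G.

(** Otherwise (C8) would make every invariant linear function zero, in particular [ell], against
    (C6). *)
Lemma Sigma1_nonempty : (0 < n)%N -> exists eta, eta \in Sigma1_dual G.
Proof.
move=> n0; have [/eqP S0|/fset0Pn [eta etaS]] := boolP (Sigma1_dual G == fset0)%fset; last by exists eta.
have e : map_mx intr (ell G) = 0 :> 'cV[C]_n.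
  apply: C8 => [w wW|w wW|eta]; last by rewrite S0 inE.
    by rewrite -map_mxM (ax_C4 ax).
  by rewrite mulmx0.
have e0 : ell G = 0.
  apply/matrixP => i j; have /matrixP /(_ i j) := e; rewrite !mxE => /eqP.
  by rewrite intr_eq0 => /eqP.
by have := ax_C6 ax (Ordinal n0); rewrite e0 pairing0r ltxx.
Qed.

Lemma Lambda_plusMn eta k : Lambda_plus G eta -> Lambda_plus G (eta *+ k).
Proof.
move=> etaL; elim: k => [|k IH]; first by rewrite mulr0n; apply: (Lambda_plus0 ax).
by rewrite mulrS; apply: (Lambda_plusD ax).
Qed.

Lemma level_nonempty m f : msize f = m.+1 ->
  exists2 lambda, Lambda_plus G lambda & level lambda = m%:Z.
Proof.
case: m => [|m] fm; first by exists 0; [exact: (Lambda_plus0 ax)|rewrite pairing0l].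
have n0 : (0 < n)%N.
  rewrite lt0n; apply/eqP => n0.
  by move: fm; rewrite (nvar0_mpolyC_eq f n0) msizeC; case: (_ != _).
have [eta etaS] := Sigma1_nonempty n0.
exists (eta *+ m.+1).
  apply: Lambda_plusMn; case/Sigma1_dualP: etaS => i _ ->; apply/(Lambda_plusP ax) => j.
  by rewrite (sigma_dualP ax); case: (_ == _).
by rewrite -scaler_nat pairingZl (ell_Lambda1 ax) ?(Sigma1_Lambda1 ax) // mulr1 natz.
Qed.

(** (C9) asserts uniqueness only in exact degree [ell(lambda)]. If a nonzero [f] vanished at the
    nodes, [p + f] and [p - f] would solve the same problem as [p] unless their degrees drop, and
    the leading coefficient of [f] cannot be cancelled with both signs. *)
Lemma unisolvent_uniq_C9 rho : (forall lambda, Lambda_plus G lambda ->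
    exists! p : P, [/\ W_invariant G p,
      (msize p)%:Z = level lambda + 1 & interpolates G rho lambda p]) ->
  unisolvent_uniq rho.
Proof.
move=> H m f finv fm fvan; apply/eqP; apply: contraT => nzf.
have [m' fm'] : exists m', msize f = m'.+1.
  by exists (msize f).-1; rewrite prednK // lt0n msize_poly_eq0.
have [lambda lL lm] := level_nonempty fm'.
have [p [[pinv pm pint] puniq]] := H lambda lL.
have pm' : msize p = m'.+1 by apply/Posz_eqS; rewrite pm lm.
have fvan' mu : Lambda_plus G mu -> level mu <= level lambda -> evalV f (rho + toV mu) = 0.
  move=> muL mul; apply: fvan => //; apply: le_lt_trans mul _.
  by rewrite lm ltz_nat -fm'.
have test (c : C) : c != 0 -> msize (p + c *: f) = m'.+1 -> False.
  move=> nzc sz; suff : p = p + c *: f.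
    move=> /eqP; rewrite eq_sym -subr_eq0 addrAC subrr add0r.
    by rewrite -mul_mpolyC mulf_eq0 mpolyC_eq0 (negPf nzc) (negPf nzf).
  apply: puniq; split; first by apply: W_invariantD => //; apply: W_invariantZ.
    by rewrite lm; apply/Posz_eqS.
  by move=> mu muL mul; rewrite evalVD evalVZ fvan' // mulr0 addr0 pint.
have bound (c : C) : (msize (p + c *: f) <= m'.+1)%N.
  by apply: msizeD_bound; rewrite ?pm' // (leq_trans (msizeZ_le _ _)) // fm'.
have test' (c : C) : c != 0 -> (p + c *: f)@_(mlead f) = 0.
  move=> nzc; apply/eqP; apply: contraT; rewrite -mcoeff_msupp => sup.
  case: (test c nzc); apply/eqP; rewrite eqn_leq bound /=.
  by rewrite -fm' -(mlead_deg nzf); apply: msize_mdeg_lt sup.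
have test2 (c : C) : c != 0 -> p@_(mlead f) + c * f@_(mlead f) = 0.
  by move=> nzc; rewrite -mcoeffZ -mcoeffD; apply: test'.
have : (f@_(mlead f)) *+ 2 = 0.
  have t1 := test2 1 (oner_neq0 _); rewrite mul1r in t1.
  have t2 : p@_(mlead f) - f@_(mlead f) = 0.
    by rewrite -mulN1r; apply: test2; rewrite oppr_eq0 oner_neq0.
  by rewrite mulr2n [LHS](add_sub_double _ (p@_(mlead f))) t1 t2 subr0.
move/eqP; rewrite mulrn_eq0 /= mleadc_eq0 => /eqP f0.
by rewrite f0 eqxx in nzf.
Qed.

(** Newton interpolation: [p_lambda] vanishes at the nodes of lower level and at the other nodes of
    its own level, so the values at level [m] can be corrected one node at a time. *)
Lemma unisolvent_ex_C9 rho : (forall lambda, Lambda_plus G lambda ->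
    exists! p : P, [/\ W_invariant G p,
      (msize p)%:Z = level lambda + 1 & interpolates G rho lambda p]) ->
  unisolvent_ex rho.
Proof.
move=> H; elim=> [|m IH] v.
  exists 0; split; [exact: W_invariant0|by rewrite msize0|move=> mu muL].
  by rewrite ltNge (Lambda_plus_ge0 ax muL (ell_nonneg ax)).
have [g [ginv gm gv]] := IH v.
pose S := [seq nu <- level_seq m.+1 | level nu == m%:Z].
suff [f [finv fm fv fS]] : exists f, [/\ W_invariant G f, (msize f <= m.+1)%N,
    forall mu, Lambda_plus G mu -> level mu < m%:Z -> evalV f (rho + toV mu) = v mu &
    forall mu, mu \in S -> evalV f (rho + toV mu) = v mu].
  exists f; split=> // mu muL mum.
  have [lt|ge] := ltP (level mu) m%:Z; first exact: fv.
  apply: fS; rewrite mem_filter eq_le ge andbT; apply/andP; split; first by lia.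
  by apply/mem_level_seq.
have : {subset S <= S} by [].
elim: {-2}S => [|lambda S' IHS] sub.
  by exists g; split=> //; rewrite ltnW.
have [f [finv fm fv fS]] : exists f, [/\ W_invariant G f, (msize f <= m.+1)%N,
    forall mu, Lambda_plus G mu -> level mu < m%:Z -> evalV f (rho + toV mu) = v mu &
    forall mu, mu \in S' -> evalV f (rho + toV mu) = v mu].
  by apply: IHS => mu muS; apply: sub; rewrite inE muS orbT.
have := sub lambda (mem_head _ _); rewrite mem_filter => /andP [/eqP lm /mem_level_seq [lL _]].
have [p [[pinv pm pint] _]] := H lambda lL.
have pm' : msize p = m.+1 by apply/Posz_eqS; rewrite pm lm.
exists (f + (v lambda - evalV f (rho + toV lambda)) *: p); split.
- by apply: W_invariantD => //; apply: W_invariantZ.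
- by apply: msizeD_bound; rewrite // (leq_trans (msizeZ_le _ _)) // pm'.
- move=> mu muL mum; rewrite evalVD evalVZ pint //; last by rewrite lm ltW.
  have -> : (lambda == mu) = false by apply/eqP => e; move: mum; rewrite -e lm ltxx.
  by rewrite mulr0 addr0 fv.
move=> mu muS.
have := sub mu muS; rewrite mem_filter => /andP [/eqP mum /mem_level_seq [muL _]].
rewrite evalVD evalVZ pint //; last by rewrite lm mum.
have [->|neq] := eqVneq lambda mu; first by rewrite mulr1 addrC subrK.
by rewrite mulr0 addr0; apply: fS; move: muS; rewrite inE eq_sym (negPf neq).
Qed.

Lemma unisolvent rho : propagates_vanishing G rho -> unisolvent_uniq rho /\ unisolvent_ex rho.
Proof.
have [rho0 [V0 reg dom H]] := C9.
move=> prop; apply: (@unisolvent_transfer rho0) => //.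
- exact: propagates_vanishing_regular_dominant.
- exact: unisolvent_uniq_C9.
exact: unisolvent_ex_C9.
Qed.

End Interpolation.

(** * Propagation of zeros at singular dominant points *)

Lemma perm_map_sum (A : zmodType) (T : eqType) (r : seq T) (f : T -> T) (F : T -> A) :
  perm_eq (map f r) r -> \sum_(x <- r) F (f x) = \sum_(x <- r) F x.
Proof. by move=> pr; rewrite -[RHS](perm_big _ pr) big_map. Qed.

Section Dominant.

Context {R : realType} {n : nat} (G : datum n) (ax : lattice_axioms G).
Hypothesis C8 : axiom_C8 R G.
Hypothesis C9 : axiom_C9 R G.
Local Notation C := R[i].
Local Notation V := 'rV[C]_n.
Local Notation P := {mpoly C[n]}.
Local Notation lin := (@linpoly R n).
Local Notation pvec := (weyl_vector G).
Local Notation cof := (@cofactor_den R n G).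
Local Notation DD := (@root_poly R n G).
Implicit Types (p q f g h : P) (u v x rho : V) (eta mu nu lambda tau : 'rV[int]_n).
Implicit Types (omega alpha beta : 'cV[int]_n) (w s : 'M[int]_n).

(* By interpolation at the regular dominant point [pvec], the invariants separate the points
   of [pvec + Lambda_+]. *)
Lemma Lambda_plus_orbit w mu : w \in W G -> Lambda_plus G mu -> Lambda_plus G (act_dual w mu) ->
  act_dual w mu = mu.
Proof.
move=> wW muL wmuL; have [w' [w'W <- w'D]] := chamber_reduction ax wW muL wmuL.
have pK := chamber_weyl_vector ax w'W w'D.
have [_ /(_ _ muL) w'muL] := chamber_Lambda_plus ax w'W w'D.
apply/eqP; apply: contraT => neq.
pose rho : V := 1%:R *: toV pvec.
have prop : propagates_vanishing G rho.
  apply: (propagates_vanishing_regular_dominant ax); first exact: V0_weyl_vectorZ.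
    exact: weyl_vector_regular.
  exact: weyl_vector_dominant.
have [_ ex] := unisolvent ax C8 C9 prop.
have lev : pairing mu (ell G) < (`|pairing mu (ell G)|.+1)%N%:Z by lia.
have [f [finv _ fv]] := ex (`|pairing mu (ell G)|.+1)%N (fun nu => (nu == mu)%:R).
(* Since [w'] fixes [pvec], the points [pvec + mu] and [pvec + w' mu] are conjugate. *)
have := finv w' (rho + toV mu) w'W.
rewrite mulmxDl -toV_act /rho -scalemxAl -toV_act pK !fv ?(ell_act ax) //.
by rewrite eqxx (negPf neq) => /esym/eqP; rewrite oner_eq0.
Qed.

Section AtPoint.

Variables (rho : V) (nu : 'rV[int]_n).
Hypothesis V0 : in_V0 G rho.
Hypothesis dom : dominant G rho.
Hypothesis nuL : Lambda_plus G nu.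
Hypothesis level_gt0 : 0 < pairing pvec (ell G).

Let x : V := rho + toV nu.
Let S : pred 'cV[int]_n := fun alpha => linval alpha x == 0.

(** For a positive root, dominance forbids [- alpha(nu)] to be negative, and [alpha(nu)] is
    nonnegative. So reflections in the roots vanishing at [x] fix [rho] and [nu] separately. *)
Lemma singular_root alpha : alpha \in Delta G -> S alpha ->
  linval alpha rho = 0 /\ pairing nu alpha = 0.
Proof.
have H beta : beta \in Delta_plus G -> S beta -> linval beta rho = 0 /\ pairing nu beta = 0.
  move=> bp; rewrite /S /x linvalD linval_toV addr_eq0 -rmorphN => /eqP e.
  have [_ bpos] := Delta_plusP _ _ bp.
  have ge0 := Lambda_plus_ge0 ax nuL bpos.
  have [z0|nz] := eqVneq (pairing nu beta) 0; first by rewrite e z0 oppr0.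
  case: (dom bp (m := - pairing nu beta)) => //.
  by rewrite oppr_lt0 lt_neqAle eq_sym nz.
move=> aD Sa; case: (root_sign ax aD) => [/H|/H]; first by apply.
rewrite {1}/S !linvalNl pairingNr oppr_eq0 => /(_ Sa) [/eqP e1 /eqP e2].
by split; apply/eqP; rewrite -oppr_eq0.
Qed.

(** Fixing [nu] itself, and not just [x], turns conjugate translations [tau] into conjugate points
    [nu - tau]. *)
Definition point_stabilizer : {fset 'M[int]_n} :=
  [fset w in W G | (rho *m act_V w == rho) && (act_dual w nu == nu)]%fset.

Lemma point_stabilizerP w : reflect [/\ w \in W G, rho *m act_V w = rho & act_dual w nu = nu]
  (w \in point_stabilizer).
Proof.
rewrite !inE /=; apply: (iffP and3P) => [[wW /eqP r /eqP m]|[wW r m]]; first by split.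
by split=> //; apply/eqP.
Qed.

Lemma point_stabilizerM w w' : w \in point_stabilizer -> w' \in point_stabilizer ->
  w *m w' \in point_stabilizer.
Proof.
move=> /point_stabilizerP [wW r m] /point_stabilizerP [w'W r' m'].
apply/point_stabilizerP; split; first exact: (WM ax).
  by rewrite /act_V (invmxM (W_unit ax wW) (W_unit ax w'W)) map_mxM mulmxA -/(act_V _) r' -/(act_V _) r.
by rewrite (act_dualM ax) // m' m.
Qed.

Lemma point_stabilizer1 : 1%:M \in point_stabilizer.
Proof.
apply/point_stabilizerP; split; first exact: (W1 ax).
  by rewrite /act_V invmx1 map_mx1 mulmx1.
exact: act_dual1.
Qed.

Lemma reflection_stabilizer s beta : s \in W G -> beta \in Delta G -> S beta ->
  reflection_along beta s -> s \in point_stabilizer.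
Proof.
move=> sW bD Sb [c cb defs]; have [b1 b2] := singular_root bD Sb.
apply/point_stabilizerP; split=> //; rewrite defs.
  by rewrite act_V_reflection // b1 scale0r subr0.
by rewrite act_reflection // b2 scale0r subr0.
Qed.

(** The orbit is listed with multiplicity, one entry per stabilizer element, so that summing over
    all [eta] repeats the full sum a fixed number of times. *)
Let r eta : seq 'rV[int]_n := [seq act_dual w eta | w <- point_stabilizer].

Lemma stabilizer_orbit_stable eta s beta : s \in W G -> beta \in Delta G -> S beta ->
  reflection_along beta s -> perm_eq [seq act_dual s tau | tau <- r eta] (r eta).
Proof.
move=> sW bD Sb sb; have sX := reflection_stabilizer sW bD Sb sb.
have pX : perm_eq [seq s *m w | w <- point_stabilizer] point_stabilizer.
  apply: (perm_map_fset (f := fun w => s *m w)).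
    by apply: can_inj (mulKmx (W_unit ax sW)).
  by move=> w wX; apply: point_stabilizerM.
have -> : [seq act_dual s tau | tau <- r eta] =
    [seq act_dual w eta | w <- [seq s *m w | w <- point_stabilizer]].
  rewrite /r -!map_comp; apply/eq_in_map => w /point_stabilizerP [wW _ _] /=.
  by rewrite -(act_dualM ax).
exact: perm_map.
Qed.

(* A W-invariant affine function equal to [t] at [x + t pvec]; it lets the parameter
   [rho] move with the point, so that no second variable is needed. *)
Let theta : P := ((pairing pvec (ell G))%:~R^-1 : C) *: (lin (ell G) - (linval (ell G) x)%:MP).

Let numer' eta : P :=
  \prod_(omega <- Phi G | 0 < pairing eta omega) (lin omega - (k_ G rho omega)%:MP - theta).

Lemma theta_act w v : w \in W G -> evalV theta (v *m act_V w) = evalV theta v.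
Proof.
move=> wW; rewrite !evalVZ !evalVB !evalVC !evalV_linpoly linval_act.
by rewrite (ax_C4 ax) // (WV ax).
Qed.

Lemma theta_line (t : C) : evalV theta (x + t *: toV pvec) = t.
Proof.
rewrite evalVZ evalVB evalVC evalV_linpoly linvalD linvalZ linval_toV addrAC subrr add0r.
by rewrite mulrC mulfK // intr_eq0 gt_eqF.
Qed.

Lemma numer'_act w eta v : w \in W G ->
  evalV (numer' (act_dual w eta)) (v *m act_V w) = evalV (numer' eta) v.
Proof.
move=> wW; rewrite !evalV_prod (reindex_W _ _ (perm_Phi ax wW)).
apply: eq_big => omega; first by rewrite (act_dualM_pairing ax).
move=> _; rewrite evalVB [in RHS]evalVB evalVB [in RHS]evalVB !evalVC !evalV_linpoly.
by rewrite linval_act mulKmx ?(W_unit ax) // (k_act ax) // theta_act.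
Qed.

Lemma numer'_line (t : C) eta :
  evalV (numer' eta) (x + t *: toV pvec) =
  evalV (numer G (rho + t *: toV pvec) eta) (rho + t *: toV pvec + toV nu).
Proof.
rewrite !evalV_prod big_seq_cond [RHS]big_seq_cond; apply: eq_bigr => omega /andP [oP _].
rewrite evalVB [in RHS]evalVB evalVB !evalVC theta_line !evalV_linpoly (k_line ax t V0 oP).
by rewrite /x [rho + toV nu + _]addrAC opprD [RHS]addrA.
Qed.

(* A direction along which [theta] is constant and no root is. *)
Let dir : 'rV[int]_n := (size (W G))%:Z *: pvec - \sum_(w <- W G) act_dual w pvec.

Lemma dir_ell : pairing dir (ell G) = 0.
Proof.
rewrite pairingBl pairingZl pairing_suml big_seq (eq_bigr (fun=> pairing pvec (ell G))).
  by rewrite -big_seq big_const_seq count_predT iter_addr_0 -mulr_natl natz subrr.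
by move=> w wW; rewrite (ell_act ax).
Qed.

(** The orbit sum of [pvec] is fixed by the reflection, hence killed by [alpha]; on roots, [dir] is
    thus a nonzero multiple of [pvec]. *)
Lemma dir_root alpha : alpha \in Delta G -> pairing dir alpha != 0.
Proof.
move=> aD; have [s [c [sW ca defs]]] := root_reflection ax aD.
pose e : 'rV[int]_n := \sum_(w <- W G) act_dual w pvec.
have se : act_dual s e = e.
  rewrite /act_dual /e mulmx_suml -/(act_dual _ _).
  rewrite -[RHS](perm_big _ (perm_map_fset (A := W G) (can_inj (mulKmx (W_unit ax sW))) _)).
    rewrite big_map big_seq [RHS]big_seq; apply: eq_bigr => w wW.
    by rewrite -/(act_dual s _) -(act_dualM ax).
  by move=> w wW; apply: (WM ax).
have ea : pairing e alpha = 0.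
  have := congr1 (fun y => pairing y alpha) se.
  by rewrite defs act_reflection // pairingBl pairingZl ca; lia.
rewrite pairingBl pairingZl -/e ea subr0 mulf_neq0 //.
  rewrite eqz_nat size_eq0; apply/eqP => W0.
  by have := W1 ax; rewrite -[_ \in _]/(_ \in enum_fset (W G)) W0.
case: (root_sign ax aD) => /(weyl_vector_root ax); first by move/gt_eqF ->.
by rewrite pairingNr oppr_gt0 => /lt_eqF ->.
Qed.

Lemma numer'_dir (t : C) eta :
  evalV (numer' eta) (x + t *: toV dir) = evalV (numer G rho eta) (x + t *: toV dir).
Proof.
rewrite !evalV_prod; apply: eq_bigr => omega _.
rewrite evalVB; set y := evalV theta _.
suff -> : y = 0 by rewrite subr0.
rewrite /y evalVZ evalVB evalVC evalV_linpoly linvalD linvalZ linval_toV dir_ell.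
by rewrite mulr0 addr0 subrr mulr0.
Qed.

Let prodS : P := \prod_(alpha <- Delta G | S alpha) lin alpha.

Lemma prodS_line (v : 'rV[int]_n) (k : nat) : (0 < k)%N ->
  {in Delta G, forall alpha, pairing v alpha != 0} ->
  evalV prodS (x + k%:R *: toV v) != 0.
Proof.
move=> k0 nz; rewrite evalV_prod prodf_seq_neq0; apply/allP => alpha aD; apply/implyP => /eqP Sa.
rewrite evalV_linpoly linvalD Sa add0r linvalZ linval_toV mulf_neq0 //.
  by rewrite pnatr_eq0 -lt0n.
by rewrite intr_eq0 nz.
Qed.

Lemma pvec_root alpha : alpha \in Delta G -> pairing pvec alpha != 0.
Proof.
move=> aD; case: (root_sign ax aD) => /(weyl_vector_root ax); first by move/gt_eqF ->.
by rewrite pairingNr oppr_gt0 => /lt_eqF ->.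
Qed.

Lemma S_opp : {in Delta G, forall alpha, S (- alpha) = S alpha}.
Proof. by move=> alpha _; rewrite /S linvalNl oppr_eq0. Qed.

Let Nsum (num : 'rV[int]_n -> P) f eta : P :=
  \sum_(tau <- r eta) cof tau * (num tau * shift_poly tau f).

Lemma Nsum_dvd (num : 'rV[int]_n -> P) f eta : W_invariant G f ->
  (forall w eta v, w \in W G -> evalV (num (act_dual w eta)) (v *m act_V w) = evalV (num eta) v) ->
  exists q, Nsum num f eta = prodS * q.
Proof.
move=> finv numE; apply: (weyl_sum_dvd ax S_opp).
  by move=> s beta; apply: stabilizer_orbit_stable.
move=> s beta sW _ _ _ tau v; rewrite [LHS]evalVM [RHS]evalVM.
congr (_ * _).
  exact: numE.
exact: (shift_act _ _ finv sW).
Qed.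

Lemma Nsum_eval (num : 'rV[int]_n -> P) f eta v :
  evalV (Nsum num f eta) v =
  \sum_(tau <- r eta) evalV (cof tau) v * (evalV (num tau) v * evalV f (v - toV tau)).
Proof.
rewrite evalV_sum; apply: eq_bigr => tau _.
by rewrite [LHS]evalVM [X in _ * X]evalVM evalV_shift.
Qed.

(** The points [nu - tau] and [nu - tau'] are conjugate under the stabilizer of [nu], so they
    coincide once both lie in [Lambda_+]. *)
Lemma surviving_unique eta tau tau' : tau \in r eta -> tau' \in r eta ->
  Lambda_plus G (nu - tau) -> Lambda_plus G (nu - tau') -> tau = tau'.
Proof.
move=> /mapP [w wX ->] /mapP [w' w'X ->] L L'.
have [wW _ wnu] := point_stabilizerP _ wX; have [w'W _ w'nu] := point_stabilizerP _ w'X.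
have w'V := WV ax w'W.
have act_tau : act_dual (w *m invmx w') (nu - act_dual w' eta) = nu - act_dual w eta.
  by rewrite (act_dualM ax) // act_dualB (act_dualK ax) // -{1}w'nu (act_dualK ax) // act_dualB wnu.
have := Lambda_plus_orbit (WM ax wW w'V) L'; rewrite act_tau => /(_ L) /addrI /oppr_inj.
by [].
Qed.

(** The deformed numerators agree with the original ones along [dir], so [q] and [q'] agree at [x].
    Along [pvec] at most one translation [tau0] survives, and then [q'] is [q1], the quotient for
    the constant 1, times the translate of [f] by [tau0]. Being polynomial, [q1] is finite at [x],
    where the translate vanishes. *)
Lemma Nsum_vanishing f eta : W_invariant G f ->
  (forall mu, Lambda_plus G mu -> pairing mu (ell G) = pairing nu (ell G) - 1 ->
     evalV f (rho + toV mu) = 0) -> eta \in Lambda1 G ->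
  exists2 q, Nsum (numer G rho) f eta = prodS * q & evalV q x = 0.
Proof.
move=> finv fmu etaL.
have numE w eta' v : w \in W G ->
    evalV (numer G rho (act_dual w eta')) (v *m act_V w) = evalV (numer G rho eta') v.
  exact: (numer_act ax).
have [q Hq] := Nsum_dvd eta finv numE; exists q => //.
have [q' Hq'] := Nsum_dvd eta finv numer'_act.
have [q1 Hq1] := Nsum_dvd eta (@W_invariant1 R n G) numer'_act.
have rL tau : tau \in r eta -> tau \in Lambda1 G.
  by case/mapP => w /point_stabilizerP [wW _ _] ->; apply: (Lambda1_stable ax).
have -> : evalV q x = evalV q' x.
  have := @evalV_line_eq _ _ q q' x (toV dir) 1 _ 0; rewrite scale0r addr0; apply => k k0.
  apply: (mulfI (prodS_line k0 dir_root)); rewrite -!evalVM -Hq -Hq' !Nsum_eval.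
  by apply: eq_bigr => tau _; rewrite numer'_dir.
have numer'0 k tau : tau \in r eta -> ~ Lambda_plus G (nu - tau) ->
    evalV (numer' tau) (x + k%:R *: toV pvec) = 0.
  move=> tr nL; rewrite numer'_line (numer_eq0 ax) //; first exact: V0_line.
  exact: rL.
have [surv|none] := boolP (has (fun tau => [forall i, 0 <= pairing (nu - tau) (sigma G i)]) (r eta)).
  have /hasP [tau0 t0r /forallP t0L] := surv.
  have {}t0L : Lambda_plus G (nu - tau0) by apply/(Lambda_plusP ax).
  have e k : (1 <= k)%N -> evalV q' (x + k%:R *: toV pvec) =
      evalV (q1 * shift_poly tau0 f) (x + k%:R *: toV pvec).
    move=> k0; set y := x + _.
    have h1 := Nsum_eval numer' f eta y; rewrite Hq' evalVM in h1.
    have h2 := Nsum_eval numer' 1 eta y; rewrite Hq1 evalVM in h2.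
    have h3 : evalV (q1 * shift_poly tau0 f) y = evalV q1 y * evalV f (y - toV tau0).
      exact: etrans (evalVM _ _ _) (congr1 _ (evalV_shift _ _ _)).
    apply: (mulfI (prodS_line k0 pvec_root)); rewrite -/y h3 mulrA h1 h2 mulr_suml.
    rewrite big_seq [RHS]big_seq; apply: eq_bigr => tau tr.
    have [tL|tnL] := Lambda_plus_dec ax (nu - tau).
      by rewrite (surviving_unique tr t0r tL t0L) evalV1 mulr1 mulrA.
    by rewrite (numer'0 k tau tr tnL) !(mul0r, mulr0).
  have := evalV_line_eq e 0; rewrite scale0r addr0 => ->.
  rewrite (etrans (evalVM _ _ _) (congr1 _ (evalV_shift _ _ _))).
  rewrite /x -addrA -toVB fmu ?mulr0 //.
  by rewrite pairingBl (ell_Lambda1 ax (rL _ t0r)).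
have e k : (1 <= k)%N -> evalV q' (x + k%:R *: toV pvec) = evalV 0 (x + k%:R *: toV pvec).
  move=> k0; apply: (mulfI (prodS_line k0 pvec_root)).
  rewrite evalV0 mulr0 -evalVM -Hq' Nsum_eval big_seq big1 // => tau tr.
  rewrite (numer'0 k tau tr) ?mul0r ?mulr0 // => tL.
  move/hasPn: none => /(_ tau tr) /negP; apply; apply/forallP.
  by move/(Lambda_plusP ax): tL.
by have := evalV_line_eq e 0; rewrite scale0r addr0 evalV0.
Qed.

(** The orbit sums add up to [root_poly * g] times the order of the stabilizer. The roots vanishing
    at [x] are cancelled as polynomials, the others by their values. *)
Lemma dominant_vanishing f g : W_invariant G f -> Lop G rho (to_frac f) = to_frac g ->
  (forall mu, Lambda_plus G mu -> pairing mu (ell G) = pairing nu (ell G) - 1 ->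
     evalV f (rho + toV mu) = 0) ->
  evalV g x = 0.
Proof.
move=> finv /(Lop_polyP ax) Lg fmu.
pose F eta : P := cof eta * (numer G rho eta * shift_poly eta f).
have sumN : \sum_(eta <- Lambda1 G) Nsum (numer G rho) f eta =
    (DD * g) *+ size point_stabilizer.
  have -> : \sum_(eta <- Lambda1 G) Nsum (numer G rho) f eta =
      \sum_(eta <- Lambda1 G) \sum_(w <- point_stabilizer) F (act_dual w eta).
    by apply: eq_bigr => eta _; rewrite /Nsum /r big_map.
  rewrite exchange_big /= big_seq (eq_bigr (fun=> DD * g)).
    by rewrite -big_seq big_const_seq count_predT iter_addr_0.
  move=> w /point_stabilizerP [wW _ _]; rewrite Lg /weyl_sum.
  exact: (perm_map_sum F (perm_Lambda1 ax wW)).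
have [q Hq qx] : exists2 q, \sum_(eta <- Lambda1 G) Nsum (numer G rho) f eta = prodS * q &
    evalV q x = 0.
  rewrite big_seq; apply: (big_ind (fun N => exists2 q, N = prodS * q & evalV q x = 0)).
  - by exists 0; rewrite ?mulr0 ?evalV0.
  - move=> a b [qa -> qa0] [qb -> qb0]; exists (qa + qb); first by rewrite mulrDr.
    by rewrite evalVD qa0 qb0 addr0.
  by move=> eta etaL; apply: Nsum_vanishing.
pose Q : P := \prod_(alpha <- Delta G | ~~ S alpha) lin alpha.
have DDE : DD = prodS * Q by exact: bigID.
have nzS : prodS != 0 by exact: prod_roots_neq0.
have qE : q = (Q * g) *+ size point_stabilizer.
  by apply: (mulfI nzS); rewrite -Hq sumN DDE -mulrA mulrnAr.
have nzQ : evalV Q x != 0.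
  rewrite evalV_prod prodf_seq_neq0; apply/allP => alpha aD; apply/implyP.
  by rewrite evalV_linpoly.
move: qx; rewrite qE -mulr_natr -mpolyC_nat [_ * _%:MP]mulrC mul_mpolyC evalVZ evalVM => /eqP.
rewrite !mulf_eq0 (negPf nzQ) /= => /orP [|/eqP //].
rewrite pnatr_eq0 size_eq0 => /eqP X0.
by have := point_stabilizer1; rewrite -[_ \in _]/(_ \in enum_fset point_stabilizer) X0.
Qed.

End AtPoint.

Lemma propagates_vanishing_dominant rho : in_V0 G rho -> dominant G rho ->
  propagates_vanishing G rho.
Proof.
move=> V0 dom.
(* [theta] divides by [ell(pvec)]; if this is not positive, then [pvec = 0] and there are no
   roots. *)
have [gt0|le0] := ltP 0 (pairing pvec (ell G)).
  by move=> f g nu finv Lfg nuL; apply: dominant_vanishing.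
apply: (propagates_vanishing_regular ax) => // nu _.
rewrite evalV_prod prodf_seq_neq0; apply/allP => alpha aD; apply/implyP => _.
have p0 := Lambda_plus_ell0 ax (Lambda_plus_weyl_vector ax) le0.
by case: (root_sign ax aD) => /(weyl_vector_root ax); rewrite p0 pairing0l ltxx.
Qed.

End Dominant.

(** * The exponential of [ad L] *)

Section AdjointExponential.

Variables (K : fieldType) (L : {additive K -> K}) (l : K).
Hypothesis L_l : forall f, L (l * f) = (l - 1) * L f.
Hypothesis char0 : forall k, k.+1%:R != 0 :> K.

Definition ad_op (X : K -> K) (f : K) : K := L (X f) - X (L f).

Lemma L_shift k f : L ((l - k%:R) * f) = (l - k.+1%:R) * L f.
Proof.
rewrite mulrBl raddfB /= L_l mulr_natl raddfMn /= -[L f *+ k]mulr_natl -mulrBl.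
by congr (_ * _); rewrite -natr1 opprD addrAC addrA.
Qed.

(* If [h p] splits into eigenvectors [q_j] of [l - L] for [i + j], then [(ad L)^d h] acts
   through the falling factorials of [j]. *)
Lemma iter_ad_eigen (h : K) d i e p (q : nat -> K) :
  L p = (l - i%:R) * p -> h * p = \sum_(j < e) q j ->
  (forall j, L (q j) = (l - (i + j)%:R) * q j) -> (forall j, (e <= j)%N -> q j = 0) ->
  iter d ad_op (fun f => h * f) p = (-1) ^+ d * \sum_(j < e) (j ^_ d)%:R * q j.
Proof.
elim: d i p q => [|d IH] i p q Lp hp Lq qe0.
  by rewrite /= expr0 mul1r hp; apply: eq_bigr => j _; rewrite ffactn0 mul1r.
have Lqq j : L (L (q j)) = (l - (i.+1 + j)%:R) * L (q j).
  by rewrite {1}Lq L_shift addSn.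
(* Since [(l - i) q_j = L q_j + j q_j], these are the components of [h * L p]: the term [j q_j]
   belongs to [i + j] and moves to index [j - 1] relative to [i + 1]. *)
pose q' j := L (q j) + j.+1%:R * q j.+1.
have shift_sum (a : nat -> K) : a 0%N = 0 -> a e = 0 ->
    \sum_(j < e) a j.+1 = \sum_(j < e) a j.
  move=> a0 ae; apply: (@addrI _ (a 0%N)).
  by rewrite -(big_ord_recl e (fun j => a j)) big_ord_recr /= a0 ae addr0 add0r.
have Lp' : L (L p) = (l - i.+1%:R) * L p by rewrite {1}Lp L_shift.
have hp' : h * L p = \sum_(j < e) q' j.
  rewrite Lp mulrCA hp mulr_sumr /q' big_split /=.
  rewrite (shift_sum (fun j => j%:R * q j)); [|by rewrite mul0r|by rewrite qe0 // mulr0].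
  rewrite -big_split /=; apply: eq_bigr => j _; rewrite Lq -mulrDl natrD; congr (_ * _).
  by rewrite opprD addrA subrK.
have Lq' j : L (q' j) = (l - (i.+1 + j)%:R) * q' j.
  rewrite /q' raddfD /= Lqq mulr_natl [L (_ *+ _)]raddfMn /= (Lq j.+1) addnS -addSn.
  by rewrite mulrDr mulrnAr.
have qe0' j : (e <= j)%N -> q' j = 0.
  by move=> ej; rewrite /q' !qe0 ?(leqW ej) // raddf0 mulr0 addr0.
rewrite iterS /ad_op -/ad_op (IH i p q Lp hp Lq qe0) (IH i.+1 (L p) q' Lp' hp' Lq' qe0').
have Lsign (x : K) : L ((-1) ^+ d * x) = (-1) ^+ d * L x.
  by rewrite -signr_odd; case: (odd d); rewrite ?expr0 ?expr1 ?mul1r // !mulN1r raddfN.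
rewrite Lsign raddf_sum -mulrBr -sumrB exprS mulN1r mulNr -mulrN; congr (_ * _).
have -> : \sum_(j < e) (j ^_ d.+1)%:R * q j =
    \sum_(j < e) ((j.+1) ^_ d.+1)%:R * q j.+1.
  rewrite (shift_sum (fun j => (j ^_ d.+1)%:R * q j)) //; first by rewrite ffact0n mul0r.
  by rewrite qe0 // mulr0.
rewrite -sumrN; apply: eq_bigr => j _.
rewrite /= mulr_natl [L (_ *+ _)]raddfMn /= -[L _ *+ _]mulr_natl /q' mulrDr opprD addrA subrr add0r.
by rewrite ffactSS natrM mulrA [_%:R * j.+1%:R]mulrC.
Qed.

Lemma sum_signed_bin j M : (j < M)%N ->
  \sum_(d < M) (-1) ^+ d * 'C(j, d)%:R = (j == 0%N)%:R :> K.
Proof.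
move=> jM; rewrite -(subnKC jM) big_split_ord /= [X in _ + X]big1 => [|d _]; last first.
  by rewrite bin_small ?mulr0 // addSn ltnS leq_addr.
rewrite addr0; have := exprDn (1 : K) (-1) j; rewrite subrr expr0n => ->.
by apply: eq_bigr => d _; rewrite expr1n mul1r mulr_natr.
Qed.

Lemma sum_ad_eigen (h : K) i e M p (q : nat -> K) : (e <= M)%N ->
  L p = (l - i%:R) * p -> h * p = \sum_(j < e) q j ->
  (forall j, L (q j) = (l - (i + j)%:R) * q j) -> (forall j, (e <= j)%N -> q j = 0) ->
  \sum_(d < M) (d`!%:R)^-1 * iter d ad_op (fun f => h * f) p = q 0%N.
Proof.
move=> eM Lp hp Lq qe0.
have nzfact d : d`!%:R != 0 :> K by rewrite -(prednK (fact_gt0 d)) char0.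
transitivity (\sum_(d < M) \sum_(j < e) ((-1) ^+ d * 'C(j, d)%:R) * q j).
  apply: eq_bigr => d _; rewrite (iter_ad_eigen d Lp hp Lq qe0) !mulr_sumr.
  apply: eq_bigr => j _; rewrite -bin_ffact natrM.
  move: (nzfact d); move: (d`!%:R : K) ('C(j, d)%:R : K) ((-1) ^+ d : K) => a b c nz.
  by field.
rewrite exchange_big /=.
transitivity (\sum_(j < e) (j == 0%N :> nat)%:R * q j).
  by apply: eq_bigr => j _; rewrite -mulr_suml sum_signed_bin // (leq_trans (ltn_ord j)).
case: e eM hp qe0 => [|e] eM hp qe0; first by rewrite big_ord0 qe0.
by rewrite big_ord_recl /= mul1r big1 ?addr0 // => j _; rewrite mul0r.
Qed.

End AdjointExponential.

(** * Expansion over lattice paths *)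

Section PathExpansion.

Variables (n : nat) (G : datum n) (K : fieldType).
Implicit Types (eta tau : 'rV[int]_n) (t : seq 'rV[int]_n).
Variables (T : 'rV[int]_n -> {rmorphism K -> K}) (f : 'rV[int]_n -> K).
Hypothesis TD : forall eta tau x, T eta (T tau x) = T (eta + tau) x.

Definition translation_sum (x : K) : K := \sum_(eta <- Lambda1 G) f eta * T eta x.
Local Notation L := translation_sum.

Definition path_weight d t : K := \prod_(i < d) T t`_i (f (t`_i.+1 - t`_i)).

Lemma paths_nth0 d tau t : t \in paths G d tau -> t`_0 = tau.
Proof.
case: d => [|d] /=; first by rewrite inE => /eqP ->.
by case/allpairsPdep => eta [p [_ _ ->]].
Qed.

Lemma paths_size d tau t : t \in paths G d tau -> size t = d.+1.
Proof.
elim: d tau t => [|d IH] tau t /=; first by rewrite inE => /eqP ->.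
by case/allpairsPdep => eta [p [_ pp ->]]; rewrite /= (IH _ _ pp).
Qed.

Lemma paths_last d tau t : t \in paths G d tau ->
  exists2 sigma, sigma \in Lambda_deg G d & last 0 t = tau + sigma.
Proof.
elim: d tau t => [|d IH] tau t /=.
  by rewrite inE => /eqP ->; exists 0; rewrite ?inE ?addr0.
case/allpairsPdep => eta [p [etaL pp ->]].
have [sigma sL e] := IH _ _ pp; exists (sigma + eta).
  by apply/imfset2P; exists sigma => //; exists eta.
have : last tau p = last 0 p by case: p pp {e} => // /paths_size.
by rewrite /= => ->; rewrite e -addrA [eta + _]addrC.
Qed.

Lemma big_pathsS d tau (F : seq 'rV[int]_n -> K) :
  \sum_(t <- paths G d.+1 tau) F t =
  \sum_(eta <- Lambda1 G) \sum_(p <- paths G d (tau + eta)) F (tau :: p).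
Proof. exact: big_allpairs_dep. Qed.

Lemma path_weight_cons d tau eta p : p \in paths G d (tau + eta) ->
  path_weight d.+1 (tau :: p) = T tau (f eta) * path_weight d p.
Proof.
move=> pp; rewrite /path_weight big_ord_recl /= (paths_nth0 pp) [tau + eta - tau]addrC addKr.
by [].
Qed.

Lemma last_cons d tau eta p : p \in paths G d (tau + eta) -> last tau p = last 0 p.
Proof. by case: p => // /paths_size. Qed.

Lemma iter_translation_sum j tau x :
  T tau (iter j L x) = \sum_(t <- paths G j tau) path_weight j t * T (last 0 t) x.
Proof.
elim: j tau => [|j IH] tau; first by rewrite /= big_seq1 /path_weight big_ord0 mul1r.
rewrite iterS /translation_sum rmorph_sum big_pathsS; apply: eq_bigr => eta _.
rewrite rmorphM /= TD -/(iter j _ _) IH mulr_sumr big_seq [RHS]big_seq; apply: eq_bigr => p pp.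
by rewrite (path_weight_cons pp) /= (last_cons pp) mulrA.
Qed.

(** The starting vertex is arbitrary so that the induction can peel off the first step; [h] is read
    at the vertex reached after the [i] outer applications. *)
Lemma iter_mul_iter i j h tau x :
  T tau (iter i L (h * iter j L x)) =
  \sum_(t <- paths G (i + j) tau) T t`_i h * path_weight (i + j) t * T (last 0 t) x.
Proof.
elim: i tau => [|i IH] tau.
  rewrite rmorphM /= iter_translation_sum mulr_sumr big_seq [RHS]big_seq.
  by apply: eq_bigr => t tp; rewrite (paths_nth0 tp) mulrA.
rewrite iterS {1}/translation_sum rmorph_sum addSn big_pathsS; apply: eq_bigr => eta _.
rewrite rmorphM /= TD IH mulr_sumr big_seq [RHS]big_seq; apply: eq_bigr => p pp.
rewrite (path_weight_cons pp) /= (last_cons pp) !mulrA; congr (_ * _ * _).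
by rewrite mulrC.
Qed.

End PathExpansion.

Section Binomial.

Variables (K : fieldType) (L : {additive K -> K}) (h : K).

(** [ad L] is the difference of two commuting operations, composition with [L] on the left and on
    the right, so the binomial theorem applies. *)
Lemma iter_ad_binomial d x :
  iter d (ad_op L) (fun y => h * y) x =
  \sum_(i < d.+1) ((-1) ^+ (d - i) * 'C(d, i)%:R) * iter i L (h * iter (d - i) L x).
Proof.
elim: d x => [|d IH] x.
  by rewrite big_ord1 /= expr0 mul1r mul1r.
rewrite iterS /ad_op -/(ad_op L) !IH.
pose M i := iter i L (h * iter (d.+1 - i) L x).
have Lc (e c : nat) (y : K) : L ((-1) ^+ e * c%:R * y) = (-1) ^+ e * c%:R * L y.
  have Ln z : L (c%:R * z) = c%:R * L z by rewrite mulr_natl raddfMn mulr_natl.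
  rewrite -!mulrA -signr_odd; case: (odd e); last by rewrite !mul1r.
  by rewrite expr1 !mulN1r raddfN /= Ln.
have e1 : L (\sum_(i < d.+1) ((-1) ^+ (d - i) * 'C(d, i)%:R) * iter i L (h * iter (d - i) L x)) =
    \sum_(i < d.+1) ((-1) ^+ (d - i) * 'C(d, i)%:R) * M i.+1.
  by rewrite raddf_sum; apply: eq_bigr => i _; rewrite /= Lc /M subSS.
have e2 : \sum_(i < d.+1) ((-1) ^+ (d - i) * 'C(d, i)%:R) * iter i L (h * iter (d - i) L (L x)) =
    \sum_(i < d.+1) ((-1) ^+ (d - i) * 'C(d, i)%:R) * M i.
  apply: eq_bigr => i _; congr (_ * iter i L (h * _)).
  by rewrite /M -iterSr subSn // -ltnS.
pose s i : K := (-1) ^+ (d.+1 - i).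
have e3 : \sum_(i < d.+2) s i * 'C(d.+1, i)%:R * M i =
    \sum_(i < d.+2) s i * 'C(d, i)%:R * M i + \sum_(i < d.+1) s i.+1 * 'C(d, i)%:R * M i.+1.
  rewrite big_ord_recl [X in _ = X + _]big_ord_recl !bin0 -addrA; congr (_ + _).
  rewrite -big_split; apply: eq_bigr => i _; rewrite lift0 binS natrD.
  by rewrite mulrDr mulrDl.
rewrite e1 e2 [RHS]e3 [X in _ = X + _]big_ord_recr /= bin_small // mulr0 mul0r addr0 addrC -sumrN.
congr (_ + _); apply: eq_bigr => i _.
by rewrite /s subSn -1?ltnS // exprS mulN1r !mulNr.
Qed.

End Binomial.

Lemma sum_fiber (A : nmodType) (I J : eqType) (s : seq I) (r : seq J) (l : I -> J)
    (F : I -> J -> A) : uniq r -> {in s, forall t, l t \in r} ->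
  \sum_(t <- s) F t (l t) = \sum_(j <- r) \sum_(t <- s | l t == j) F t j.
Proof.
move=> ur sr; rewrite (exchange_big_dep predT) //= big_seq [RHS]big_seq.
apply: eq_bigr => t ts; rewrite big_mkcond (bigD1_seq (l t)) ?sr //= eqxx.
by rewrite big1 ?addr0 // => j; rewrite eq_sym => /negPf ->.
Qed.

Section FormalIdentity.

Context {R : realType} {n : nat} (G : datum n) (ax : lattice_axioms G).
Variable rho : 'rV[R[i]]_n.
Local Notation P := {mpoly R[i][n]}.
Local Notation K := {fraction {mpoly R[i][n]}}.

Lemma Lop_is_zmod_morphism : zmod_morphism (Lop G rho).
Proof. by move=> f g; rewrite LopD LopN. Qed.

HB.instance Definition _ := GRing.isZmodMorphism.Build K K (Lop G rho) Lop_is_zmod_morphism.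

Lemma ell_Lambda_deg d tau : tau \in Lambda_deg G d -> pairing tau (ell G) = d%:Z.
Proof.
elim: d tau => [|d IH] tau /=; first by rewrite inE => /eqP ->; rewrite pairing0l.
case/imfset2P => sigma /= sL [eta etaL ->]; rewrite pairingDl (IH _ sL) (ell_Lambda1 ax etaL).
by rewrite -addn1 PoszD.
Qed.

Lemma frac_natS_neq0 k : k.+1%:R != 0 :> K.
Proof.
rewrite -(rmorph_nat (@to_frac R n)) to_frac_eq0 -mpolyC_nat mpolyC_eq0 pnatr_eq0.
by [].
Qed.

Lemma frac_fact_neq0 k : (k`!)%:R != 0 :> K.
Proof. by rewrite -(prednK (fact_gt0 k)) frac_natS_neq0. Qed.

Lemma fact_binomial (F : fieldType) (d i : nat) (s : F) : (forall k, k`!%:R != 0 :> F) ->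
  (i <= d)%N -> (d`!%:R)^-1 * (s * 'C(d, i)%:R) = s / ((i`! * (d - i)`!)%N)%:R.
Proof.
move=> nz le; rewrite -(bin_fact le) !natrM.
have nb : 'C(d, i)%:R != 0 :> F.
  by have := nz d; rewrite -(bin_fact le) natrM mulf_eq0 negb_or => /andP [].
have := nz i; have := nz (d - i)%N.
move: (i`!%:R : F) ((d - i)`!%:R : F) ('C(d, i)%:R : F) nb => a b c nc na nb.
by field; rewrite nc na nb.
Qed.

(** Dividing the binomial expansion by [d!] produces the coefficients of [b_]; the paths are then
    grouped by end point. *)
Lemma iter_ad_paths d (h : P) g :
  (d`!%:R)^-1 * iter d (ad_L G rho) (fun f => to_frac h * f) g =
  \sum_(tau <- Lambda_deg G d) b_ G rho h tau * Ttr tau g.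
Proof.
rewrite (iter_ad_binomial (Lop G rho) (to_frac h) d g) mulr_sumr.
pose w (t : seq 'rV[int]_n) := \prod_(i < d) Ttr t`_i (f_ G rho (t`_i.+1 - t`_i)).
pose c (i : nat) : K := (-1) ^+ (d - i) / ((i`! * (d - i)`!)%N)%:R.
transitivity (\sum_(t <- paths G d 0) (\sum_(i < d.+1) c i * to_frac (shift_poly t`_i h)) * w t *
    Ttr (last 0 t) g).
  transitivity (\sum_(i < d.+1) \sum_(t <- paths G d 0)
      c i * (to_frac (shift_poly t`_i h) * w t * Ttr (last 0 t) g)).
    apply: eq_bigr => i _; rewrite mulrA (fact_binomial _ frac_fact_neq0) -1?ltnS //.
    rewrite -mulr_sumr; congr (_ * _).
    have := @iter_mul_iter n G K (fun eta => Ttr eta) (f_ G rho) (@TtrD R n) i (d - i) (to_frac h) 0 g.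
    rewrite /= Ttr0 subnKC -1?ltnS // => ->.
    by apply: eq_bigr => t _; rewrite Ttr_poly.
  rewrite exchange_big; apply: eq_bigr => t _; rewrite !mulr_suml.
  by apply: eq_bigr => i _; rewrite !mulrA.
rewrite (sum_fiber (l := fun t => last 0 t) (fun t tau => (\sum_(i < d.+1) c i * to_frac (shift_poly t`_i h)) * w t * Ttr tau g) (fset_uniq (Lambda_deg G d))).
  rewrite big_seq [RHS]big_seq; apply: eq_bigr => tau tL.
  by rewrite /b_ (ell_Lambda_deg tL) -mulr_suml.
by move=> t tp /=; have [s sL ->] := paths_last tp; rewrite add0r.
Qed.

Lemma Dop_exp_ad_L h : Dop G rho h =1 exp_ad_L G rho h.
Proof. by move=> f; apply: eq_bigr => d _; rewrite iter_ad_paths. Qed.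

End FormalIdentity.

(** * The polynomials [p_lambda] *)

Section Eigenbasis.

Context {R : realType} {n : nat} (G : datum n) (ax : lattice_axioms G).
Hypothesis C8 : axiom_C8 R G.
Variable rho : 'rV[R[i]]_n.
Hypothesis prop : propagates_vanishing G rho.
Hypothesis uni : unisolvent_uniq G rho.
Hypothesis ex : unisolvent_ex G rho.
Local Notation C := R[i].
Local Notation P := {mpoly C[n]}.
Local Notation K := {fraction {mpoly C[n]}}.
Local Notation level := (fun nu => pairing nu (ell G)).
Implicit Types (p q f g h : P) (eta mu nu lambda tau : 'rV[int]_n).

Lemma shift_level_poly eta : eta \in Lambda1 G ->
  shift_poly eta (level_poly G rho) = level_poly G rho - 1.
Proof.
move=> etaL; apply: evalV_inj => v; rewrite evalVB evalV1; apply: etrans (evalV_shift _ _ _) _.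
rewrite /level_poly !evalVB !evalVC !evalV_linpoly linvalB linval_toV (ell_Lambda1 ax etaL).
by rewrite addrAC.
Qed.

Lemma Lop_level_poly (f : K) : Lop G rho (to_frac (level_poly G rho) * f) =
  (to_frac (level_poly G rho) - 1) * Lop G rho f.
Proof.
rewrite /Lop mulr_sumr big_seq [RHS]big_seq; apply: eq_bigr => eta etaL.
rewrite rmorphM mulrCA; congr (_ * _).
by rewrite [LHS]Ttr_poly (shift_level_poly etaL) rmorphB rmorph1.
Qed.

Lemma graded_eigen k q : W_invariant G q -> (msize q <= k.+1)%N -> vanishes_below G rho k q ->
  Lop G rho (to_frac q) = (to_frac (level_poly G rho) - k%:R) * to_frac q.
Proof.
move=> qinv qk qvan; have [h [hinv Hh hq]] := euler_image_ex ax C8 prop qinv.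
have e : h = k%:R *: q.
  apply/eqP; rewrite -subr_eq0; apply/eqP; apply: (uni (m := k)).
  - by apply: W_invariantB => //; apply: W_invariantZ.
  - exact: (unisolvent_euler ax C8 prop uni ex).
  move=> nu nuL nuk; rewrite evalVB evalVZ (euler_image_eval prop qinv Hh nuL).
    by rewrite qvan // !mulr0 subrr.
  by move=> mu muL e; apply: qvan => //; rewrite e; lia.
rewrite [LHS]Hh e -mul_mpolyC mpolyC_nat -mulrBl rmorphM rmorphB /=.
by rewrite rmorph_nat.
Qed.

(** A Newton expansion: the first component interpolates [f] up to level [i], and the remainder
    vanishes one level further. With no degrees left, uniqueness makes the remainder zero. *)
Lemma graded_decomp e i f : W_invariant G f -> (msize f <= i + e)%N ->
  vanishes_below G rho i f -> exists q : nat -> P,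
  [/\ f = \sum_(j < e) q j, vanishes_below G rho i.+1 (f - q 0%N),
      forall j, (e <= j)%N -> q j = 0 &
      forall j, [/\ W_invariant G (q j), (msize (q j) <= (i + j).+1)%N &
                   vanishes_below G rho (i + j) (q j)]].
Proof.
elim: e i f => [|e IH] i f finv fm fvan.
  have f0 : f = 0 by apply: (uni (m := i)) => //; rewrite -(addn0 i).
  exists (fun=> 0); rewrite f0 subrr big_ord0; split=> // [|j].
    by move=> mu _ _; rewrite evalV0.
  rewrite msize0; split=> //; first exact: W_invariant0.
  by move=> mu _ _; rewrite evalV0.
have [g [ginv gm gv]] := ex i.+1 (fun mu => evalV f (rho + toV mu)).
have van : vanishes_below G rho i.+1 (f - g) by move=> mu muL mui; rewrite evalVB gv ?subrr.
have fgm : (msize (f - g) <= i.+1 + e)%N.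
  by apply: msizeB_bound; rewrite ?addSnnS // (leq_trans gm) // addnS ltnS leq_addr.
have [q [fq _ q0 Hq]] := IH i.+1 (f - g) (W_invariantB finv ginv) fgm van.
exists (fun j => if j is j'.+1 then q j' else g); split=> //.
- by rewrite big_ord_recl /= -fq addrC subrK.
- by case.
case=> [|j]; last by rewrite addnS -addSn.
rewrite addn0; split=> // mu muL mui; rewrite gv ?fvan //.
by apply: lt_trans mui _; rewrite ltz_nat.
Qed.

Lemma is_p_unique lambda p q : Lambda_plus G lambda ->
  is_p G rho lambda p -> is_p G rho lambda q -> p = q.
Proof.
move=> lL [pinv pm pv] [qinv qm qv].
have l0 := Lambda_plus_ge0 ax lL (ell_nonneg ax).
apply/eqP; rewrite -subr_eq0; apply/eqP; apply: (uni (m := `|level lambda|.+1)).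
- exact: W_invariantB.
- by apply: msizeB_bound; move: pm qm; case: (msize p) (msize q); lia.
by move=> mu muL mul; rewrite evalVB pv ?qv ?subrr //; lia.
Qed.

Lemma is_p_vanishes lambda p : Lambda_plus G lambda -> is_p G rho lambda p -> vanishes_below G rho `|level lambda| p.
Proof.
move=> lL [_ _ pv] mu muL mul.
have l0 := Lambda_plus_ge0 ax lL (ell_nonneg ax).
have m0 := Lambda_plus_ge0 ax muL (ell_nonneg ax).
rewrite pv //; last by lia.
by case: eqP => // e; move: mul; rewrite e; lia.
Qed.

Lemma is_p_ex : exists p : 'rV[int]_n -> P,
  forall lambda, Lambda_plus G lambda -> is_p G rho lambda (p lambda).
Proof.
suff : forall lambda, exists p : P, Lambda_plus G lambda -> is_p G rho lambda p.
  by move=> H; have [p pP] := @boolp.choice _ _ _ H; exists p.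
move=> lambda.
have [p [pinv pm pv]] := ex `|level lambda|.+1 (fun mu => (lambda == mu)%:R).
exists p => lL; have l0 := Lambda_plus_ge0 ax lL (ell_nonneg ax).
split=> // [|mu muL mul]; last by apply: pv => //; lia.
by move: (msize p) pm; lia.
Qed.

Lemma exp_ad_L_p lambda p h : Lambda_plus G lambda -> is_p G rho lambda p -> W_invariant G h ->
  exp_ad_L G rho h (to_frac p) =
  to_frac (evalV h (rho + toV lambda))%:MP * to_frac p.
Proof.
move=> lL Hp hinv; have [pinv pm pv] := Hp.
have l0 := Lambda_plus_ge0 ax lL (ell_nonneg ax).
pose i := `|level lambda|%N.
have pi1 : (msize p <= i.+1)%N by rewrite /i; move: (msize _) pm; lia.
have pvan := is_p_vanishes lL Hp.
have [|||q [hq qv q0 Hq]] := @graded_decomp (msize h) i (h * p).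
- exact: W_invariantM.
- have := msizeM_bound (leqnn (msize h)) pi1; rewrite addnS /= addnC.
  by [].
- by move=> mu muL mui; rewrite evalVM pvan ?mulr0.
(* Up to level [i] the only node where [h * p] can be nonzero is [lambda], so its first component is
   the multiple of [p] with the same value there. *)
have -> : to_frac (evalV h (rho + toV lambda))%:MP * to_frac p = to_frac (q 0%N).
  rewrite -rmorphM /= mul_mpolyC; congr to_frac; apply/eqP; rewrite -subr_eq0; apply/eqP.
  have [qinv qs _] := Hq 0%N; apply: (uni (m := i.+1)).
  - by apply: W_invariantB => //; apply: W_invariantZ.
  - apply: msizeB_bound; last by rewrite -(addn0 i).
    exact: leq_trans (msizeZ_le _ _) pi1.
  move=> mu muL mui; have := qv mu muL mui; rewrite !evalVB evalVM evalVZ => /eqP.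
  rewrite subr_eq0 => /eqP <-; rewrite pv //; last by rewrite /i in mui; lia.
  by case: eqP => [->|]; rewrite ?mulr0 subrr.
have e := @sum_ad_eigen K (Lop G rho) (to_frac (level_poly G rho)) Lop_level_poly _
  (to_frac h) i (msize h) (msize h) (to_frac p) (fun j => to_frac (q j)) (leqnn _).
apply: e.
- exact: frac_natS_neq0.
- exact: graded_eigen.
- by rewrite -rmorphM hq rmorph_sum.
- by move=> j; have [] := Hq j; apply: graded_eigen.
by move=> j ej; rewrite q0 // rmorph0.
Qed.

Variable p : 'rV[int]_n -> P.
Hypothesis Hp : forall lambda, Lambda_plus G lambda -> is_p G rho lambda (p lambda).

(** Triangularity: at [rho + lambda], apart from [p lambda], only terms of strictly lower level can
    contribute, and their coefficients vanish by induction. *)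
Lemma is_p_independent (s : seq 'rV[int]_n) (c : 'rV[int]_n -> C) : uniq s ->
  (forall lambda, lambda \in s -> Lambda_plus G lambda) ->
  \sum_(lambda <- s) c lambda *: p lambda = 0 -> forall lambda, lambda \in s -> c lambda = 0.
Proof.
move=> us sL s0 lambda; have [k] := ubnP `|level lambda|; elim: k lambda => // k IH lambda lk ls.
have l0 := Lambda_plus_ge0 ax (sL _ ls) (ell_nonneg ax).
have := congr1 (fun q => evalV q (rho + toV lambda)) s0.
rewrite /= evalV0 evalV_sum (bigD1_seq lambda) //= evalVZ.
have [_ _ -> //] := Hp (sL _ ls); last exact: sL.
rewrite eqxx mulr1 big_seq_cond big1 ?addr0 // => mu /andP [ms ne].
rewrite evalVZ; have m0 := Lambda_plus_ge0 ax (sL _ ms) (ell_nonneg ax).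
have [lt|ge] := ltP (level mu) (level lambda); first by rewrite IH ?mul0r //; lia.
by have [_ _ ->] := Hp (sL _ ms); rewrite ?(negPf ne) ?mulr0 //; apply: sL.
Qed.

Lemma graded_expansion k m q : (k < m)%N ->
  W_invariant G q -> (msize q <= k.+1)%N -> vanishes_below G rho k q ->
  q = \sum_(lambda <- level_seq G m | `|level lambda|%N == k)
    evalV q (rho + toV lambda) *: p lambda.
Proof.
move=> km qinv qk qvan; apply/eqP; rewrite -subr_eq0; apply/eqP.
have SP mu : mu \in level_seq G m -> `|level mu|%N == k -> Lambda_plus G mu /\ level mu = k%:Z.
  move=> /(mem_level_seq ax) [muL _] /eqP e; split=> //.
  by have := Lambda_plus_ge0 ax muL (ell_nonneg ax); lia.
apply: (uni (m := k.+1)).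
- apply: W_invariantB => //; rewrite big_seq_cond; apply: W_invariant_sum => mu /andP [mS mk].
  by apply: W_invariantZ; have [muL _] := SP _ mS mk; have [] := Hp muL.
- apply: msizeB_bound => //; apply: msize_sum_bound => mu mS mk.
  apply: leq_trans (msizeZ_le _ _) _; have [muL e] := SP _ mS mk; have [_ + _] := Hp muL.
  by rewrite e; move: (msize _); lia.
move=> nu nuL nuk; rewrite evalVB evalV_sum; have n0 := Lambda_plus_ge0 ax nuL (ell_nonneg ax).
have eP mu : mu \in level_seq G m -> `|level mu|%N == k ->
    evalV (p mu) (rho + toV nu) = (mu == nu)%:R.
  by move=> mS mk; have [muL e] := SP _ mS mk; have [_ _ ->] := Hp muL; rewrite // e; lia.
have -> : \sum_(mu <- level_seq G m | `|level mu|%N == k)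
     evalV (evalV q (rho + toV mu) *: p mu) (rho + toV nu) =
   \sum_(mu <- level_seq G m | (`|level mu|%N == k) && (mu == nu)) evalV q (rho + toV mu).
  rewrite big_mkcondr big_seq_cond [RHS]big_seq_cond; apply: eq_bigr => mu /andP [mS mk].
  by rewrite evalVZ eP //; case: eqP; rewrite ?mulr1 ?mulr0.
have [e|ne] := eqVneq `|level nu|%N k.
  rewrite (eq_bigl (pred1 nu)) => [|mu /=]; last first.
    by case: (mu =P nu) => [->|]; rewrite ?andbF // e eqxx.
  rewrite -big_filter filter_pred1_uniq ?undup_uniq //; last by apply/(mem_level_seq ax); split=> //; lia.
  by rewrite big_seq1 subrr.
rewrite big1 => [|mu /andP [/eqP mk /eqP e]]; last first.
  by move: ne; rewrite -e mk eqxx.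
by rewrite subr0 qvan //; lia.
Qed.

Lemma is_p_span q : W_invariant G q -> exists (s : seq 'rV[int]_n) (c : 'rV[int]_n -> C),
  (forall lambda, lambda \in s -> Lambda_plus G lambda) /\
  q = \sum_(lambda <- s) c lambda *: p lambda.
Proof.
move=> qinv; pose m := msize q.
have [|r [qr _ _ Hr]] := @graded_decomp m 0 q qinv (leqnn _).
  by move=> mu muL; rewrite ltNge (Lambda_plus_ge0 ax muL (ell_nonneg ax)).
exists (level_seq G m), (fun lambda => evalV (r `|level lambda|%N) (rho + toV lambda)).
split=> [lambda /(mem_level_seq ax) [] //|].
rewrite (sum_fiber (l := fun lambda => `|level lambda|%N)
  (fun lambda k => evalV (r k) (rho + toV lambda) *: p lambda) (iota_uniq 0 m)); last first.
  move=> mu /(mem_level_seq ax) [muL mum]; rewrite mem_iota /= add0n.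
  by have := Lambda_plus_ge0 ax muL (ell_nonneg ax); move: (m) mum; lia.
rewrite [LHS]qr -(big_mkord predT r) /index_iota subn0 big_seq [RHS]big_seq.
apply: eq_bigr => k; rewrite mem_iota /= add0n => km; have [rinv rk rvan] := Hr k.
exact: graded_expansion.
Qed.

End Eigenbasis.

(** * Difference operators *)

Section DifferenceOperators.

Context {R : realType} {n : nat}.
Local Notation C := R[i].
Local Notation P := {mpoly C[n]}.
Local Notation K := {fraction {mpoly C[n]}}.
Implicit Types (s r : seq ('rV[int]_n * K)) (f g : K) (X Y : K -> K).

Definition difference_sum s f : K := \sum_(x <- s) x.2 * Ttr x.1 f.

Definition difference_operator X := exists s, X =1 difference_sum s.

Lemma difference_sumD s f g :
  difference_sum s (f + g) = difference_sum s f + difference_sum s g.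
Proof. by rewrite /difference_sum -big_split; apply: eq_bigr => x _; rewrite rmorphD mulrDr. Qed.

Lemma difference_sumC s c f :
  difference_sum s (to_frac c%:MP * f) = to_frac c%:MP * difference_sum s f.
Proof.
rewrite /difference_sum mulr_sumr; apply: eq_bigr => x _.
by rewrite rmorphM /= Ttr_const mulrCA.
Qed.

Lemma difference_operator_lin X (I : Type) (r : seq I) (c : I -> C) (a : I -> K) :
  difference_operator X ->
  X (\sum_(i <- r) to_frac (c i)%:MP * a i) = \sum_(i <- r) to_frac (c i)%:MP * X (a i).
Proof.
move=> [s XE]; rewrite XE.
elim: r => [|i r IH]; last by rewrite !big_cons difference_sumD IH difference_sumC XE.
by rewrite !big_nil /difference_sum big1 // => x _; rewrite rmorph0 mulr0.
Qed.

Lemma difference_operatorD X Y : difference_operator X -> difference_operator Y ->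
  difference_operator (fun f => X f + Y f).
Proof.
move=> [s XE] [r YE]; exists (s ++ r) => f.
by rewrite /difference_sum big_cat XE YE.
Qed.

Lemma difference_operatorM (a : K) X : difference_operator X ->
  difference_operator (fun f => a * X f).
Proof.
move=> [s XE]; exists [seq (x.1, a * x.2) | x <- s] => f.
rewrite XE /difference_sum big_map mulr_sumr; apply: eq_bigr => x _.
by rewrite mulrA.
Qed.

Lemma difference_operator_comp X Y : difference_operator X -> difference_operator Y ->
  difference_operator (X \o Y).
Proof.
move=> [s XE] [r YE]; exists [seq (x.1 + y.1, x.2 * Ttr x.1 y.2) | x <- s, y <- r] => f.
rewrite /= XE /difference_sum big_allpairs_dep; apply: eq_bigr => x _ /=.
rewrite YE /difference_sum rmorph_sum mulr_sumr; apply: eq_bigr => y _ /=.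
by rewrite rmorphM /= TtrD mulrA.
Qed.

Lemma difference_operator_sum (I : Type) (r : seq I) (F : I -> K -> K) :
  (forall i, difference_operator (F i)) ->
  difference_operator (fun f => \sum_(i <- r) F i f).
Proof.
move=> HF; elim: r => [|i r [s IH]].
  by exists [::] => f; rewrite /difference_sum !big_nil.
have [t Ft] := HF i; exists (t ++ s) => f.
by rewrite big_cons Ft IH /difference_sum big_cat.
Qed.

Lemma difference_operator_translation (a : K) tau : difference_operator (fun f => a * Ttr tau f).
Proof. by exists [:: (tau, a)] => f; rewrite /difference_sum big_seq1. Qed.

Lemma difference_operator_Dop (G : datum n) rho h : difference_operator (Dop G rho h).
Proof.
do 2!apply: difference_operator_sum => ?.
exact: difference_operator_translation.
Qed.

End DifferenceOperators.

(** * Independence of translations on invariants *)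

Section Separation.

Context {R : realType} {n : nat} (G : datum n) (ax : lattice_axioms G).
Local Notation C := R[i].
Local Notation P := {mpoly C[n]}.
Local Notation K := {fraction {mpoly C[n]}}.
Local Notation lin := (@linpoly R n).

(** Definite on the dual lattice, this invariant has distinct translates by distinct lattice
    vectors. *)
Definition Phi_form : P := \sum_(omega <- Phi G) lin omega ^+ 2.

Lemma evalV_Phi_form v : evalV Phi_form v = \sum_(omega <- Phi G) linval omega v ^+ 2.
Proof.
rewrite evalV_sum; apply: eq_bigr => omega _.
by rewrite !expr2 evalVM evalV_linpoly.
Qed.

Lemma Phi_form_invariant : W_invariant G Phi_form.
Proof.
move=> w v wW; rewrite !evalV_Phi_form.
rewrite -(perm_map_sum (fun omega => linval omega (v *m act_V w) ^+ 2) (perm_Phi ax wW)).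
by apply: eq_bigr => omega _; rewrite linval_act mulKmx ?(W_unit ax).
Qed.

Lemma Phi_form_eq0 eta : evalV Phi_form (toV eta) = 0 -> eta = 0.
Proof.
rewrite evalV_Phi_form => e.
have {e} : \sum_(omega <- Phi G) pairing eta omega ^+ 2 == 0.
  rewrite -(intr_eq0 C) rmorph_sum -[X in _ == X]e; apply/eqP; apply: eq_bigr => omega _.
  by rewrite linval_toV rmorphXn.
rewrite psumr_eq0 => [/allP H|omega _]; last exact: sqr_ge0.
rewrite (sigma_dual_decomp ax eta) big1 // => i _.
have := H _ (sigma_Phi ax i); rewrite /= sqrf_eq0 => /eqP ->.
by rewrite scale0r.
Qed.

Lemma shift_Phi_form_neq tau tau' : tau != tau' ->
  to_frac (shift_poly tau Phi_form) - to_frac (shift_poly tau' Phi_form) != 0.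
Proof.
move=> ne; rewrite -rmorphB to_frac_eq0 subr_eq0; apply: contra ne => /eqP e.
have h : evalV Phi_form (toV tau - toV tau) = evalV Phi_form (toV tau - toV tau').
  apply: etrans (esym (evalV_shift tau _ (toV tau))) _.
  exact: etrans (congr1 (fun q => evalV q (toV tau)) e) (evalV_shift _ _ _).
have := Phi_form_eq0 (eta := tau - tau'); rewrite toVB -h subrr => h0.
rewrite -subr_eq0.
apply/eqP.
apply: h0.
rewrite evalV_Phi_form.
apply: big1 => omega _.
by rewrite /linval mul0mx mxE expr0n.
Qed.

Lemma weighted_sum_diff (A : comPzRingType) (I : Type) (i0 : I) (r : seq I) (c a b : I -> A) :
  \sum_(i <- i0 :: r) c i * (a i * b i) = 0 -> \sum_(i <- i0 :: r) c i * b i = 0 ->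
  \sum_(i <- r) c i * (a i - a i0) * b i = 0.
Proof.
move=> h1 h2; transitivity (\sum_(i <- i0 :: r) c i * (a i - a i0) * b i).
  by rewrite big_cons subrr mulr0 mul0r add0r.
transitivity (\sum_(i <- i0 :: r) c i * (a i * b i) - a i0 * \sum_(i <- i0 :: r) c i * b i).
  rewrite mulr_sumr -sumrB; apply: eq_bigr => i _; ring.
by rewrite h1 h2 mulr0 subrr.
Qed.

(* Dedekind's argument, with the invariant [Phi_form] separating the translations. *)
Lemma translation_independence (r : seq 'rV[int]_n) (c : 'rV[int]_n -> K) : uniq r ->
  (forall f : P, W_invariant G f -> \sum_(tau <- r) c tau * Ttr tau (to_frac f) = 0) ->
  forall tau, tau \in r -> c tau = 0.
Proof.
elim: r c => // tau0 r IH c /= /andP [tr ur] H.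
have c0 tau : tau \in r -> c tau = 0.
  move=> taur; pose d t := c t * (to_frac (shift_poly t Phi_form) - to_frac (shift_poly tau0 Phi_form)).
  have : d tau = 0.
    apply: IH => // f finv.
    apply: (weighted_sum_diff (a := fun t => to_frac (shift_poly t Phi_form))); last exact: H.
    rewrite -[RHS](H _ (W_invariantM Phi_form_invariant finv)); apply: eq_bigr => t _.
    congr (_ * _); rewrite -[X in X * _]Ttr_poly.
    by rewrite rmorphM rmorphM.
  move/eqP; rewrite mulf_eq0 (negPf (shift_Phi_form_neq _)) ?orbF => [/eqP //|].
  by apply: contraNneq tr => <-.
move=> tau; rewrite inE => /orP [/eqP ->|]; last exact: c0.
have := H 1 (@W_invariant1 R n G); rewrite big_cons rmorph1 rmorph1 mulr1.
by rewrite big_seq big1 ?addr0 // => t tr'; rewrite c0 ?mul0r.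
Qed.

Lemma difference_operator_eq (X Y : K -> K) :
  difference_operator X -> difference_operator Y ->
  (forall f : P, W_invariant G f -> X (to_frac f) = Y (to_frac f)) -> X =1 Y.
Proof.
move=> dX dY XY.
have [s sE] := difference_operatorD dX (difference_operatorM (-1) dY).
suff H f : difference_sum s f = 0.
  by move=> f; apply/eqP; rewrite -subr_eq0 -mulN1r; move: (sE f); rewrite H => ->.
pose c tau : K := \sum_(x <- s | x.1 == tau) x.2.
have group g : difference_sum s g = \sum_(tau <- undup [seq x.1 | x <- s]) c tau * Ttr tau g.
  rewrite /difference_sum (sum_fiber (l := fst) (fun x tau => x.2 * Ttr tau g)
      (undup_uniq [seq x.1 | x <- s])).
    by apply: eq_bigr => tau _; rewrite mulr_suml.
  by move=> x xs; rewrite mem_undup; apply: map_f.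
rewrite group big_seq big1 // => tau tr.
rewrite (translation_independence (undup_uniq _) _ tr) ?mul0r // => g ginv.
by rewrite -group -sE XY // mulN1r subrr.
Qed.

End Separation.

(** * Polynomial dependence on the parameter and comparison of spectra *)

Section PolynomialFamilies.

Context {R : realType} {n : nat} (G : datum n) (ax : lattice_axioms G).
Local Notation C := R[i].
Local Notation P := {mpoly C[n]}.
Local Notation K := {fraction {mpoly C[n]}}.
Local Notation pvec := (weyl_vector G).
Implicit Types (F H : C -> K) (X Y : 'rV[C]_n -> K -> K) (h : P).

(** The parameter enters as a constant, which translations fix, so [Ttr] acts on the coefficients
    alone. *)
Definition polynomial_family F := exists q : {poly K}, forall t, F t = q.[to_frac t%:MP].

Lemma polynomial_family_cst (a : K) : polynomial_family (fun=> a).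
Proof. by exists a%:P => t; rewrite hornerC. Qed.

Lemma polynomial_family_id : polynomial_family (fun t => to_frac t%:MP).
Proof. by exists 'X => t; rewrite hornerX. Qed.

Lemma polynomial_familyD F H : polynomial_family F -> polynomial_family H ->
  polynomial_family (fun t => F t + H t).
Proof. by move=> [q Fq] [r Hr]; exists (q + r) => t; rewrite hornerD Fq Hr. Qed.

Lemma polynomial_familyM F H : polynomial_family F -> polynomial_family H ->
  polynomial_family (fun t => F t * H t).
Proof. by move=> [q Fq] [r Hr]; exists (q * r) => t; rewrite hornerM Fq Hr. Qed.

Lemma polynomial_familyB F H : polynomial_family F -> polynomial_family H ->
  polynomial_family (fun t => F t - H t).
Proof. by move=> [q Fq] [r Hr]; exists (q - r) => t; rewrite hornerD hornerN Fq Hr. Qed.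

Lemma polynomial_family_sum (I : Type) (r : seq I) (F : I -> C -> K) :
  (forall i, polynomial_family (F i)) -> polynomial_family (fun t => \sum_(i <- r) F i t).
Proof.
move=> HF; elim: r => [|i r IH].
  by have [q qE] := polynomial_family_cst 0; exists q => t; rewrite big_nil (qE t).
by have [q qE] := polynomial_familyD (HF i) IH; exists q => t; rewrite big_cons qE.
Qed.

Lemma polynomial_family_prod (I : eqType) (r : seq I) (Q : pred I) (F : I -> C -> K) :
  (forall i, i \in r -> polynomial_family (F i)) ->
  polynomial_family (fun t => \prod_(i <- r | Q i) F i t).
Proof.
elim: r => [|i r IH] HF.
  by have [q qE] := polynomial_family_cst 1; exists q => t; rewrite big_nil (qE t).
have [|q qE] := IH; first by move=> j jr; apply: HF; rewrite inE jr orbT.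
case Qi: (Q i); last by exists q => t; rewrite big_cons Qi qE.
have [|r' rE] := HF i; first by rewrite inE eqxx.
by exists (r' * q) => t; rewrite big_cons Qi hornerM rE qE.
Qed.

Lemma polynomial_family_Ttr tau F : polynomial_family F -> polynomial_family (fun t => Ttr tau (F t)).
Proof.
move=> [q Fq]; exists (map_poly (Ttr tau) q) => t.
by rewrite Fq -{2}(Ttr_const tau t) horner_map.
Qed.

Lemma polynomial_family_eq0 F (N : nat) : polynomial_family F ->
  (forall k, (N <= k)%N -> F k%:R = 0) -> forall t, F t = 0.
Proof.
move=> [q Fq] F0 t; have q0 : q = 0.
  apply: (poly_eq0_infinite (x := fun k => to_frac ((N + k)%:R)%:MP)) => [j k|k].
    move/to_frac_inj/(congr1 (fun p => evalV p 0)) => /eqP.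
    by rewrite !evalVC eqr_nat eqn_add2l => /eqP.
  by rewrite -Fq F0 // leq_addr.
by rewrite Fq q0 horner0.
Qed.

Section Line.

Variables (rho : 'rV[C]_n) (V0 : in_V0 G rho).
Local Notation line t := (rho + t *: toV pvec).

Lemma polynomial_family_f eta : polynomial_family (fun t => f_ G (line t) eta).
Proof.
apply: polynomial_familyM; last exact: polynomial_family_cst.
apply: polynomial_family_prod => omega oP.
have [q qE] := polynomial_familyB (polynomial_family_cst (to_frac (linpoly omega - (k_ G rho omega)%:MP)))
  polynomial_family_id.
exists q => t; rewrite -qE (k_line ax t V0 oP) mpolyCD opprD addrA.
exact: rmorphB.
Qed.

Lemma polynomial_family_Lop F : polynomial_family F ->
  polynomial_family (fun t => Lop G (line t) (F t)).
Proof.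
move=> HF; apply: polynomial_family_sum => eta.
by apply: polynomial_familyM; [apply: polynomial_family_f|apply: polynomial_family_Ttr].
Qed.

Lemma polynomial_family_exp_ad_L h F : polynomial_family F ->
  polynomial_family (fun t => exp_ad_L G (line t) h (F t)).
Proof.
move=> HF; apply: polynomial_family_sum => d.
apply: polynomial_familyM; first exact: polynomial_family_cst.
elim: {d}(d : nat) F HF => [|d IH] F HF.
  by apply: polynomial_familyM => //; apply: polynomial_family_cst.
by apply: polynomial_familyB; [apply: polynomial_family_Lop|]; apply: IH => //; apply: polynomial_family_Lop.
Qed.

End Line.

(** A negative integer value [alpha(rho) + k alpha(p)] would make [alpha(rho)] an integer below
    [- k], since [alpha(p)] is at least 1; the bound need only exceed the real parts. *)
Lemma dominant_line (rho : 'rV[C]_n) : exists N, forall k : nat, (N <= k)%N -> dominant G (rho + k%:R *: toV pvec).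
Proof.
pose B := \sum_(alpha <- Delta_plus G) Num.bound `|complex.Re (linval alpha rho)|.
exists B => k Bk alpha aD m m0.
rewrite linvalD linvalZ linval_toV => e.
have {}e : linval alpha rho = (m - k%:Z * pairing pvec alpha)%:~R.
  by rewrite rmorphB rmorphM /= -e -pmulrn addrK.
have Re_int (x : int) : complex.Re (x%:~R : C) = x%:~R.
  by rewrite -(rmorph_int (@real_complex R)).
have := archi_boundP (normr_ge0 (complex.Re (linval alpha rho))).
have Nk : (Num.bound `|complex.Re (linval alpha rho)| <= k)%N.
  by apply: leq_trans Bk; rewrite /B (big_rem alpha) //= leq_addr.
rewrite ltNge => /negP; apply; apply: (@le_trans _ _ k%:R); first by rewrite ler_nat.
rewrite e Re_int -intr_norm pmulrn ler_int ler0_norm; have pa := weyl_vector_root ax aD; nia.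
Qed.

Hypotheses (C8 : axiom_C8 R G) (C9 : axiom_C9 R G).

(** What suffices to recover operators from their eigenvalues. The second clause allows the argument
    to vary with [t], which makes the notion stable under composition. *)
Definition spectral_family X (a : 'rV[C]_n -> C) : Prop :=
  [/\ forall rho, difference_operator (X rho),
      forall rho F, in_V0 G rho -> polynomial_family F ->
        polynomial_family (fun t => X (rho + t *: toV pvec) (F t)) &
      forall rho lambda p, in_V0 G rho -> dominant G rho -> Lambda_plus G lambda ->
        is_p G rho lambda p ->
        X rho (to_frac p) = to_frac (a (rho + toV lambda))%:MP * to_frac p].

Lemma spectral_family_Dop h : W_invariant G h -> spectral_family (fun rho => Dop G rho h) (evalV h).
Proof.
move=> hinv; split=> [rho|rho F V0 HF|rho lambda p V0 dom lL Hp].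
- exact: difference_operator_Dop.
- have [q qE] := polynomial_family_exp_ad_L V0 h HF.
  by exists q => t; rewrite (Dop_exp_ad_L ax) qE.
have prop := propagates_vanishing_dominant ax C8 C9 V0 dom.
have [uni ex] := unisolvent ax C8 C9 prop.
by rewrite (Dop_exp_ad_L ax); apply: exp_ad_L_p.
Qed.

Lemma spectral_familyD X Y a b : spectral_family X a -> spectral_family Y b ->
  spectral_family (fun rho f => X rho f + Y rho f) (fun v => a v + b v).
Proof.
move=> [dX pX eX] [dY pY eY]; split=> [rho|rho F V0 HF|rho lambda p V0 dom lL Hp].
- exact: difference_operatorD.
- by apply: polynomial_familyD; [apply: pX|apply: pY].
by rewrite (eX _ lambda) ?(eY _ lambda) // mpolyCD rmorphD mulrDl.
Qed.

Lemma spectral_familyZ (c : C) X a : spectral_family X a ->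
  spectral_family (fun rho f => to_frac c%:MP * X rho f) (fun v => c * a v).
Proof.
move=> [dX pX eX]; split=> [rho|rho F V0 HF|rho lambda p V0 dom lL Hp].
- exact: difference_operatorM.
- by apply: polynomial_familyM; [apply: polynomial_family_cst|apply: pX].
by rewrite (eX _ lambda) // mpolyCM rmorphM mulrA.
Qed.

Lemma spectral_family_comp X Y a b : spectral_family X a -> spectral_family Y b ->
  spectral_family (fun rho => X rho \o Y rho) (fun v => a v * b v).
Proof.
move=> [dX pX eX] [dY pY eY]; split=> [rho|rho F V0 HF|rho lambda p V0 dom lL Hp].
- exact: difference_operator_comp.
- by apply: (pX rho (fun t => Y (rho + t *: toV pvec) (F t))) => //; apply: pY.
rewrite /= (eY _ lambda) //.
have := difference_operator_lin [:: to_frac p] (fun=> b (rho + toV lambda)) id (dX rho).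
by rewrite !big_seq1 (eX _ lambda) // => ->; rewrite mulrCA mulrA mpolyCM rmorphM.
Qed.

Lemma spectral_family_eq X Y a b : spectral_family X a -> spectral_family Y b -> a =1 b ->
  forall rho, in_V0 G rho -> X rho =1 Y rho.
Proof.
move=> [dX pX eX] [dY pY eY] ab rho V0.
apply: (difference_operator_eq ax) => // f finv.
pose line (t : C) := rho + t *: toV pvec.
have cst := polynomial_family_cst (to_frac f).
have fam := polynomial_familyB (pX _ _ V0 cst) (pY _ _ V0 cst).
have [N HN] := dominant_line rho.
suff H t : X (line t) (to_frac f) - Y (line t) (to_frac f) = 0.
  by have /eqP := H 0; rewrite subr_eq0 /line scale0r addr0 => /eqP.
apply: (polynomial_family_eq0 (N := N) fam) => k Nk.
have V0k : in_V0 G (line k%:R) := V0_line ax _ V0.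
have domk : dominant G (line k%:R) := HN k Nk.
have prop := propagates_vanishing_dominant ax C8 C9 V0k domk.
have [uni ex] := unisolvent ax C8 C9 prop.
have [p Hp] := is_p_ex ax ex.
have [s [c [sL ->]]] := is_p_span ax uni ex Hp finv.
have -> : to_frac (\sum_(lambda <- s) c lambda *: p lambda) =
    \sum_(lambda <- s) to_frac (c lambda)%:MP * to_frac (p lambda).
  by rewrite rmorph_sum; apply: eq_bigr => l _; rewrite -mul_mpolyC rmorphM.
rewrite (difference_operator_lin _ _ _ (dX _)) (difference_operator_lin _ _ _ (dY _)).
apply/eqP; rewrite subr_eq0; apply/eqP.
rewrite big_seq [RHS]big_seq; apply: eq_bigr => lambda ls.
have lL := sL _ ls.
by rewrite (eX _ lambda) ?(eY _ lambda) ?ab //; apply: Hp.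
Qed.

End PolynomialFamilies.

Theorem theorem5p8 (R : realType) (n : nat) (G : datum n)
    (Sigma_basis : Sigma G \in unitmx)
    (W_group : is_finite_automorphism_group G)
    (C1 : axiom_C1 R G)
    (Delta_roots : is_root_system G)
    (C2 : axiom_C2 G)
    (C3 : axiom_C3 G)
    (C4 : axiom_C4 G)
    (C5 : axiom_C5 G)
    (C6 : axiom_C6 G)
    (C7 : axiom_C7 G)
    (C8 : axiom_C8 R G)
    (C9 : axiom_C9 R G)
    (rho : 'rV[R[i]]_n)
    (rho_V0 : in_V0 G rho) :
  [/\ (* (a) *)
      forall h : {mpoly R[i][n]}, W_invariant G h ->
        Dop G rho h =1 exp_ad_L G rho h,
      (* (b) *)
      [/\ Dop G rho 1 =1 id,
          forall h g : {mpoly R[i][n]}, W_invariant G h -> W_invariant G g ->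
            Dop G rho (h + g) =1 (fun f => Dop G rho h f + Dop G rho g f),
          forall (c : R[i]) (h : {mpoly R[i][n]}), W_invariant G h ->
            Dop G rho (c *: h) =1 (fun f => to_frac c%:MP * Dop G rho h f),
          forall h g : {mpoly R[i][n]}, W_invariant G h -> W_invariant G g ->
            Dop G rho (h * g) =1 Dop G rho h \o Dop G rho g &
          forall h g : {mpoly R[i][n]}, W_invariant G h -> W_invariant G g ->
            Dop G rho h \o Dop G rho g =1 Dop G rho g \o Dop G rho h] &
      (* (c) *)
      dominant G rho ->
        exists p : 'rV[int]_n -> {mpoly R[i][n]},
          [/\ forall lambda, Lambda_plus G lambda ->
                unique (is_p G rho lambda) (p lambda),
              invariant_basis G p &
              forall lambda, Lambda_plus G lambda ->
              forall h : {mpoly R[i][n]}, W_invariant G h ->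
                Dop G rho h (to_frac (p lambda)) =
                to_frac (evalV h (rho + toV lambda))%:MP * to_frac (p lambda)]].
Proof.
have ax : lattice_axioms G by split.
have spec := spectral_family_Dop ax C8 C9.
have eq_of := spectral_family_eq ax C8 C9.
split.
- by move=> h _; apply: Dop_exp_ad_L.
- split=> [f|h g hinv ginv|c h hinv|h g hinv ginv|h g hinv ginv].
  + by rewrite (Dop_exp_ad_L ax) /exp_ad_L msize1 big_ord1 /= invr1 mul1r rmorph1 mul1r.
  (* The eigenvalues are values of [h] at points, and evaluation is an algebra homomorphism; each
     identity below reduces to the corresponding one for values. *)
  + apply: (eq_of _ _ _ _ (spec _ (W_invariantD hinv ginv)) (spectral_familyD (spec _ hinv) (spec _ ginv)) _ _ rho_V0) => v.
    exact: evalVD.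
  + apply: (eq_of _ _ _ _ (spec _ (W_invariantZ c hinv)) (spectral_familyZ c (spec _ hinv)) _ _ rho_V0) => v.
    exact: evalVZ.
  + apply: (eq_of _ _ _ _ (spec _ (W_invariantM hinv ginv)) (spectral_family_comp (spec _ hinv) (spec _ ginv)) _ _ rho_V0) => v.
    exact: evalVM.
  apply: (eq_of _ _ _ _ (spectral_family_comp (spec _ hinv) (spec _ ginv)) (spectral_family_comp (spec _ ginv) (spec _ hinv)) _ _ rho_V0) => v.
  exact: mulrC.
move=> dom; have prop := propagates_vanishing_dominant ax C8 C9 rho_V0 dom.
have [uni ex] := unisolvent ax C8 C9 prop.
have [p Hp] := is_p_ex ax ex.
exists p; split=> [lambda lL||lambda lL h hinv].
- by split=> [|q]; [apply: Hp|apply: (is_p_unique ax uni lL); apply: Hp].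
- split=> [lambda lL|s c|q]; first by have [] := Hp _ lL.
    exact: (is_p_independent ax Hp).
  exact: (is_p_span ax uni ex Hp).
by rewrite (Dop_exp_ad_L ax); apply: (exp_ad_L_p ax C8 prop uni ex lL (Hp _ lL) hinv).
Qed.
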